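(* Observational equivalence $\simeq$ is a congruence: it is an equivalence relation on terms and, whenever $P\simeq Q$, we have $\alpha.P\simeq\alpha.Q$ for every action $\alpha$, $P|R\simeq Q|R$, $R|P\simeq R|Q$, $P\parallel R\simeq Q\parallel R$, $R\parallel P\simeq R\parallel Q$ for every term $R$, $\diamond P\simeq\diamond Q$, and $\nu x\,P\simeq\nu x\,Q$ for every name $x$.
   Context: Fix a commutative semiring $(\mathbb K,+,\cdot,0,1)$ and a countable set $\mathcal N$ of names. Polarities are $+,-$; $\neg$ exchanges them. An action is $u^\varepsilon(x)$ with $u,x\in\mathcal N$, $\varepsilon$ a polarity ($u$ is its subject; $x$ is bound in the continuation). Terms (finite, no recursion): $P,Q::=k\mid \alpha.P\mid \diamond P\mid P|Q\mid P\parallel Q\mid \nu x\,P$ with $k\in\mathbb K$ ($|$: parallel composition with interaction; $\parallel$: without interaction; $\nu x$: hiding). Terms are taken up to injective renaming of bound names and $\nu x\nu y P=\nu y\nu x P$, bound names distinct from all other names. Positions are finite sequences of integers ordered by prefix; independent means incomparable. Labels: visible $u^\varepsilon(x):\iota$ or internal $(\iota,\kappa)$; $\iota.a$ prefixes every position of $a$ with $\iota$. Transitions: $\alpha.P\xrightarrow{\alpha:\epsilon}\diamond P$ ($\epsilon$ the empty position); if $P\xrightarrow{a}P'$ then $\diamond P\xrightarrow{1.a}\diamond P'$, $P|Q\xrightarrow{1.a}P'|Q$, $Q|P\xrightarrow{2.a}Q|P'$, $P\parallel Q\xrightarrow{1.a}P'\parallel Q$, $Q\parallel P\xrightarrow{2.a}Q\parallel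 P'$, and $\nu xP\xrightarrow{a}\nu xP'$ if $x\notin a$; if $P\xrightarrow{u^\varepsilon(x):\iota}P'$ and $Q\xrightarrow{u^{\neg\varepsilon}(y):\kappa}Q'$ then $P|Q\xrightarrow{(1.\iota,2.\kappa)}\nu x(P'|Q'[x/y])$. A path is a finite sequence of internal labels; it is valid for $P$ if it labels a sequence of transitions from $P$, reaching $P/p$. Labels are independent if all their positions are pairwise independent; homotopy is the smallest congruence on label sequences with $ab\sim ba$ for independent $a,b$. A run of $P$ is a homotopy class of maximal valid paths of $P$ (valid paths that are not a proper prefix of a valid path); $\mathrm{Runs}(P)$ is the (finite) set of runs and $P/\rho$ is well defined. The state is $s(k)=k$, $s(\alpha.P)=1$, $s(\diamond P)=s(\nu xP)=s(P)$, $s(P|Q)=s(P\parallel Q)=s(P)s(Q)$. The outcome is $\langle P\rangle=\sum_{\rho\in\mathrm{Runs}(P)}s(P/\rho)$. Observational equivalence: $P\simeq Q$ iff $\langle P|R\rangle=\langle Q|R\rangle$ for all terms $R$. *)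

(* Defs.v *)
From HB Require Import structures.
From mathcomp Require Import all_boot all_order all_algebra.
From Stdlib Require Import ClassicalEpsilon.
Set Implicit Arguments. Unset Strict Implicit. Unset Printing Implicit Defensive.
Import GRing.Theory.

Section Calculus.
Variable K : comPzSemiRingType.

(* Names: nat.  Polarities: bool (true = +, false = -; negb = ¬). *)
Definition name := nat.

(* A name occurrence (subject of an action): free name or de Bruijn index
   pointing to an enclosing binder (an action object or a ν). *)
Inductive nm := F of name | B of nat.

(* Act u e P  is  u^e(x).P  where x is bound (index 0) in P;
   Nu P       is  ν x P     where x is bound (index 0) in P. *)
Inductive term :=
| Const of K
| Act of nm & bool & term
| Diam of term
| Par of term & term
| SPar of term & term
| Nu of term.

Definition nm_open k x (u : nm) := match u with B i => if i == k then F x else u | _ => u end.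
Definition nm_close k x (u : nm) := match u with F y => if y == x then B k else u | _ => u end.
Definition nm_rename y x (u : nm) := match u with F z => if z == y then F x else u | _ => u end.

Fixpoint open_rec k x P := match P with
| Const c => Const c
| Act u e P => Act (nm_open k x u) e (open_rec k.+1 x P)
| Diam P => Diam (open_rec k x P)
| Par P Q => Par (open_rec k x P) (open_rec k x Q)
| SPar P Q => SPar (open_rec k x P) (open_rec k x Q)
| Nu P => Nu (open_rec k.+1 x P) end.

Fixpoint close_rec k x P := match P with
| Const c => Const c
| Act u e P => Act (nm_close k x u) e (close_rec k.+1 x P)
| Diam P => Diam (close_rec k x P)
| Par P Q => Par (close_rec k x P) (close_rec k x Q)
| SPar P Q => SPar (close_rec k x P) (close_rec k x Q)
| Nu P => Nu (close_rec k.+1 x P) end.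

Fixpoint rename y x P := match P with
| Const c => Const c
| Act u e P => Act (nm_rename y x u) e (rename y x P)
| Diam P => Diam (rename y x P)
| Par P Q => Par (rename y x P) (rename y x Q)
| SPar P Q => SPar (rename y x P) (rename y x Q)
| Nu P => Nu (rename y x P) end.

Definition open x P := open_rec 0 x P.
Definition close x P := close_rec 0 x P.

Fixpoint fv P : seq name := match P with
| Const _ => [::]
| Act u _ P => (if u is F x then [:: x] else [::]) ++ fv P
| Diam P | Nu P => fv P
| Par P Q | SPar P Q => fv P ++ fv Q end.

Fixpoint lc_at k P := match P with
| Const _ => true
| Act u _ P => (if u is B i then i < k else true) && lc_at k.+1 P
| Diam P => lc_at k P
| Par P Q | SPar P Q => lc_at k P && lc_at k Q
| Nu P => lc_at k.+1 P end.
Definition lc P := lc_at 0 P.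

Definition act (u : name) (e : bool) (x : name) P := Act (F u) e (close x P).
Definition nu (x : name) P := Nu (close x P).

Definition position := seq nat.
Inductive label :=
| Vis of name & bool & name & position   (* u^e(x) : iota *)
| Int of position & position.

Definition lprefix (i : nat) (a : label) := match a with
| Vis u e x p => Vis u e x (i :: p)
| Int p q => Int (i :: p) (i :: q) end.

Definition lnames (a : label) : seq name :=
  match a with Vis u _ x _ => [:: u; x] | Int _ _ => [::] end.

(* the bound name of a visible label is fresh for the other component
   (Barendregt convention: bound names distinct from all other names) *)
Definition fresh_for (a : label) (Q : term) :=
  match a with Vis _ _ x _ => x \notin fv Q | Int _ _ => true end.

Inductive step : term -> label -> term -> Prop :=
| st_act u e x P : x \notin fv (Act (F u) e P) ->
    step (Act (F u) e P) (Vis u e x [::]) (Diam (open x P))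
| st_diam P a P' : step P a P' -> step (Diam P) (lprefix 1 a) (Diam P')
| st_parL P Q a P' : step P a P' -> fresh_for a Q ->
    step (Par P Q) (lprefix 1 a) (Par P' Q)
| st_parR P Q a Q' : step Q a Q' -> fresh_for a P ->
    step (Par P Q) (lprefix 2 a) (Par P Q')
| st_sparL P Q a P' : step P a P' -> fresh_for a Q ->
    step (SPar P Q) (lprefix 1 a) (SPar P' Q)
| st_sparR P Q a Q' : step Q a Q' -> fresh_for a P ->
    step (SPar P Q) (lprefix 2 a) (SPar P Q')
| st_nu P z a P' : z \notin fv P -> z \notin lnames a ->
    step (open z P) a P' -> step (Nu P) a (Nu (close z P'))
| st_comm P Q u e x y i k P' Q' :
    step P (Vis u e x i) P' -> step Q (Vis u (~~ e) y k) Q' -> x \notin fv Q ->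
    step (Par P Q) (Int (1 :: i) (2 :: k)) (Nu (close x (Par P' (rename y x Q')))).

Definition path := seq (position * position).

Inductive valid_to : term -> path -> term -> Prop :=
| vt_nil P : valid_to P [::] P
| vt_cons P i k P1 p P2 : step P (Int i k) P1 -> valid_to P1 p P2 ->
    valid_to P ((i, k) :: p) P2.

Definition valid P p := exists P', valid_to P p P'.

Definition maximal P (p : path) :=
  valid P p /\ forall q, valid P q -> prefix p q -> p = q.

Definition indep_pos (p q : position) := ~~ prefix p q && ~~ prefix q p.

Definition indep_lab (a b : position * position) :=
  [/\ indep_pos a.1 b.1, indep_pos a.1 b.2, indep_pos a.2 b.1 & indep_pos a.2 b.2].

Inductive homot : path -> path -> Prop :=
| ho_refl p : homot p p
| ho_sym p q : homot p q -> homot q p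
| ho_trans p q r : homot p q -> homot q r -> homot p r
| ho_swap s t a b : indep_lab a b -> homot (s ++ a :: b :: t) (s ++ b :: a :: t).

Fixpoint state P : K := match P with
| Const k => k
| Act _ _ _ => 1
| Diam P | Nu P => state P
| Par P Q | SPar P Q => state P * state Q end.

Definition runs_repr P (rs : seq (path * term)) :=
  [/\ forall r, List.In r rs -> maximal P r.1 /\ valid_to P r.1 r.2,
      forall i j, i < j < size rs ->
        ~ homot (nth ([::], P) rs i).1 (nth ([::], P) rs j).1 &
      forall p, maximal P p -> exists2 r, List.In r rs & homot p r.1].

Definition outcome_is P (k : K) :=
  exists rs, runs_repr P rs /\ k = (\sum_(r <- rs) state r.2)%R.

(* <P> : the (unique, by finiteness of Runs(P) and well-definedness of P/rho)
   value k with outcome_is P k *)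
Definition outcome P : K := epsilon (inhabits 0%R) (outcome_is P).

Definition obs_equiv P Q := forall R, lc R -> outcome (Par P R) = outcome (Par Q R).

End Calculus.

(* Main.v *)
(* Two valid paths are homotopic iff they are permutations of each other, because later labels of
   a path never use a position above an earlier one; so runs are sets of labels, and an outcome
   is a sum over maximal sets.  Opening all hidings that are not under an action turns the effect
   of a label into local replacements at incomparable positions, up to the choice of fresh names.

   Relabelling positions gives <(P|R)|S> = <P|(R|S)>, <P|R> = <R|P>, <(diamond P)|S> = <P|S> and
   <(nu x P)|S> = <P[z/x]|S> for fresh z, hence the cases of |, diamond and nu.

   For a prefix, the outcome of a.P|S is the sum over the runs where a does not fire plus the sum,
   over the minimal sets of labels firing a, of the outcomes <P[z/x]|S'> of what remains.  The
   minimal sets only depend on the prefix and on S.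

   For P||R observed by S, the runs of (P||R)|S are classified by a guess t: which actions of R
   and S fire, and whether their partners are in R.  There are terms T_t such that
   <(P||R)|S> = sum over t of <P|T_t>.  T_t is R|S with fresh copies of the free names that
   prevent R from interacting with P, and with tests of value 0 unless t is realised. *)

Require Import Defs.
From mathcomp Require Import all_boot all_order all_algebra.
From Stdlib Require Import ClassicalEpsilon.
Set Implicit Arguments. Unset Strict Implicit. Unset Printing Implicit Defensive.
Import GRing.Theory.

(** * Renaming and transitions *)

Section Renaming.
Variable K : comPzSemiRingType.
Implicit Types (P Q T U : term K) (f : name -> name).

(** [K] has no subtraction, so runs that contradict a guess cannot be removed afterwards: they must
    carry the value 0, while each remaining run keeps the value of the run that it imitates. Two
    features of the calculus make this possible. A synchronisation creates a name that only its two
    partners know, so a name common to [P] and [R] is always one of the initial free names, and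
    these alone need copies. And an action that fires leaves a [Diam] in its place, so positions
    keep their meaning and a guess is a finite function on the action positions of the initial term.
    An action guessed not to fire cannot just be erased: a run is maximal only when the
    synchronisations left aside are impossible, so the action must stay visible to its environment.

    Everywhere else the obstacle is the choice of bound names: exchanging two independent steps
    gives terms whose hidings differ in order and in names. Final terms are therefore compared by
    their paths and states. *)

Definition nm_map f (u : nm) := if u is F x then F (f x) else u.

Fixpoint tmap f P := match P with
| Const c => Const c
| Act u e P => Act (nm_map f u) e (tmap f P)
| Diam P => Diam (tmap f P)
| Par P Q => Par (tmap f P) (tmap f Q)
| SPar P Q => SPar (tmap f P) (tmap f Q)
| Nu P => Nu (tmap f P) end.

(** Transpositions serve as renamings because they are injective, as [step_tmap] requires, and
    involutive; the substitution [rename] is neither. *)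
Definition sw (a b n : name) := if n == a then b else if n == b then a else n.

Lemma swK a b : involutive (sw a b).
Proof.
move=> n; rewrite /sw; case: (eqVneq n a) => [->|na].
  by case: (eqVneq b a) => [->|] //; rewrite eqxx.
case: (eqVneq n b) => [->|nb]; first by rewrite eqxx.
by rewrite (negPf na) (negPf nb).
Qed.

Lemma sw_inj a b : injective (sw a b).
Proof. exact: inv_inj (@swK a b). Qed.

Lemma swL a b : sw a b a = b.
Proof. by rewrite /sw eqxx. Qed.

Lemma swR a b : sw a b b = a.
Proof. by rewrite /sw; case: eqP => [->|_] //; rewrite eqxx. Qed.

Lemma sw_out a b n : n != a -> n != b -> sw a b n = n.
Proof. by rewrite /sw => /negPf-> /negPf->. Qed.

Lemma fv_tmap f P : fv (tmap f P) = map f (fv P).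
Proof. by elim: P => //= [[x|i] e P|P IP Q|P IP Q] -> //=; rewrite IP map_cat. Qed.

Lemma tmap_id f P : {in fv P, f =1 id} -> tmap f P = P.
Proof.
elim: P => //= [u e P IH|P IH|P IP Q IQ|P IP Q IQ|P IH] h.
- congr Act; last by apply: IH => x xP; apply: h; rewrite mem_cat xP orbT.
  by case: u h => //= x h; rewrite h ?mem_head.
- by rewrite IH.
- by rewrite IP ?IQ // => x xP; apply: h; rewrite mem_cat xP ?orbT.
- by rewrite IP ?IQ // => x xP; apply: h; rewrite mem_cat xP ?orbT.
- by rewrite IH.
Qed.

Lemma tmap_sw_id a b P : a \notin fv P -> b \notin fv P -> tmap (sw a b) P = P.
Proof.
move=> aP bP; apply: tmap_id => x xP; apply: sw_out.
  by apply: contraNneq aP => <-.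
by apply: contraNneq bP => <-.
Qed.

Lemma tmapK a b P : tmap (sw a b) (tmap (sw a b) P) = P.
Proof.
elim: P => //= [u e P ->|P ->|P -> Q ->|P -> Q ->|P ->] //.
by case: u => //= x; rewrite swK.
Qed.

Lemma tmap_open f k x P : tmap f (open_rec k x P) = open_rec k (f x) (tmap f P).
Proof.
elim: P k => //= [u e P IH|P IH|P IP Q IQ|P IP Q IQ|P IH] k; rewrite ?IH ?IP ?IQ //.
by congr Act; case: u => //= i; case: ifP.
Qed.

Lemma tmap_close f k x P : injective f ->
  tmap f (close_rec k x P) = close_rec k (f x) (tmap f P).
Proof.
move=> fI; elim: P k => //= [u e P IH|P IH|P IP Q IQ|P IP Q IQ|P IH] k; rewrite ?IH ?IP ?IQ //.
by congr Act; case: u => //= y; rewrite (inj_eq fI); case: ifP.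
Qed.

Lemma tmap_rename f y x P : injective f ->
  tmap f (rename y x P) = rename (f y) (f x) (tmap f P).
Proof.
move=> fI; elim: P => //= [u e P IH|P IH|P IP Q IQ|P IP Q IQ|P IH]; rewrite ?IH ?IP ?IQ //.
by congr Act; case: u => //= z; rewrite (inj_eq fI); case: ifP.
Qed.

Lemma open_close k x P : lc_at k P -> open_rec k x (close_rec k x P) = P.
Proof.
elim: P k => //= [u e P IH|P IH|P IP Q IQ|P IP Q IQ|P IH] k.
- case/andP => hu hP; rewrite IH //; congr Act.
  case: u hu => [y|i] /= hi; first by case: eqP => [->|] //=; rewrite eqxx.
  by rewrite ltn_eqF.
- by move/IH->.
- by case/andP => /IP-> /IQ->.
- by case/andP => /IP-> /IQ->.
- by move/IH->.
Qed.

Lemma fv_close k x P : fv (close_rec k x P) = [seq y <- fv P | y != x].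
Proof.
elim: P k => //= [u e P IH|P IP Q IQ|P IP Q IQ] k; rewrite ?IH ?IP ?IQ ?filter_cat //.
by congr (_ ++ _); case: u => //= y; case: eqP.
Qed.

Lemma fv_open k x P : {subset fv (open_rec k x P) <= x :: fv P}.
Proof.
elim: P k => //= [u e P IH|P IP Q IQ|P IP Q IQ] k y; rewrite ?mem_cat.
- case/orP=> [|/IH]; last by rewrite !inE mem_cat => /orP[->|->]; rewrite ?orbT.
  case: u => [z|i] /=; first by rewrite !inE => /eqP->; rewrite eqxx orbT.
  by case: eqP => //= _; rewrite !inE => /eqP->; rewrite eqxx.
- by case/orP=> [/IP|/IQ]; rewrite !inE mem_cat => /orP[->|->]; rewrite ?orbT.
- by case/orP=> [/IP|/IQ]; rewrite !inE mem_cat => /orP[->|->]; rewrite ?orbT.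
Qed.

Lemma sub_fv_open k x P : {subset fv P <= fv (open_rec k x P)}.
Proof.
elim: P k => //= [u e P IH|P IP Q IQ|P IP Q IQ] k y; rewrite ?mem_cat.
- case/orP=> [|/(IH k.+1)->]; last by rewrite orbT.
  by case: u => [z|i] //= ->.
- by case/orP=> [/(IP k)|/(IQ k)] ->; rewrite ?orbT.
- by case/orP=> [/(IP k)|/(IQ k)] ->; rewrite ?orbT.
Qed.

Lemma lc_open k x P : lc_at k.+1 P -> lc_at k (open_rec k x P).
Proof.
elim: P k => //= [u e P IH|P IP Q IQ|P IP Q IQ|P IH] k; last by move/IH.
- case/andP => hu hP; rewrite IH // andbT.
  case: u hu => //= i; rewrite ltnS leq_eqVlt; case: eqP => //=.
- by case/andP => /IP-> /IQ->.
- by case/andP => /IP-> /IQ->.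
Qed.

Lemma lc_close k x P : lc_at k P -> lc_at k.+1 (close_rec k x P).
Proof.
elim: P k => //= [u e P IH|P IP Q IQ|P IP Q IQ|P IH] k; last by move/IH.
- case/andP => hu hP; rewrite IH // andbT.
  by case: u hu => //= [y _|i]; [case: eqP | move/leqW].
- by case/andP => /IP-> /IQ->.
- by case/andP => /IP-> /IQ->.
Qed.

Lemma lc_tmap f k P : lc_at k (tmap f P) = lc_at k P.
Proof.
elim: P k => //= [u e P IH|P IP Q IQ|P IP Q IQ] k; rewrite ?IH ?IP ?IQ //.
by case: u.
Qed.

Lemma rename_tmap y x P : rename y x P = tmap (fun z => if z == y then x else z) P.
Proof.
elim: P => //= [u e P ->|P ->|P -> Q ->|P -> Q ->|P ->] //.
by congr Act; case: u => //= z; case: eqP.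
Qed.

Lemma eq_in_tmap f g P : {in fv P, f =1 g} -> tmap f P = tmap g P.
Proof.
elim: P => //= [u e P IH|P IH|P IP Q IQ|P IP Q IQ|P IH] h.
- congr Act; last by apply: IH => x xP; apply: h; rewrite mem_cat xP orbT.
  by case: u h => //= x h; rewrite h ?mem_head.
- by rewrite IH.
- by rewrite IP ?IQ // => x xP; apply: h; rewrite mem_cat xP ?orbT.
- by rewrite IP ?IQ // => x xP; apply: h; rewrite mem_cat xP ?orbT.
- by rewrite IH.
Qed.

(** For a fresh target, substitution and transposition agree, which makes the facts on injective
    renamings available for the synchronisation rule. *)
Lemma rename_sw y x P : (x != y -> x \notin fv P) -> rename y x P = tmap (sw y x) P.
Proof.
move=> xP; rewrite rename_tmap; apply: eq_in_tmap => z zP; rewrite /sw.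
case: (eqVneq z y) => // zy; case: (eqVneq z x) => // zx; move: zP zy; rewrite zx => xP'.
by move/xP; rewrite xP'.
Qed.

Lemma close_sw k x z P : (z != x -> z \notin fv P) ->
  close_rec k z (tmap (sw x z) P) = close_rec k x P.
Proof.
move=> zP; rewrite -{1}(swL x z) -tmap_close; last exact: sw_inj.
case: (eqVneq z x) zP => [->|zx] zP.
  by apply: tmap_id => w _; rewrite /sw; case: eqP.
apply: tmap_sw_id; rewrite fv_close mem_filter ?eqxx //.
by rewrite (negPf (zP isT)) andbF.
Qed.

Lemma open_close_sw k x z P : lc_at k P -> (z != x -> z \notin fv P) ->
  open_rec k z (close_rec k x P) = tmap (sw x z) P.
Proof. by move=> lP zP; rewrite -(@close_sw k x z) // open_close // lc_tmap. Qed.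

Lemma state_tmap f P : state (tmap f P) = state P.
Proof. by elim: P => //= P -> Q ->. Qed.

Lemma state_open k x P : state (open_rec k x P) = state P.
Proof. by elim: P k => //= P IP Q IQ k; rewrite IP IQ. Qed.

End Renaming.

(** * Equivariance of transitions and free choice of bound names *)

Section Steps.
Variable K : comPzSemiRingType.
Implicit Types (P Q T U : term K) (f : name -> name) (a : label).

Definition lmap f a := match a with
| Vis u e x p => Vis (f u) e (f x) p
| Int p q => Int p q end.

Definition lbound a : seq name := if a is Vis _ _ x _ then [:: x] else [::].

Lemma lmap_prefix f i a : lmap f (lprefix i a) = lprefix i (lmap f a).
Proof. by case: a. Qed.

Lemma lbound_prefix i a : lbound (lprefix i a) = lbound a.
Proof. by case: a. Qed.

Lemma lbound_names a : {subset lbound a <= lnames a}.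
Proof. by case: a => //= u e x p y; rewrite !inE => ->; rewrite orbT. Qed.

Lemma fresh_forE a Q : fresh_for a Q = all (fun x => x \notin fv Q) (lbound a).
Proof. by case: a => //= u e x p; rewrite andbT. Qed.

Lemma step_tmap f T a T' : injective f ->
  step T a T' -> step (tmap f T) (lmap f a) (tmap f T').
Proof.
move=> fI; have memf x P : (f x \in fv (tmap f P)) = (x \in fv P).
  by rewrite fv_tmap mem_map.
have frf a0 Q : fresh_for (lmap f a0) (tmap f Q) = fresh_for a0 Q.
  by case: a0 => //= *; rewrite memf.
elim=> /= {T a T'}.
- move=> u e x P xP; rewrite /open tmap_open; apply: st_act.
  by rewrite -(memf x (Act (F u) e P)) in xP.
- by move=> P a P' _ IH; rewrite lmap_prefix; apply: st_diam.
- by move=> P Q a P' _ IH fr; rewrite lmap_prefix; apply: st_parL; rewrite ?frf.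
- by move=> P Q a P' _ IH fr; rewrite lmap_prefix; apply: st_parR; rewrite ?frf.
- by move=> P Q a P' _ IH fr; rewrite lmap_prefix; apply: st_sparL; rewrite ?frf.
- by move=> P Q a P' _ IH fr; rewrite lmap_prefix; apply: st_sparR; rewrite ?frf.
- move=> P z a P' zP za _; rewrite /open tmap_open /close tmap_close // => IH.
  apply: (st_nu (z := f z)) => //; first by rewrite memf.
  by case: a za {IH} => //= u e x p; rewrite !inE !(inj_eq fI).
- move=> P Q u e x y i k P' Q' _ IP _ IQ xQ.
  rewrite /close /= !tmap_close // tmap_rename //.
  by apply: st_comm IP IQ _; rewrite memf.
Qed.

Lemma step_fresh T a T' : step T a T' -> all (fun x => x \notin fv T) (lbound a).
Proof.
elim=> /= {T a T'} [u e x P|P a P'|P Q a P'|P Q a P'|P Q a P'|P Q a P'|P z a P'|//].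
- by rewrite andbT.
- by rewrite lbound_prefix.
- move=> _ IH; rewrite fresh_forE lbound_prefix => fr.
  by apply/allP => x xa; rewrite mem_cat negb_or (allP IH _ xa) (allP fr _ xa).
- move=> _ IH; rewrite fresh_forE lbound_prefix => fr.
  by apply/allP => x xa; rewrite mem_cat negb_or (allP IH _ xa) (allP fr _ xa).
- move=> _ IH; rewrite fresh_forE lbound_prefix => fr.
  by apply/allP => x xa; rewrite mem_cat negb_or (allP IH _ xa) (allP fr _ xa).
- move=> _ IH; rewrite fresh_forE lbound_prefix => fr.
  by apply/allP => x xa; rewrite mem_cat negb_or (allP IH _ xa) (allP fr _ xa).
- move=> _ _ _ IH; apply/allP => x xa; apply: contra (allP IH _ xa).
  exact: sub_fv_open.
Qed.

Lemma step_fv T a T' : step T a T' -> {subset fv T' <= lbound a ++ fv T}.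
Proof.
elim=> /= {T a T'} [u e x P xP|P a P' _ IH|P Q a P' _ IH _|P Q a P' _ IH _
  |P Q a P' _ IH _|P Q a P' _ IH _|P z a P' zP za _ IH
  |P Q u e x y i k P' Q' _ IP _ IQ xQ] w; rewrite ?lbound_prefix.
- by move/fv_open; rewrite !inE => /orP[->|->]; rewrite ?orbT.
- exact: IH.
- rewrite !mem_cat => /orP[/IH|->]; last by rewrite !orbT.
  by rewrite mem_cat => /orP[]->; rewrite ?orbT.
- rewrite !mem_cat => /orP[->|/IH]; first by rewrite !orbT.
  by rewrite mem_cat => /orP[]->; rewrite ?orbT.
- rewrite !mem_cat => /orP[/IH|->]; last by rewrite !orbT.
  by rewrite mem_cat => /orP[]->; rewrite ?orbT.
- rewrite !mem_cat => /orP[->|/IH]; first by rewrite !orbT.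
  by rewrite mem_cat => /orP[]->; rewrite ?orbT.
- rewrite fv_close mem_filter mem_cat => /andP[wz /IH]; rewrite mem_cat.
  by case/orP => [->//|/fv_open]; rewrite inE (negPf wz) /= => ->; rewrite orbT.
- rewrite !fv_close -filter_cat mem_filter !mem_cat => /andP[wx].
  case/orP => [/IP|]; first by rewrite !inE (negPf wx) => /= ->.
  rewrite rename_tmap fv_tmap => /mapP[v /IQ].
  rewrite !inE; case: eqP => [_ _ vx|vy /= vQ ->]; first by rewrite vx eqxx in wx.
  by rewrite vQ orbT.
Qed.

Lemma lc_step T a T' : step T a T' -> lc T -> lc T'.
Proof.
rewrite /lc; elim=> //= {T a T'}.
- by move=> u e x P _ lP; apply: lc_open.
- by move=> P Q a P' _ IH _ /andP[/IH-> ->].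
- by move=> P Q a P' _ IH _ /andP[-> /IH->].
- by move=> P Q a P' _ IH _ /andP[/IH-> ->].
- by move=> P Q a P' _ IH _ /andP[-> /IH->].
- by move=> P z a P' _ _ _ IH lP; apply/lc_close/IH/lc_open.
- move=> P Q u e x y i k P' Q' _ IP _ IQ _ /andP[/IP lP /IQ lQ].
  by rewrite !lc_close // rename_tmap lc_tmap.
Qed.

Lemma lmap_id f a : {in lnames a, f =1 id} -> lmap f a = a.
Proof. by case: a => //= u e x p h; rewrite !h // !inE eqxx ?orbT. Qed.

(** The rule for hiding opens with some unknown name; a transposition replaces it by any prescribed
    name that is fresh for the body and absent from the label. *)
Lemma step_nu_inv P a T' z : step (Nu P) a T' -> z \notin fv P -> z \notin lnames a ->
  exists2 P', step (open z P) a P' & T' = Nu (close z P').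
Proof.
move=> H; inversion H as [| | | | | |P0 w a0 P' wP wa st|]; subst=> zP za.
exists (tmap (sw w z) P').
  have := step_tmap (@sw_inj w z) st; rewrite /open tmap_open swL tmap_sw_id //.
  rewrite lmap_id // => x xa; apply: sw_out.
    by apply: contraNneq wa => <-.
  by apply: contraNneq za => <-.
rewrite /close close_sw // => zw; apply/negP => /(step_fv st).
rewrite mem_cat => /orP[/lbound_names|/fv_open]; first by rewrite (negPf za).
by rewrite inE (negPf zw) (negPf zP).
Qed.

Definition lsubj a : seq name := if a is Vis u _ _ _ then [:: u] else [::].

Lemma lsubj_prefix i a : lsubj (lprefix i a) = lsubj a.
Proof. by case: a. Qed.

Lemma step_subj T a T' : step T a T' -> {subset lsubj a <= fv T}.
Proof.
elim=> /= {T a T'} [u e x P xP|P a P' _ IH|P Q a P' _ IH _|P Q a P' _ IH _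
  |P Q a P' _ IH _|P Q a P' _ IH _|P z a P' zP za _ IH|//] w;
  rewrite ?lsubj_prefix ?mem_cat.
- by rewrite !inE => ->.
- by move/IH.
- by move/IH ->.
- by move/IH ->; rewrite orbT.
- by move/IH ->.
- by move/IH ->; rewrite orbT.
- move=> wa; have /fv_open := IH _ wa.
  rewrite inE => /orP[/eqP wz|//]; move: za wa; rewrite wz.
  by case: (a) => //= u e x p; rewrite !inE => /negPf; case: eqP.
Qed.

Lemma step_vis_rename P u e x i P' z : step P (Vis u e x i) P' -> z \notin fv P ->
  step P (Vis u e z i) (tmap (sw x z) P').
Proof.
move=> st zP; have := step_fresh st; rewrite /= andbT => xP.
have := step_tmap (@sw_inj x z) st; rewrite tmap_sw_id //= swL.
have uP : u \in fv P by apply: step_subj st _ (mem_head _ _).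
by rewrite sw_out //; [apply: contraNneq xP => <- | apply: contraNneq zP => <-].
Qed.

Lemma step_vis_fv P u e x i P' z : step P (Vis u e x i) P' ->
  z \notin fv P -> z != x -> z \notin fv P'.
Proof.
move=> st zP zx; apply/negP => /(step_fv st).
by rewrite inE (negPf zx) (negPf zP).
Qed.

(** Both partners can be renamed to bind the same prescribed fresh name, and then the substitution
    of the rule disappears. *)
Lemma step_comm_inv P Q i k T' z : step (Par P Q) (Int (1 :: i) (2 :: k)) T' ->
  z \notin fv P -> z \notin fv Q ->
  exists u e P' Q', [/\ step P (Vis u e z i) P', step Q (Vis u (~~ e) z k) Q'
    & T' = Nu (close z (Par P' Q'))].
Proof.
move=> H zP zQ.
have {H}[u [e [x [y [P' [Q' [sP sQ xQ ->]]]]]]] : exists u e x y P' Q',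
  [/\ step P (Vis u e x i) P', step Q (Vis u (~~ e) y k) Q', x \notin fv Q
    & T' = Nu (close x (Par P' (rename y x Q')))].
  inversion H; subst; last first.
  - by exists u, e, x, y, P', Q'.
  - by destruct a.
  - by destruct a.
exists u, e, (tmap (sw x z) P'), (tmap (sw y z) Q').
split; [exact: step_vis_rename sP _|exact: step_vis_rename sQ _|].
rewrite /close /= (close_sw _ (step_vis_fv sP zP)) (close_sw _ (step_vis_fv sQ zQ)).
rewrite rename_sw; last exact: step_vis_fv sQ xQ.
by rewrite close_sw //; apply: step_vis_fv sQ xQ.
Qed.

Lemma rename_id x P : rename x x P = P.
Proof. by rewrite rename_tmap tmap_id // => z _; case: eqP. Qed.

Lemma step_comm P Q i k u e z P' Q' : step P (Vis u e z i) P' -> step Q (Vis u (~~ e) z k) Q' ->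
  step (Par P Q) (Int (1 :: i) (2 :: k)) (Nu (close z (Par P' Q'))).
Proof.
move=> sP sQ; rewrite -{1}(rename_id z Q'); apply: (st_comm sP sQ).
by have := step_fresh sQ; rewrite /= andbT.
Qed.

Lemma fresh_name (A : seq name) : exists x, x \notin A.
Proof.
exists (\max_(y <- A) y).+1; apply/negP => h.
by have := @leq_bigmax_seq _ A xpredT id _ h isT; rewrite ltnn.
Qed.

End Steps.

(** * What identifies a transition, and which positions a path may still use *)

Section Positions.
Variable K : comPzSemiRingType.
Implicit Types (P Q T U : term K) (a : label) (i : position).

(** The data that identify a transition of a given term. Subject and polarity are left out: the
    position determines them. *)
Definition lkey a := match a with Vis _ _ x i => (Some x, i, i) | Int i k => (None, i, k) end.

Lemma lkey_prefix n a m b : lkey (lprefix n a) = lkey (lprefix m b) -> n = m /\ lkey a = lkey b.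
Proof. by case: a b => [u e x p|p q] [v f y r|r s] //= [*]; subst. Qed.

Lemma lkey_names a b z : lkey a = lkey b -> z \notin lnames a -> z \notin lsubj b ->
  z \notin lnames b.
Proof.
case: a b => [u e x p|p q] [v f y r|r s] // [<- _ _].
by rewrite /= !inE !negb_or => /andP[_ ->] ->.
Qed.

Local Ltac useIH IH := match goal with h : step _ _ _ |- _ =>
  by case/lkey_prefix => _ /(IH _ _ h)[-> ->] end.

(** Under a hiding and in a synchronisation the intermediate names are arbitrary; inversion brings
    both derivations to the same names, after which they can be compared. *)
Lemma step_det T a T1 b T2 : step T a T1 -> step T b T2 -> lkey a = lkey b ->
  a = b /\ T1 = T2.
Proof.
move=> st; elim: st b T2 => {T a T1}.
- move=> u e x P xP b T2 H; inversion H; subst => /= -[e1].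
  by rewrite e1.
- move=> P a P' _ IH b T2 H; inversion H; subst; useIH IH.
- move=> P Q a P' _ IH fr b T2 H; inversion H; subst; first by useIH IH.
    by case/lkey_prefix.
  by case: a {IH fr}.
- move=> P Q a P' _ IH fr b T2 H; inversion H; subst; last by case: a {IH fr}.
    by case/lkey_prefix.
  by useIH IH.
- move=> P Q a P' _ IH fr b T2 H; inversion H; subst; first by useIH IH.
  by case/lkey_prefix.
- move=> P Q a P' _ IH fr b T2 H; inversion H; subst; first by case/lkey_prefix.
  by useIH IH.
- move=> P z a P' zP za _ IH b T2 st kab.
  have zb : z \notin lnames b.
    apply: lkey_names kab za _; apply/negP => /(step_subj st).
    by rewrite /= (negPf zP).
  by have [P2 /IH/(_ kab)[-> ->] ->] := step_nu_inv st zP zb.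
- move=> P Q u e x y i k P' Q' sP IP sQ IQ xQ b T2 st kab.
  case: b st kab => // i' k' st [? ?]; subst i' k'.
  have := step_fresh sP; rewrite /= andbT => xP.
  have := step_fresh sQ; rewrite /= andbT => yQ.
  have [u2 [e2 [P2 [Q2 [sP2 sQ2 ->]]]]] := step_comm_inv st xP xQ.
  have [_ <-] := IP _ _ sP2 erefl.
  have [_ ->] := IQ _ _ (step_vis_rename sQ2 yQ) erefl.
  split=> //; congr (Nu (close x (Par _ _))).
  have sw_sym z : sw x y z = sw y x z.
    by rewrite /sw; case: (z =P x) => [zx|_]; case: (z =P y) => // zy; rewrite -zx -zy.
  rewrite rename_sw => [|xy].
    by rewrite (eq_in_tmap (g := sw x y)) ?tmapK // => z _; rewrite sw_sym.
  rewrite fv_tmap; apply/mapP => -[w wQ2 xw]; have := step_fv sQ2 wQ2.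
  have wy : w = y by apply: (@sw_inj x y); rewrite -xw swR.
  by rewrite wy /= inE (negPf yQ) orbF eq_sym (negPf xy).
Qed.

(* A label can only fire at positions where [dn] is false, and makes it true there: this is
   what orders the labels of a path. *)
Fixpoint dn T i := match T, i with
| Act _ _ _, _ => false
| Nu P, _ => dn P i
| _, [::] => true
| Diam P, d :: i => (d == 1) && dn P i
| Par P Q, d :: i | SPar P Q, d :: i => (d == 1) && dn P i || (d == 2) && dn Q i
| Const _, _ => false
end.

Lemma dn_open k x T : dn (open_rec k x T) =1 dn T.
Proof.
by elim: T k => //= [P IP|P IP Q IQ|P IP Q IQ] k [|d i] //=; rewrite ?IP ?IQ.
Qed.

Lemma dn_close k x T : dn (close_rec k x T) =1 dn T.
Proof.
by elim: T k => //= [P IP|P IP Q IQ|P IP Q IQ] k [|d i] //=; rewrite ?IP ?IQ.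
Qed.

Lemma dn_rename x y T : dn (rename x y T) =1 dn T.
Proof.
by elim: T => //= [P IP|P IP Q IQ|P IP Q IQ] [|d i] //=; rewrite ?IP ?IQ.
Qed.

Lemma dn_step T a T' i : step T a T' -> dn T i -> dn T' i.
Proof.
move=> st; elim: st i => {T a T'} //=.
- by move=> P a P' _ IH [|d i] //= /andP[-> /IH].
- by move=> P Q a P' _ IH _ [|d i] //= /orP[/andP[-> /IH->]|->]; rewrite ?orbT.
- by move=> P Q a P' _ IH _ [|d i] //= /orP[->|/andP[-> /IH->]]; rewrite ?orbT.
- by move=> P Q a P' _ IH _ [|d i] //= /orP[/andP[-> /IH->]|->]; rewrite ?orbT.
- by move=> P Q a P' _ IH _ [|d i] //= /orP[->|/andP[-> /IH->]]; rewrite ?orbT.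
- by move=> P z a P' _ _ _ IH i dP; rewrite dn_close; apply: IH; rewrite dn_open.
- move=> P Q u e x y i k P' Q' _ IP _ IQ _ [|d j] //=.
  by rewrite !dn_close dn_rename => /orP[/andP[-> /IP->]|/andP[-> /IQ->]]; rewrite ?orbT.
Qed.

Definition lposs a := match a with Vis _ _ _ i => [:: i] | Int i k => [:: i; k] end.

Lemma lposs_prefix n a : lposs (lprefix n a) = map (cons n) (lposs a).
Proof. by case: a. Qed.

(** An unfired action blocks what is below it, so everything strictly above a firing position is
    already passed; the position itself is passed by this very step. *)
Lemma step_pos T a T' p q : step T a T' -> p \in lposs a -> prefix q p ->
  dn T' q /\ dn T q = (q != p).
Proof.
move=> st; elim: st p q => {T a T'} /=.
- by move=> u e x P _ p q; rewrite inE => /eqP->; case: q.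
- move=> P a P' _ IH p q; rewrite lposs_prefix => /mapP[p' pa ->].
  by case: q => //= d q; case: eqP => //= -> /(IH _ _ pa)[-> ->]; rewrite eqseq_cons ?orbF.
- move=> P Q a P' _ IH _ p q; rewrite lposs_prefix => /mapP[p' pa ->].
  by case: q => //= d q; case: eqP => //= -> /(IH _ _ pa)[-> ->]; rewrite eqseq_cons ?orbF.
- move=> P Q a P' _ IH _ p q; rewrite lposs_prefix => /mapP[p' pa ->].
  by case: q => //= d q; case: eqP => //= -> /(IH _ _ pa)[-> ->]; rewrite eqseq_cons ?orbF.
- move=> P Q a P' _ IH _ p q; rewrite lposs_prefix => /mapP[p' pa ->].
  by case: q => //= d q; case: eqP => //= -> /(IH _ _ pa)[-> ->]; rewrite eqseq_cons ?orbF.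
- move=> P Q a P' _ IH _ p q; rewrite lposs_prefix => /mapP[p' pa ->].
  by case: q => //= d q; case: eqP => //= -> /(IH _ _ pa)[-> ->]; rewrite eqseq_cons ?orbF.
- move=> P z a P' _ _ _ IH p q pa /(IH _ _ pa).
  by rewrite dn_close dn_open.
- move=> P Q u e x y i k P' Q' _ IP _ IQ _ p q; rewrite !inE => /orP[]/eqP->.
    case: q => //= d q; case: eqP => //= -> /(IP _ _ (mem_head _ _)).
    by rewrite dn_close !orbF eqseq_cons => -[-> ->].
  case: q => //= d q; case: eqP => //= -> /(IQ _ _ (mem_head _ _)).
  by rewrite !dn_close dn_rename eqseq_cons => -[-> ->].
Qed.

Fixpoint acts T : nat := match T with
| Const _ => 0
| Act _ _ P => (acts P).+1
| Diam P | Nu P => acts P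
| Par P Q | SPar P Q => acts P + acts Q end.

Lemma acts_open k x T : acts (open_rec k x T) = acts T.
Proof. by elim: T k => //= [u e P IP|P IP Q IQ|P IP Q IQ] k; rewrite ?IP ?IQ. Qed.

Lemma acts_close k x T : acts (close_rec k x T) = acts T.
Proof. by elim: T k => //= [u e P IP|P IP Q IQ|P IP Q IQ] k; rewrite ?IP ?IQ. Qed.

Lemma acts_tmap f T : acts (tmap f T) = acts T.
Proof. by elim: T => //= [u e P ->|P -> Q ->|P -> Q ->]. Qed.

Lemma acts_step T a T' : step T a T' -> acts T' < acts T.
Proof.
elim=> {T a T'} //=.
- by move=> u e x P _; rewrite acts_open.
- by move=> P Q a P' _ IH _; rewrite ltn_add2r.
- by move=> P Q a P' _ IH _; rewrite ltn_add2l.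
- by move=> P Q a P' _ IH _; rewrite ltn_add2r.
- by move=> P Q a P' _ IH _; rewrite ltn_add2l.
- by move=> P z a P' _ _ _; rewrite acts_open acts_close.
- move=> P Q u e x y i k P' Q' _ IP _ IQ _.
  by rewrite !acts_close rename_tmap acts_tmap (ltn_trans (n := acts P + acts Q')) ?ltn_add2r ?ltn_add2l.
Qed.

Fixpoint poss T : seq position := match T with
| Const _ => [::]
| Act _ _ _ => [:: [::]]
| Nu P => poss P
| Diam P => map (cons 1) (poss P)
| Par P Q | SPar P Q => map (cons 1) (poss P) ++ map (cons 2) (poss Q) end.

Lemma poss_open k x T : poss (open_rec k x T) = poss T.
Proof. by elim: T k => //= [P IP|P IP Q IQ|P IP Q IQ] k; rewrite ?IP ?IQ. Qed.

Lemma step_poss T a T' : step T a T' -> {subset lposs a <= poss T}.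
Proof.
elim=> {T a T'} //=.
- by move=> u e x P _ p.
- by move=> P a P1 _ IH p; rewrite lposs_prefix => /mapP[q /IH qP ->]; rewrite map_f.
- move=> P Q a P' _ IH _ p; rewrite lposs_prefix mem_cat => /mapP[q /IH qP ->].
  by rewrite map_f.
- move=> P Q a P' _ IH _ p; rewrite lposs_prefix mem_cat => /mapP[q /IH qP ->].
  by rewrite map_f ?orbT.
- move=> P Q a P' _ IH _ p; rewrite lposs_prefix mem_cat => /mapP[q /IH qP ->].
  by rewrite map_f.
- move=> P Q a P' _ IH _ p; rewrite lposs_prefix mem_cat => /mapP[q /IH qP ->].
  by rewrite map_f ?orbT.
- by move=> P z a P' _ _ _ IH p /IH; rewrite poss_open.
- move=> P Q u e x y i k P' Q' _ IP _ IQ _ p; rewrite !inE mem_cat => /orP[]/eqP->.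
    by rewrite map_f ?IP ?mem_head.
  by rewrite map_f ?orbT ?IQ ?mem_head.
Qed.

End Positions.

(** * Terms with opened hidings *)

Lemma lprefix_vis n a u e x i : lprefix n a = Vis u e x i ->
  exists2 j, a = Vis u e x j & i = n :: j.
Proof. by case: a => //= v f y j [-> -> -> <-]; exists j. Qed.

Lemma lprefix_int n a i k : lprefix n a = Int i k ->
  exists j l, [/\ a = Int j l, i = n :: j & k = n :: l].
Proof. by case: a => //= j l [<- <-]; exists j, l. Qed.

Ltac inv_prefix := match goal with
| h : lprefix _ _ = Vis _ _ _ _ |- _ => have [? ? ?] := lprefix_vis h
| h : lprefix _ _ = Int _ _ |- _ => have [? [? [? ? ?]]] := lprefix_int h end; subst.

Section Stripping.
Variable K : comPzSemiRingType.
Implicit Types (P Q T U V : term K) (a : label) (i j k : position) (zs ns ms A : seq name).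

(* [sr T U zs]: opening the hidings of [T] that are not under an action with
   the names [zs] yields [U]. *)
Inductive sr : term K -> term K -> seq name -> Prop :=
| sr_const c : sr (Const c) (Const c) [::]
| sr_act u e P : sr (Act u e P) (Act u e P) [::]
| sr_diam P U zs : sr P U zs -> sr (Diam P) (Diam U) zs
| sr_par P Q U V zs ws : sr P U zs -> sr Q V ws -> sr (Par P Q) (Par U V) (zs ++ ws)
| sr_spar P Q U V zs ws : sr P U zs -> sr Q V ws -> sr (SPar P Q) (SPar U V) (zs ++ ws)
| sr_nu z P U zs : z \notin fv P -> sr (open z P) U zs -> sr (Nu P) U (z :: zs).

Definition fresh A zs := all (fun z => z \notin A) zs.

Lemma freshW A B zs : {subset B <= A} -> fresh A zs -> fresh B zs.
Proof. by move=> BA /allP h; apply/allP => z /h; apply/contra/BA. Qed.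

Lemma fresh_cat A B zs : fresh (A ++ B) zs = fresh A zs && fresh B zs.
Proof.
elim: zs => //= z zs ->; rewrite mem_cat negb_or -!andbA; congr andb.
by rewrite !andbA [(z \notin B) && _]andbC.
Qed.

Lemma fresh_sub A zs ws : {subset ws <= zs} -> fresh A zs -> fresh A ws.
Proof. by move=> h /allP H; apply/allP => z /h /H. Qed.

Fixpoint term_size T : nat := match T with
| Const _ => 1
| Act _ _ P | Diam P | Nu P => (term_size P).+1
| Par P Q | SPar P Q => (term_size P + term_size Q).+1 end.

Lemma term_size_open n x T : term_size (open_rec n x T) = term_size T.
Proof. by elim: T n => //= [u e P IP|P IP|P IP Q IQ|P IP Q IQ|P IP] n; rewrite ?IP ?IQ. Qed.

Lemma sr_ex T A : exists U zs, [/\ sr T U zs, uniq zs & fresh A zs].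
Proof.
(* [open z P] is not a subterm of [Nu P], hence the induction on the size. *)
elim: {T}(term_size T).+1 {-2}T A (leqnn (term_size T).+1) => // n IH [c|u e P|P|P Q|P Q|P] A /=; rewrite ltnS => lt.
- by exists (Const c), [::]; split=> //; constructor.
- by exists (Act u e P), [::]; split=> //; constructor.
- have [U [zs [? ? ?]]] := IH P A lt.
  by exists (Diam U), zs; split=> //; constructor.
- have [|U [zs [sU uU fU]]] := IH P A; first by rewrite (leq_trans _ lt) ?ltnS ?leq_addr.
  have [|V [ws [sV uV fV]]] := IH Q (A ++ zs); first by rewrite (leq_trans _ lt) ?ltnS ?leq_addl.
  rewrite fresh_cat in fV; case/andP: fV => fV fzs.
  exists (Par U V), (zs ++ ws); split; first by constructor.
    by rewrite cat_uniq uU uV andbT -all_predC.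
  by rewrite /fresh all_cat; apply/andP.
- have [|U [zs [sU uU fU]]] := IH P A; first by rewrite (leq_trans _ lt) ?ltnS ?leq_addr.
  have [|V [ws [sV uV fV]]] := IH Q (A ++ zs); first by rewrite (leq_trans _ lt) ?ltnS ?leq_addl.
  rewrite fresh_cat in fV; case/andP: fV => fV fzs.
  exists (SPar U V), (zs ++ ws); split; first by constructor.
    by rewrite cat_uniq uU uV andbT -all_predC.
  by rewrite /fresh all_cat; apply/andP.
- have [z] := fresh_name (A ++ fv P); rewrite mem_cat negb_or => /andP[zA zP].
  have [|U [zs [sU uU fU]]] := IH (open z P) (z :: A); first by rewrite term_size_open.
  exists U, (z :: zs); split=> /=; first by constructor.
    rewrite uU andbT; apply/negP => /(allP fU); by rewrite mem_head.
  rewrite zA; apply: freshW fU => x xA; by rewrite inE xA orbT.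
Qed.

Lemma sr_state T U zs : sr T U zs -> state T = state U.
Proof.
elim=> //= [P Q U' V zs' ws _ -> _ -> //|P Q U' V zs' ws _ -> _ -> //|z P U' zs' _ _ <-].
by rewrite state_open.
Qed.

Lemma sr_lc T U zs : sr T U zs -> lc T -> lc U.
Proof.
rewrite /lc; elim=> //= [P Q U' V zs' ws _ IP _ IQ|P Q U' V zs' ws _ IP _ IQ|z P U' zs' _ _ IP].
- by case/andP => /IP-> /IQ->.
- by case/andP => /IP-> /IQ->.
- by move=> lP; apply/IP/lc_open.
Qed.

Lemma sr_fv T U zs : sr T U zs -> {subset fv U <= fv T ++ zs}.
Proof.
elim=> //= {T U zs} [u e P|P Q U V zs ws _ IP _ IQ|P Q U V zs ws _ IP _ IQ|z P U zs _ _ IP] x.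
- by rewrite cats0.
- by rewrite !mem_cat => /orP[/IP|/IQ]; rewrite mem_cat => /orP[]->; rewrite ?orbT.
- by rewrite !mem_cat => /orP[/IP|/IQ]; rewrite mem_cat => /orP[]->; rewrite ?orbT.
- move/IP; rewrite !mem_cat !inE => /orP[/fv_open|->]; last by rewrite !orbT.
  by rewrite inE => /orP[]->; rewrite ?orbT.
Qed.

Lemma sr_id T U zs : sr T U zs -> sr U U [::].
Proof.
elim=> {T U zs} //=; try by constructor.
- by move=> P Q U V zs ws _ IP _ IQ; rewrite -[[::]]/([::] ++ [::]); constructor.
- by move=> P Q U V zs ws _ IP _ IQ; rewrite -[[::]]/([::] ++ [::]); constructor.
Qed.

(* Transitions of stripped terms: the created name [x] stays free, and [ns]
   are the names given to the newly exposed hidings. *)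
Inductive fire : term K -> position -> name -> bool -> name -> term K -> seq name -> Prop :=
| fi_act u e P x B ns : sr (open x P) B ns -> fire (Act (F u) e P) [::] u e x (Diam B) ns
| fi_diam P i u e x P' ns : fire P i u e x P' ns -> fire (Diam P) (1 :: i) u e x (Diam P') ns
| fi_parL P Q i u e x P' ns : fire P i u e x P' ns -> fire (Par P Q) (1 :: i) u e x (Par P' Q) ns
| fi_parR P Q i u e x Q' ns : fire Q i u e x Q' ns -> fire (Par P Q) (2 :: i) u e x (Par P Q') ns
| fi_sparL P Q i u e x P' ns :
    fire P i u e x P' ns -> fire (SPar P Q) (1 :: i) u e x (SPar P' Q) ns
| fi_sparR P Q i u e x Q' ns :
    fire Q i u e x Q' ns -> fire (SPar P Q) (2 :: i) u e x (SPar P Q') ns.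

Inductive ust : term K -> position -> position -> name -> term K -> seq name -> Prop :=
| us_diam P i k x P' ns : ust P i k x P' ns -> ust (Diam P) (1 :: i) (1 :: k) x (Diam P') ns
| us_parL P Q i k x P' ns : ust P i k x P' ns -> ust (Par P Q) (1 :: i) (1 :: k) x (Par P' Q) ns
| us_parR P Q i k x Q' ns : ust Q i k x Q' ns -> ust (Par P Q) (2 :: i) (2 :: k) x (Par P Q') ns
| us_sparL P Q i k x P' ns :
    ust P i k x P' ns -> ust (SPar P Q) (1 :: i) (1 :: k) x (SPar P' Q) ns
| us_sparR P Q i k x Q' ns :
    ust Q i k x Q' ns -> ust (SPar P Q) (2 :: i) (2 :: k) x (SPar P Q') ns
| us_comm P Q i k u e x P' Q' ns ms :
    fire P i u e x P' ns -> fire Q k u (~~ e) x Q' ms ->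
    ust (Par P Q) (1 :: i) (2 :: k) x (Par P' Q') (ns ++ ms).

Lemma fire_subj U i u e x U' ns : fire U i u e x U' ns -> u \in fv U.
Proof.
elim=> //= {U i u e x U' ns} *; rewrite ?mem_head // mem_cat; apply/orP;
by [left | right].
Qed.

Lemma fire_fv U i u e x U' ns : fire U i u e x U' ns -> {subset fv U' <= x :: ns ++ fv U}.
Proof.
elim=> //= {U i u e x U' ns}.
- move=> u e P x B ns sB y /(sr_fv sB); rewrite inE !mem_cat => /orP[/fv_open|->].
    by rewrite !inE => /orP[]->; rewrite ?orbT.
  by rewrite orbT.
- move=> P Q i u e x P' ns _ IH y; rewrite !(inE, mem_cat) => /orP[/IH|->]; last by rewrite !orbT.
  by rewrite !(inE, mem_cat) => /or3P[]->; rewrite ?orbT.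
- move=> P Q i u e x P' ns _ IH y; rewrite !(inE, mem_cat) => /orP[->|/IH]; first by rewrite !orbT.
  by rewrite !(inE, mem_cat) => /or3P[]->; rewrite ?orbT.
- move=> P Q i u e x P' ns _ IH y; rewrite !(inE, mem_cat) => /orP[/IH|->]; last by rewrite !orbT.
  by rewrite !(inE, mem_cat) => /or3P[]->; rewrite ?orbT.
- move=> P Q i u e x P' ns _ IH y; rewrite !(inE, mem_cat) => /orP[->|/IH]; first by rewrite !orbT.
  by rewrite !(inE, mem_cat) => /or3P[]->; rewrite ?orbT.
Qed.

Lemma ust_fv U i k x U' ns : ust U i k x U' ns -> {subset fv U' <= x :: ns ++ fv U}.
Proof.
elim=> //= {U i k x U' ns}.
- move=> P Q i k x P' ns _ IH y; rewrite !(inE, mem_cat) => /orP[/IH|->]; last by rewrite !orbT.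
  by rewrite !(inE, mem_cat) => /or3P[]->; rewrite ?orbT.
- move=> P Q i k x P' ns _ IH y; rewrite !(inE, mem_cat) => /orP[->|/IH]; first by rewrite !orbT.
  by rewrite !(inE, mem_cat) => /or3P[]->; rewrite ?orbT.
- move=> P Q i k x P' ns _ IH y; rewrite !(inE, mem_cat) => /orP[/IH|->]; last by rewrite !orbT.
  by rewrite !(inE, mem_cat) => /or3P[]->; rewrite ?orbT.
- move=> P Q i k x P' ns _ IH y; rewrite !(inE, mem_cat) => /orP[->|/IH]; first by rewrite !orbT.
  by rewrite !(inE, mem_cat) => /or3P[]->; rewrite ?orbT.
- move=> P Q i k u e x P' Q' ns ms /fire_fv fP /fire_fv fQ y.
  by rewrite !(inE, mem_cat) => /orP[/fP|/fQ]; rewrite !(inE, mem_cat) => /or3P[]->; rewrite ?orbT.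
Qed.

Lemma step_vis_strip T U zs u e x i T' A :
  sr T U zs -> lc T -> step T (Vis u e x i) T' -> x \notin zs -> u \notin zs ->
  exists ns U' zs', [/\ fire U i u e x U' ns, sr T' U' zs', perm_eq zs' (zs ++ ns),
    uniq ns & fresh A ns].
Proof.
rewrite /lc => H; elim: H i T' => {T U zs}.
- by move=> c i T' _ st; inversion st.
- move=> v f P i T' _ st _ _; inversion st; subst.
  have [B [ns [sB uB fB]]] := sr_ex (open x P) A.
  by exists ns, (Diam B), ns; split=> //; constructor.
- move=> P U zs sU IH i T' lP st xz uz; inversion st as [|? a P' sP| | | | | |]; subst.
  inv_prefix.
  have [ns [U' [zs' [? ? ? ? ?]]]] := IH _ _ lP sP xz uz.
  by exists ns, (Diam U'), zs'; split=> //; constructor.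
- move=> P Q U V zs ws sU IP sV IQ i T' /= /andP[lP lQ] st.
  rewrite !mem_cat !negb_or => /andP[xz xw] /andP[uz uw].
  inversion st as [| |? ? a P' sP fr|? ? a Q' sP fr| | | |]; subst; inv_prefix.
    have [ns [U' [zs' [? ? pe ? ?]]]] := IP _ _ lP sP xz uz.
    exists ns, (Par U' V), (zs' ++ ws); split=> //; try by constructor.
    rewrite (perm_trans (perm_cat pe (perm_refl ws))) // -!catA perm_cat2l.
    by rewrite perm_catC.
  have [ns [V' [ws' [? ? pe ? ?]]]] := IQ _ _ lQ sP xw uw.
  exists ns, (Par U V'), (zs ++ ws'); split=> //; try by constructor.
  by rewrite -catA perm_cat2l.
- move=> P Q U V zs ws sU IP sV IQ i T' /= /andP[lP lQ] st.
  rewrite !mem_cat !negb_or => /andP[xz xw] /andP[uz uw].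
  inversion st as [| | | |? ? a P' sP fr|? ? a Q' sP fr| |]; subst; inv_prefix.
    have [ns [U' [zs' [? ? pe ? ?]]]] := IP _ _ lP sP xz uz.
    exists ns, (SPar U' V), (zs' ++ ws); split=> //; try by constructor.
    rewrite (perm_trans (perm_cat pe (perm_refl ws))) // -!catA perm_cat2l.
    by rewrite perm_catC.
  have [ns [V' [ws' [? ? pe ? ?]]]] := IQ _ _ lQ sP xw uw.
  exists ns, (SPar U V'), (zs ++ ws'); split=> //; try by constructor.
  by rewrite -catA perm_cat2l.
- move=> z P U zs zP sU IH i T' /= lP st.
  rewrite !inE !negb_or => /andP[xz xzs] /andP[uz uzs].
  have [|P' sP' ->] := step_nu_inv st zP.
    by rewrite !inE !negb_or eq_sym uz eq_sym xz.
  have lP' := lc_open z lP.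
  have [ns [U' [zs' [? ? pe ? ?]]]] := IH _ _ lP' sP' xzs uzs.
  exists ns, U', (z :: zs'); split=> //; last by rewrite /= perm_cons.
  constructor; first by rewrite fv_close mem_filter eqxx.
  by rewrite /open /close open_close //; apply: (lc_step sP').
Qed.

Lemma fire_step T U zs i u e x U' ns :
  sr T U zs -> lc T -> fire U i u e x U' ns -> x \notin fv T -> x \notin zs -> u \notin zs ->
  exists T' zs', [/\ step T (Vis u e x i) T', sr T' U' zs' & perm_eq zs' (zs ++ ns)].
Proof.
rewrite /lc => H; elim: H i U' => {T U zs}.
- by move=> c i U' _ fi; inversion fi.
- move=> v f P i U' _ fi xT _ _; inversion fi; subst.
  exists (Diam (open x P)), ns; split=> //; last by constructor.
  exact: st_act.
- move=> P U zs sU IH i U' lP fi xP xz uz; inversion fi as [|? j ? ? ? V' ? fV| | | |]; subst.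
  have [T' [zs' [? ? ?]]] := IH _ _ lP fV xP xz uz.
  by exists (Diam T'), zs'; split=> //; [apply: (@st_diam _ _ (Vis u e x j)) | constructor].
- move=> P Q U V zs ws sU IP sV IQ i U' /= /andP[lP lQ] fi.
  rewrite !mem_cat !negb_or => /andP[xP xQ] /andP[xz xw] /andP[uz uw].
  inversion fi as [| |? ? j ? ? ? V' ? fV|? ? j ? ? ? V' ? fV| |]; subst.
    have [T' [zs' [? ? pe]]] := IP _ _ lP fV xP xz uz.
    exists (Par T' Q), (zs' ++ ws); split; try by constructor.
      exact: (@st_parL _ _ _ (Vis u e x j)).
    rewrite (perm_trans (perm_cat pe (perm_refl ws))) // -!catA perm_cat2l.
    by rewrite perm_catC.
  have [T' [ws' [? ? pe]]] := IQ _ _ lQ fV xQ xw uw.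
  exists (Par P T'), (zs ++ ws'); split; try by constructor.
    exact: (@st_parR _ _ _ (Vis u e x j)).
  by rewrite -catA perm_cat2l.
- move=> P Q U V zs ws sU IP sV IQ i U' /= /andP[lP lQ] fi.
  rewrite !mem_cat !negb_or => /andP[xP xQ] /andP[xz xw] /andP[uz uw].
  inversion fi as [| | | |? ? j ? ? ? V' ? fV|? ? j ? ? ? V' ? fV]; subst.
    have [T' [zs' [? ? pe]]] := IP _ _ lP fV xP xz uz.
    exists (SPar T' Q), (zs' ++ ws); split; try by constructor.
      exact: (@st_sparL _ _ _ (Vis u e x j)).
    rewrite (perm_trans (perm_cat pe (perm_refl ws))) // -!catA perm_cat2l.
    by rewrite perm_catC.
  have [T' [ws' [? ? pe]]] := IQ _ _ lQ fV xQ xw uw.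
  exists (SPar P T'), (zs ++ ws'); split; try by constructor.
    exact: (@st_sparR _ _ _ (Vis u e x j)).
  by rewrite -catA perm_cat2l.
- move=> z P U zs zP sU IH i U' /= lP fi xP.
  rewrite !inE !negb_or => /andP[xz xzs] /andP[uz uzs].
  have xP' : x \notin fv (open z P).
    by apply/negP => /fv_open; rewrite inE (negPf xz) (negPf xP).
  have [T' [zs' [sT' ? pe]]] := IH _ _ (lc_open z lP) fi xP' xzs uzs.
  exists (Nu (close z T')), (z :: zs'); split; last by rewrite /= perm_cons.
    by apply: st_nu sT' => //; rewrite !inE negb_or eq_sym uz eq_sym xz.
  constructor; first by rewrite fv_close mem_filter eqxx.
  rewrite /open /close open_close //; exact: lc_step sT' (lc_open z lP).
Qed.

End Stripping.

(* Closes a commutation goal when both transitions happen inside the same component. *)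
Ltac local_swap IH := match goal with h : _ |- _ =>
  (edestruct (IH _ _ h) || edestruct (IH _ _ _ h));
  [done .. | eexists; constructor; eassumption] end.

(** * Transitions of terms versus transitions of their opened forms *)

Section Bridge.
Variable K : comPzSemiRingType.
Implicit Types (P Q T U V : term K) (a : label) (i j k : position) (zs ns ms A : seq name).

Lemma fresh_catl A zs ws : fresh A (zs ++ ws) = fresh A zs && fresh A ws.
Proof. by rewrite /fresh all_cat. Qed.

Lemma perm_insert (zs zs' ns ms : seq name) :
  perm_eq zs' (zs ++ ns) -> perm_eq (zs' ++ ms) ((zs ++ ms) ++ ns).
Proof.
move=> pe; rewrite (perm_trans (perm_cat pe (perm_refl ms))) // -!catA perm_cat2l.
by rewrite perm_catC.
Qed.

Lemma perm_merge z (zs zs' ws ws' ns ms : seq name) :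
  perm_eq zs' (zs ++ ns) -> perm_eq ws' (ws ++ ms) ->
  perm_eq (z :: zs' ++ ws') ((zs ++ ws) ++ z :: ns ++ ms).
Proof.
move=> /permP pe1 /permP pe2; apply/permP => p.
by rewrite /= !count_cat /= !count_cat pe1 pe2 !count_cat addnACA [RHS]addnCA.
Qed.

(** The hiding of the created name is opened at once, together with those uncovered by the two
    continuations; all these names can be taken outside of any prescribed [A]. *)
Lemma step_int_strip T U zs i k T' A :
  sr T U zs -> lc T -> uniq zs -> fresh (fv T) zs -> step T (Int i k) T' ->
  exists x ns U' zs', [/\ ust U i k x U' ns, sr T' U' zs', perm_eq zs' (zs ++ x :: ns),
    uniq (x :: ns) & fresh A (x :: ns)].
Proof.
rewrite /lc => H; elim: H i k T' => {T U zs}.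
- by move=> c i k T' _ _ _ st; inversion st.
- by move=> v f P i k T' _ _ _ st; inversion st.
- move=> P U zs sU IH i k T' lP uz fz st; inversion st as [|? a P' sP| | | | | |]; subst; inv_prefix.
  have [x [ns [U' [zs' [? ? ? ? ?]]]]] := IH _ _ _ lP uz fz sP.
  by exists x, ns, (Diam U'), zs'; split=> //; constructor.
- move=> P Q U V zs ws sU IP sV IQ i k T' /= /andP[lP lQ].
  rewrite cat_uniq !fresh_cat !fresh_catl => /and3P[uz dzw uw] /andP[/andP[fPz fPw] /andP[fQz fQw]] st.
  inversion st as [| |? ? a P' sP fr|? ? a Q' sP fr| | | |]; subst; try inv_prefix.
  + have [x [ns [U' [zs' [? ? pe ? ?]]]]] := IP _ _ _ lP uz fPz sP.
    exists x, ns, (Par U' V), (zs' ++ ws); split=> //; try by constructor.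
    exact: perm_insert.
  + have [x [ns [V' [ws' [? ? pe ? ?]]]]] := IQ _ _ _ lQ uw fQw sP.
    exists x, ns, (Par U V'), (zs ++ ws'); split=> //; try by constructor.
    by rewrite -catA perm_cat2l.
  + have [z] := fresh_name (A ++ fv P ++ fv Q ++ zs ++ ws).
    rewrite !mem_cat !negb_or => /and5P[zA zP zQ zz zw].
    have [v [f [P1 [Q1 [sP sQ ->]]]]] := step_comm_inv st zP zQ.
    have vP := step_subj sP (mem_head _ _); have vQ := step_subj sQ (mem_head _ _).
    (* The subject is free in both components, whereas the opened names of one component are fresh
       for the other: no opened name is the subject of the synchronisation. *)
    have vz : v \notin zs by apply/negP => /(allP fQz); rewrite vQ.
    have vw : v \notin ws by apply/negP => /(allP fPw); rewrite vP.
    have [ns [U1 [zs1 [fi sU1 pe1 un fn]]]] := step_vis_strip (z :: A) sU lP sP zz vz.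
    have [ms [V1 [ws1 [fj sV1 pe2 um fm]]]] := step_vis_strip (z :: A ++ ns) sV lQ sQ zw vw.
    exists z, (ns ++ ms), (Par U1 V1), (z :: zs1 ++ ws1); split=> //.
    * exact: us_comm fi fj.
    * constructor; first by rewrite /close /= !fv_close mem_cat !mem_filter eqxx.
      rewrite /open /close /= !open_close; first by constructor.
        exact: lc_step sQ lQ.
      exact: lc_step sP lP.
    * exact: perm_merge.
    * rewrite /= mem_cat negb_or cat_uniq un um andbT -!andbA; apply/and4P; split=> //.
        by apply/negP => /(allP fn); rewrite mem_head.
        by apply/negP => /(allP fm); rewrite mem_head.
      apply/hasPn => w /(allP fm); by rewrite inE mem_cat !negb_or => /and3P[].
    * rewrite /= zA /= fresh_catl (freshW _ fn) ?(freshW _ fm) // => w wA.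
        by rewrite inE mem_cat wA orbT.
      by rewrite inE wA orbT.
- move=> P Q U V zs ws sU IP sV IQ i k T' /= /andP[lP lQ].
  rewrite cat_uniq !fresh_cat !fresh_catl => /and3P[uz dzw uw] /andP[/andP[fPz fPw] /andP[fQz fQw]] st.
  inversion st as [| | | |? ? a P' sP fr|? ? a Q' sP fr| |]; subst; inv_prefix.
  + have [x [ns [U' [zs' [? ? pe ? ?]]]]] := IP _ _ _ lP uz fPz sP.
    exists x, ns, (SPar U' V), (zs' ++ ws); split=> //; try by constructor.
    exact: perm_insert.
  + have [x [ns [V' [ws' [? ? pe ? ?]]]]] := IQ _ _ _ lQ uw fQw sP.
    exists x, ns, (SPar U V'), (zs ++ ws'); split=> //; try by constructor.
    by rewrite -catA perm_cat2l.
- move=> z P U zs zP sU IH i k T' /= lP /andP[zz uz] /andP[_ fz] st.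
  have [//|P' sP' ->] := step_nu_inv st zP.
  have lP' := lc_open z lP.
  have [|x [ns [U' [zs' [? ? pe ? ?]]]]] := IH _ _ _ lP' uz _ sP'.
    apply/allP => w wz; apply/negP => /fv_open; rewrite inE (negPf (allP fz _ wz)) orbF => /eqP wz'.
    by rewrite -wz' wz in zz.
  exists x, ns, U', (z :: zs'); split=> //; last by rewrite /= perm_cons.
  constructor; first by rewrite fv_close mem_filter eqxx.
  by rewrite /open /close open_close //; apply: (lc_step sP').
Qed.

Lemma ust_step T U zs i k x U' ns :
  sr T U zs -> lc T -> uniq zs -> fresh (fv T) zs -> ust U i k x U' ns ->
  x \notin fv T -> x \notin zs ->
  exists T' zs', [/\ step T (Int i k) T', sr T' U' zs' & perm_eq zs' (zs ++ x :: ns)].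
Proof.
rewrite /lc => H; elim: H i k U' => {T U zs}.
- by move=> c i k U' _ _ _ fi; inversion fi.
- by move=> v f P i k U' _ _ _ fi; inversion fi.
- move=> P U zs sU IH i k U' lP uz fz fi xP xz.
  inversion fi as [? j l ? V' ? fV| | | | |]; subst.
  have [T' [zs' [? ? ?]]] := IH _ _ _ lP uz fz fV xP xz.
  by exists (Diam T'), zs'; split=> //; [apply: (@st_diam _ _ (Int j l)) | constructor].
- move=> P Q U V zs ws sU IP sV IQ i k U' /= /andP[lP lQ].
  rewrite cat_uniq !fresh_cat !fresh_catl => /and3P[uz dzw uw] /andP[/andP[fPz fPw] /andP[fQz fQw]] fi.
  rewrite !mem_cat !negb_or => /andP[xP xQ] /andP[xz xw].
  inversion fi as [|? ? j l ? V' ? fV|? ? j l ? V' ? fV| | |? ? j l v e ? U1 V1 n1 n2 fU fV]; subst.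
  + have [T' [zs' [? ? pe]]] := IP _ _ _ lP uz fPz fV xP xz.
    exists (Par T' Q), (zs' ++ ws); split; try by constructor.
      exact: (@st_parL _ _ _ (Int j l)).
    exact: perm_insert.
  + have [T' [ws' [? ? pe]]] := IQ _ _ _ lQ uw fQw fV xQ xw.
    exists (Par P T'), (zs ++ ws'); split; try by constructor.
      exact: (@st_parR _ _ _ (Int j l)).
    by rewrite -catA perm_cat2l.
  (* An opened name of one component is fresh for the other and differs from its opened names, so it
     cannot be a subject on both sides. *)
  + have vz : v \notin zs.
      apply/negP => vz; have := sr_fv sV (fire_subj fV); rewrite mem_cat.
      rewrite (negPf (allP fQz _ vz)) /= => vw; move/hasPn: dzw => /(_ _ vw).
      by rewrite vz.
    have vw : v \notin ws.
      apply/negP => vw; have := sr_fv sU (fire_subj fU); rewrite mem_cat.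
      rewrite (negPf (allP fPw _ vw)) /= => vz'; by rewrite vz' in vz.
    have [T1 [zs1 [sT1 ? pe1]]] := fire_step sU lP fU xP xz vz.
    have [T2 [zs2 [sT2 ? pe2]]] := fire_step sV lQ fV xQ xw vw.
    exists (Nu (close x (Par T1 T2))), (x :: zs1 ++ zs2); split.
    * exact: step_comm sT1 sT2.
    * constructor; first by rewrite /close /= !fv_close mem_cat !mem_filter eqxx.
      rewrite /open /close /= !open_close; first by constructor.
        exact: lc_step sT2 lQ.
      exact: lc_step sT1 lP.
    * exact: perm_merge.
- move=> P Q U V zs ws sU IP sV IQ i k U' /= /andP[lP lQ].
  rewrite cat_uniq !fresh_cat !fresh_catl => /and3P[uz dzw uw] /andP[/andP[fPz fPw] /andP[fQz fQw]] fi.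
  rewrite !mem_cat !negb_or => /andP[xP xQ] /andP[xz xw].
  inversion fi as [| | |? ? j l ? V' ? fV|? ? j l ? V' ? fV|]; subst.
  + have [T' [zs' [? ? pe]]] := IP _ _ _ lP uz fPz fV xP xz.
    exists (SPar T' Q), (zs' ++ ws); split; try by constructor.
      exact: (@st_sparL _ _ _ (Int j l)).
    exact: perm_insert.
  + have [T' [ws' [? ? pe]]] := IQ _ _ _ lQ uw fQw fV xQ xw.
    exists (SPar P T'), (zs ++ ws'); split; try by constructor.
      exact: (@st_sparR _ _ _ (Int j l)).
    by rewrite -catA perm_cat2l.
- move=> z P U zs zP sU IH i k U' /= lP /andP[zz uz] /andP[_ fz] fi xP.
  rewrite !inE !negb_or => /andP[xz xzs].
  have xP' : x \notin fv (open z P).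
    by apply/negP => /fv_open; rewrite inE (negPf xz) (negPf xP).
  have [|T' [zs' [sT' ? pe]]] := IH _ _ _ (lc_open z lP) uz _ fi xP' xzs.
    apply/allP => w wz; apply/negP => /fv_open; rewrite inE (negPf (allP fz _ wz)) orbF => /eqP wz'.
    by rewrite -wz' wz in zz.
  exists (Nu (close z T')), (z :: zs'); split; last by rewrite /= perm_cons.
    exact: st_nu sT'.
  constructor; first by rewrite fv_close mem_filter eqxx.
  rewrite /open /close open_close //; exact: lc_step sT' (lc_open z lP).
Qed.

(* [A] contains every name used so far, hence [x :: ns] fresh for [A] is a legitimate choice. *)
Record stripped A T U zs : Prop := Stripped {
  stripped_lc : lc T;
  stripped_sr : sr T U zs;
  stripped_uniq : uniq zs;
  stripped_fresh : fresh (fv T) zs;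
  stripped_fv : {subset fv T <= A};
  stripped_zs : {subset zs <= A} }.

Definition newnames A x ns := uniq (x :: ns) && fresh A (x :: ns).

Lemma newnamesW A B x ns : {subset B <= A} -> newnames A x ns -> newnames B x ns.
Proof. by move=> BA /andP[u f]; rewrite /newnames u (freshW BA f). Qed.

Lemma strippedW A B T U zs : {subset A <= B} -> stripped A T U zs -> stripped B T U zs.
Proof. by move=> AB [? ? ? ? f z]; split=> // w /[dup]; [move=> _ /f|move=> _ /z]; apply: AB. Qed.

Lemma stripped_ex A T : lc T -> exists U zs, stripped (fv T ++ zs) T U zs /\ fresh A zs.
Proof.
move=> lT; have [U [zs [s u]]] := sr_ex T (A ++ fv T); rewrite fresh_cat => /andP[fA fT].
by exists U, zs; split=> //; split=> // w wT; rewrite mem_cat wT ?orbT.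
Qed.

Lemma stripped_fvU A T U zs : stripped A T U zs -> {subset fv U <= A}.
Proof. by case=> _ s _ _ f z x /(sr_fv s); rewrite mem_cat => /orP[/f|/z]. Qed.

Lemma stripped_lcU A T U zs : stripped A T U zs -> lc U.
Proof. by case=> l s *; apply: (sr_lc s). Qed.

Lemma stripped_next A T U zs i k x T' U' zs' ns : stripped A T U zs -> newnames A x ns ->
  step T (Int i k) T' -> sr T' U' zs' -> perm_eq zs' (zs ++ x :: ns) ->
  stripped (x :: ns ++ A) T' U' zs'.
Proof.
move=> [lT sT uz fz fT zA] /andP[un fn] st sT' pe.
have fvT' := step_fv st; rewrite /= in fvT'.
have mz w : w \in zs' -> (w \in zs) || (w \in x :: ns) by rewrite (perm_mem pe) mem_cat.
split=> //; first exact: lc_step st lT.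
- rewrite (perm_uniq pe) cat_uniq uz un andbT; apply/hasPn => w /(allP fn).
  by apply/contra/zA.
- apply/allP => w /mz /orP[/(allP fz)|/(allP fn)]; apply: contra => /fvT' //.
  exact: fT.
- by move=> w /fvT'/fT wA; rewrite inE mem_cat wA !orbT.
- by move=> w /mz; rewrite !inE mem_cat => /or3P[/zA->|->|->]; rewrite ?orbT.
Qed.

Lemma stripped_step A B T U zs i k T' : stripped A T U zs -> step T (Int i k) T' ->
  exists x ns U' zs', [/\ ust U i k x U' ns, newnames (A ++ B) x ns & stripped (x :: ns ++ A) T' U' zs'].
Proof.
move=> s st; case: (s) => lT sT uz fz fT zA.
have [x [ns [U' [zs' [us sT' pe un fn]]]]] := step_int_strip (A ++ B) sT lT uz fz st.
have nn : newnames (A ++ B) x ns by rewrite /newnames un.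
exists x, ns, U', zs'; split=> //; apply: stripped_next s _ st sT' pe.
by apply: newnamesW nn => w; rewrite mem_cat => ->.
Qed.

Lemma stripped_ust A T U zs i k x U' ns : stripped A T U zs -> ust U i k x U' ns ->
  newnames A x ns ->
  exists T' zs', step T (Int i k) T' /\ stripped (x :: ns ++ A) T' U' zs'.
Proof.
move=> s us nn; case: (s) => lT sT uz fz fT zA.
have xA : x \notin A by case/andP: nn => _ /= /andP[].
have [||T' [zs' [st sT' pe]]] := ust_step sT lT uz fz us; try exact: contra xA.
  by apply: contra xA; apply: fT.
  by apply: contra xA; apply: zA.
by exists T', zs'; split=> //; apply: stripped_next s nn st sT' pe.
Qed.

(** All names being explicit in opened forms, transitions commute with equality of the resulting
    terms. The second can depend on the first only if its position lies below the first one, in the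
    continuation just uncovered. The three variants that follow cover internal transitions. *)
Lemma fire_fire U i u e x U1 ns k v f y U2 ms : fire U i u e x U1 ns ->
  fire U1 k v f y U2 ms -> ~~ prefix i k ->
  exists2 U1', fire U k v f y U1' ms & fire U1' i u e x U2 ns.
Proof.
move=> H; elim: H k U2 => {U i u e x U1 ns}
  [u e P x B ns _ k U2 _|P|P Q|P Q|P Q|P Q]; first by rewrite prefix0s.
all: move=> i u e x P' ns H IH k U2 fi np;
  inversion fi; subst; try local_swap IH.
- by eexists; [apply: fi_parR; eassumption | apply: fi_parL].
- by eexists; [apply: fi_parL; eassumption | apply: fi_parR].
- by eexists; [apply: fi_sparR; eassumption | apply: fi_sparL].
- by eexists; [apply: fi_sparL; eassumption | apply: fi_sparR].
Qed.

Lemma fire_ust U i u e x U1 ns j k y U2 ms : fire U i u e x U1 ns ->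
  ust U1 j k y U2 ms -> ~~ prefix i j -> ~~ prefix i k ->
  exists2 U1', ust U j k y U1' ms & fire U1' i u e x U2 ns.
Proof.
move=> H; elim: H j k U2 => {U i u e x U1 ns}
  [u e P x B ns _ j k U2 _|P|P Q|P Q|P Q|P Q]; first by rewrite prefix0s.
all: move=> i u e x P' ns H IH j k U2 us np np';
  inversion us; subst; try local_swap IH.
- by eexists; [apply: us_parR; eassumption | apply: fi_parL].
- match goal with h : fire P' _ _ _ _ _ _ |- _ => have [//|V ? ?] := fire_fire H h end.
  by eexists; [apply: us_comm; eassumption | apply: fi_parL].
- by eexists; [apply: us_parL; eassumption | apply: fi_parR].
- match goal with h : fire P' _ _ _ _ _ _ |- _ => have [//|V ? ?] := fire_fire H h end.
  by eexists; [apply: us_comm; eassumption | apply: fi_parR].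
- by eexists; [apply: us_sparR; eassumption | apply: fi_sparL].
- by eexists; [apply: us_sparL; eassumption | apply: fi_sparR].
Qed.

Lemma ust_fire U i u e x U1 ns j k y U2 ms : ust U j k y U1 ms ->
  fire U1 i u e x U2 ns -> ~~ prefix j i -> ~~ prefix k i ->
  exists2 U1', fire U i u e x U1' ns & ust U1' j k y U2 ms.
Proof.
move=> H; elim: H i U2 => {U j k y U1 ms} [P|P Q|P Q|P Q|P Q|P Q j k v f y P' Q' m1 m2 HP HQ]; last first.
  move=> i U2 fi np np'; inversion fi; subst.
    match goal with h : fire P' _ _ _ _ _ _ |- _ => have [//|V ? ?] := fire_fire HP h end.
    by eexists; [apply: fi_parL; eassumption | apply: us_comm; eassumption].
  match goal with h : fire Q' _ _ _ _ _ _ |- _ => have [//|V ? ?] := fire_fire HQ h end.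
  by eexists; [apply: fi_parR; eassumption | apply: us_comm; eassumption].
all: move=> j k y P' ms H IH i U2 fi np np'; inversion fi; subst; try local_swap IH.
- by eexists; [apply: fi_sparL; eassumption | apply: us_sparR].
- by eexists; [apply: fi_sparR; eassumption | apply: us_sparL].
- by eexists; [apply: fi_parL; eassumption | apply: us_parR].
- by eexists; [apply: fi_parR; eassumption | apply: us_parL].
Qed.

Lemma ust_ust U i l x U1 ns j k y U2 ms : ust U i l x U1 ns -> ust U1 j k y U2 ms ->
  ~~ prefix i j -> ~~ prefix i k -> ~~ prefix l j -> ~~ prefix l k ->
  exists2 U1', ust U j k y U1' ms & ust U1' i l x U2 ns.
Proof.
move=> H; elim: H j k U2 => {U i l x U1 ns}
  [P|P Q|P Q|P Q|P Q|P Q i l v f x P' Q' n1 n2 HP HQ]; last first.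
  move=> j k U2 us np1 np2 np3 np4; inversion us; subst.
  - match goal with h : ust P' _ _ _ _ _ |- _ => have [//|//|V ? ?] := fire_ust HP h end.
    by eexists; [apply: us_parL; eassumption | apply: us_comm; eassumption].
  - match goal with h : ust Q' _ _ _ _ _ |- _ => have [//|//|V ? ?] := fire_ust HQ h end.
    by eexists; [apply: us_parR; eassumption | apply: us_comm; eassumption].
  - match goal with h : fire P' _ _ _ _ _ _ |- _ => have [//|V ? ?] := fire_fire HP h end.
    match goal with h : fire Q' _ _ _ _ _ _ |- _ => have [//|W ? ?] := fire_fire HQ h end.
    by eexists; apply: us_comm; eassumption.
all: move=> i l x P' ns H IH j k U2 us np1 np2 np3 np4; inversion us; subst; try local_swap IH.
- by eexists; [apply: us_sparL; eassumption | apply: us_sparR].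
- by eexists; [apply: us_sparR; eassumption | apply: us_sparL].
- by eexists; [apply: us_parL; eassumption | apply: us_parR].
- match goal with h : fire P' _ _ _ _ _ _ |- _ => have [//|//|V ? ?] := ust_fire H h end.
  by eexists; [apply: us_comm; eassumption | apply: us_parR].
- by eexists; [apply: us_parR; eassumption | apply: us_parL].
- match goal with h : fire P' _ _ _ _ _ _ |- _ => have [//|//|V ? ?] := ust_fire H h end.
  by eexists; [apply: us_comm; eassumption | apply: us_parL].
Qed.

End Bridge.

(** * Runs as paths up to permutation *)

Section Totals.
Variables (K : comPzSemiRingType) (X : eqType).
Implicit Types (M : seq X -> Prop) (f : seq X -> K) (p q r : seq X) (ps qs rs : seq (seq X)).
Local Open Scope ring_scope.

Definition nperm p q := ~~ perm_eq p q.

Definition perm_transversal M ps := [/\ forall p, p \in ps -> M p, pairwise nperm ps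
  & forall p, M p -> has (perm_eq p) ps].

(** A relation rather than a function: representatives are obtained classically, and the sum is
    independent of them only when [f] is constant on permutation classes, which is [permfun]. *)
Definition permsum M f (k : K) := exists2 ps, perm_transversal M ps & k = \sum_(p <- ps) f p.

Lemma perm_transversal_ex M ps : (forall p, M p -> p \in ps) -> exists qs, perm_transversal M qs.
Proof.
move=> fin; suff [qs [h1 h2 h3]] : exists qs, [/\ forall p, p \in qs -> M p, pairwise nperm qs
  & forall p, p \in ps -> M p -> has (perm_eq p) qs].
  by exists qs; split=> // p Mp; apply: h3 (fin p Mp) Mp.
elim: ps {fin} => [|p ps [qs [h1 h2 h3]]]; first by exists [::].
case: (excluded_middle_informative (M p)) => [Mp|nMp]; last first.
  by exists qs; split=> // q; rewrite inE => /orP[/eqP->|/h3].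
case hp: (has (perm_eq p) qs).
  by exists qs; split=> // q; rewrite inE => /orP[/eqP->|/h3].
exists (p :: qs); split.
- by move=> q; rewrite inE => /orP[/eqP->|/h1].
- by rewrite /= h2 andbT; apply/allP => q qqs; apply: contraFN hp => pq; apply/hasP; exists q.
- by move=> q; rewrite inE => /orP[/eqP-> _|/h3 h /h /= ->]; rewrite /= ?perm_refl ?orbT.
Qed.

(** Classes of [qs] without a counterpart in [rs] are tolerated when their value is 0; this is how
    the runs that contradict a guess will be discarded. *)
Lemma sum_match f f' rs qs : pairwise nperm rs -> pairwise nperm qs ->
  (forall r, r \in rs -> exists2 q, q \in qs & perm_eq q r /\ f r = f' q) ->
  (forall q, q \in qs -> f' q = 0 \/ exists2 r, r \in rs & perm_eq q r) ->
  \sum_(r <- rs) f r = \sum_(q <- qs) f' q.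
Proof.
have uniqP ps : pairwise nperm ps -> uniq ps.
  elim: ps => //= p ps IH /andP[/allP h /IH->]; rewrite andbT.
  by apply/negP => /h; rewrite /nperm perm_refl.
have nP ps p q : pairwise nperm ps -> p \in ps -> q \in ps -> perm_eq p q -> p = q.
  elim: ps => //= r ps IH /andP[/allP h pw]; rewrite !inE.
  case/orP=> [/eqP->|pps] /orP[/eqP->|qps] // pq; last exact: IH.
    by have := h _ qps; rewrite /nperm pq.
  by have := h _ pps; rewrite /nperm perm_sym pq.
elim: rs qs => [|r rs IH] qs pr pq hr hq.
  rewrite big_nil big_seq big1 // => q /hq[//|[]//].
have [q qqs [qr fr]] := hr r (mem_head _ _).
rewrite big_cons [RHS](big_rem q) //= fr; congr (_ + _).
case/andP: (pr) => /allP prr prs; have uq := uniqP _ pq.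
apply: IH => //.
- by apply: subseq_pairwise pq; apply: rem_subseq.
- move=> r' rr'; have [|q' qqs' [qr' fr']] := hr r'; first by rewrite inE rr' orbT.
  exists q' => //; rewrite (mem_rem_uniq _ uq) !inE qqs' andbT.
  apply/negP => /eqP eq'; have := prr _ rr'; rewrite /nperm perm_sym.
  by move: qr' qr; rewrite eq' perm_sym => qr' qr; rewrite (perm_trans qr' qr).
- move=> q'; rewrite (mem_rem_uniq _ uq) inE => /andP[nq qqs'].
  case: (hq _ qqs') => [->|]; first by left.
  case=> r'; rewrite inE => /orP[/eqP->|rr'] qr'; last by right; exists r'.
  case/eqP: nq; apply: nP pq qqs' qqs _.
  by rewrite (perm_trans qr') // perm_sym.
Qed.

Definition permfun M f := forall p q, M p -> M q -> perm_eq p q -> f p = f q.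

Lemma permsum_map f k M' f' k' M (h : seq X -> seq X) :
  permsum M f k -> permsum M' f' k' -> permfun M' f' ->
  (forall p, M p -> M' (h p) /\ f p = f' (h p)) ->
  (forall p q, M p -> M q -> perm_eq (h p) (h q) = perm_eq p q) ->
  (forall q, M' q -> f' q = 0 \/ exists2 p, M p & perm_eq q (h p)) ->
  k = k'.
Proof.
move=> [ps [ps1 ps2 ps3] ->] [qs [qs1 qs2 qs3] ->] inv hM hI hS.
rewrite [LHS](_ : _ = \sum_(r <- [seq h p | p <- ps]) f' r); last first.
  by rewrite big_map big_seq [RHS]big_seq; apply: eq_bigr => p /ps1/hM[_ ->].
apply: sum_match => //.
- rewrite pairwise_map; apply: (sub_in_pairwise (P := [in ps])) ps2 => [p q|]; last exact/allP.
  by move=> /ps1 Mp /ps1 Mq; rewrite /nperm /= hI.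
- move=> _ /mapP[p /ps1 Mp ->]; have [M'p _] := hM p Mp.
  have /hasP[q qqs pq] := qs3 _ M'p; exists q; first by [].
  by rewrite perm_sym pq; split=> //; apply: inv => //; apply: qs1.
- move=> q /qs1 M'q; case: (hS _ M'q) => [->|[p Mp qp]]; [by left | right].
  have /hasP[p' p'ps pp'] := ps3 _ Mp; exists (h p'); first exact: map_f.
  by rewrite (perm_trans qp) // hI //; apply: ps1.
Qed.

Lemma permsum_uniq M f k k' : permfun M f -> permsum M f k -> permsum M f k' -> k = k'.
Proof.
move=> inv tk tk'; apply: (permsum_map (h := id)) tk tk' inv _ _ _ => // q Mq.
by right; exists q.
Qed.

Lemma permsum_cat M1 M2 M f k1 k2 : permsum M1 f k1 -> permsum M2 f k2 ->
  (forall p, M p <-> M1 p \/ M2 p) ->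
  (forall p q, M1 p -> M2 q -> ~~ perm_eq p q) -> permsum M f (k1 + k2).
Proof.
move=> [ps [p1 p2 p3] ->] [qs [q1 q2 q3] ->] MM dis.
exists (ps ++ qs); last by rewrite big_cat.
split.
- by move=> p; rewrite mem_cat => /orP[/p1|/q1] h; apply/MM; [left | right].
- rewrite pairwise_cat p2 q2 !andbT; apply/allrelP => p q /p1 + /q1; exact: dis.
- by move=> p /MM[/p3|/q3]; rewrite has_cat => ->; rewrite ?orbT.
Qed.

Lemma permsum_bigcup (I : eqType) (s : seq I) (N : I -> seq X -> Prop) f (g : I -> K) :
  uniq s -> (forall i, i \in s -> permsum (N i) f (g i)) ->
  (forall i j p q, i \in s -> j \in s -> N i p -> N j q -> perm_eq p q -> i = j) ->
  permsum (fun p => exists2 i, i \in s & N i p) f (\sum_(i <- s) g i).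
Proof.
elim: s => [_ _ _|i s IH /= /andP[nis us] tot dis].
  by exists [::]; rewrite ?big_nil //; split=> // p [].
rewrite big_cons; apply: (permsum_cat (tot i (mem_head _ _)) (IH us _ _)).
- by move=> j js; apply: tot; rewrite inE js orbT.
- by move=> j l p q js ls; apply: dis; rewrite inE ?js ?ls orbT.
- move=> p; split.
    by case=> j; rewrite inE => /orP[/eqP->|js] Nj; [left | right; exists j].
  by case=> [Ni|[j js Nj]]; [exists i; rewrite ?mem_head | exists j; rewrite ?inE ?js ?orbT].
- move=> p q Ni [j js Nj]; apply/negP => pq; move: nis.
  by rewrite (dis i j p q) ?js ?mem_head // inE js orbT.
Qed.

Lemma eq_permsum M M' f k : (forall p, M p <-> M' p) -> permsum M f k -> permsum M' f k.
Proof.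
move=> MM [ps [p1 p2 p3] ->]; exists ps => //; split=> // [p /p1/MM //|p /MM/p3 //].
Qed.

End Totals.

(** * Paths: exchanges, residuals and intersections *)

Section Traces.
Variable K : comPzSemiRingType.
Implicit Types (P Q T U V : term K) (a b : position * position) (p q r : Defs.path).

Lemma valid_toP T a p T2 : valid_to T (a :: p) T2 <->
  exists2 T1, step T (Int a.1 a.2) T1 & valid_to T1 p T2.
Proof.
case: a => i k /=; split=> [v|[T1 st v]]; last exact: vt_cons st v.
by inversion v; subst; exists P1.
Qed.

Lemma valid_to_nil T T1 : valid_to T [::] T1 -> T1 = T.
Proof. by move=> v; inversion v. Qed.

Lemma valid_to_cat T p q T2 :
  valid_to T (p ++ q) T2 <-> exists2 T1, valid_to T p T1 & valid_to T1 q T2.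
Proof.
elim: p T => [|a p IH] T /=.
  by split=> [v|[T1 /valid_to_nil->]]; first by exists T => //; constructor.
split=> [/valid_toP[T1 st /IH[T3 v v']]|[T1 /valid_toP[T3 st v v']]].
  by exists T3 => //; apply/valid_toP; exists T1.
by apply/valid_toP; exists T3 => //; apply/IH; exists T1.
Qed.

Lemma step_int_det T i k T1 T2 : step T (Int i k) T1 -> step T (Int i k) T2 -> T1 = T2.
Proof. by move=> s1 s2; case: (step_det s1 s2 erefl). Qed.

Lemma valid_to_det T p T1 T2 : valid_to T p T1 -> valid_to T p T2 -> T1 = T2.
Proof.
elim: p T => [|a p IH] T; first by move=> /valid_to_nil-> /valid_to_nil->.
by move=> /valid_toP[T3 s3 v3] /valid_toP[T4 /(step_int_det s3) <- /(IH _ v3)].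
Qed.

Lemma lc_valid T p T1 : valid_to T p T1 -> lc T -> lc T1.
Proof. by elim=> // {T p T1} P i k P1 p P2 st _ IH /(lc_step st)/IH. Qed.

(** Replaces equality of reached terms, which fails after an exchange of steps because the hidings
    are then created in another order. *)
Definition tequiv_sub T T' := forall p T1, valid_to T p T1 ->
  exists2 T2, valid_to T' p T2 & state T1 = state T2.
Definition tequiv T T' := tequiv_sub T T' /\ tequiv_sub T' T.

Lemma tequiv_refl T : tequiv T T.
Proof. by split=> p T1 v; exists T1. Qed.

Lemma tequiv_sym T T' : tequiv T T' -> tequiv T' T.
Proof. by case. Qed.

Lemma tequiv_trans T1 T2 T3 : tequiv T1 T2 -> tequiv T2 T3 -> tequiv T1 T3.
Proof.
move=> [h12 h21] [h23 h32]; split=> p T v.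
  by have [T' /h23[T'' v' e'] e] := h12 _ _ v; exists T''; rewrite ?e.
by have [T' /h21[T'' v' e'] e] := h32 _ _ v; exists T''; rewrite ?e.
Qed.

Lemma tequiv_state T T' : tequiv T T' -> state T = state T'.
Proof. by case=> h _; have [T2 /valid_to_nil->] := h _ _ (vt_nil T). Qed.

Lemma tequiv_valid T T' p T1 : tequiv T T' -> valid_to T p T1 ->
  exists2 T2, valid_to T' p T2 & tequiv T1 T2.
Proof.
move=> [h h'] v; have [T2 v2 _] := h _ _ v; exists T2 => //; split=> q T3 v3.
  have [|T4 /valid_to_cat[T5 v5 v4] e4] := h (p ++ q) T3.
    by apply/valid_to_cat; exists T1.
  by exists T4 => //; rewrite (valid_to_det v2 v5).
have [|T4 /valid_to_cat[T5 v5 v4] e4] := h' (p ++ q) T3.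
  by apply/valid_to_cat; exists T2.
by exists T4 => //; rewrite (valid_to_det v v5).
Qed.

(** Both terms follow the transitions of their common opened form, with the same names at each
    step. *)
Lemma stripped_tequiv_sub A T T' U zs ws : stripped A T U zs -> stripped A T' U ws ->
  tequiv_sub T T'.
Proof.
move=> s s' p; elim: p A T T' U zs ws s s' => [|[i k] p IH] A T T' U zs ws s s' T1.
  move=> /valid_to_nil->; exists T'; first by constructor.
  by rewrite (sr_state (stripped_sr s)) (sr_state (stripped_sr s')).
case/valid_toP=> T2 /= st v.
have [x [ns [U2 [zs2 [us nn s2]]]]] := stripped_step A s st.
have {}nn : newnames A x ns by apply: newnamesW nn => w wA; rewrite mem_cat wA.
have [T2' [ws2 [st' s2']]] := stripped_ust s' us nn.
have [T1' v' e'] := IH _ _ _ _ _ _ s2 s2' _ v.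
by exists T1' => //; apply/valid_toP; exists T2'.
Qed.

Lemma stripped_tequiv A T T' U zs ws : stripped A T U zs -> stripped A T' U ws ->
  tequiv T T'.
Proof. by move=> s s'; split; [apply: stripped_tequiv_sub s s' | apply: stripped_tequiv_sub s' s]. Qed.

(** The exchange takes place on opened forms. The names chosen for the two steps are disjoint, so
    they remain legitimate choices in the other order. *)
Lemma step_swap T i k T1 j l T2 : lc T -> step T (Int i k) T1 -> step T1 (Int j l) T2 ->
  indep_lab (i, k) (j, l) ->
  exists T1' T2', [/\ step T (Int j l) T1', step T1' (Int i k) T2' & tequiv T2 T2'].
Proof.
move=> lT st1 st2 [/= /andP[ij _] /andP[il _] /andP[kj _] /andP[kl _]].
have [U [zs [+ _]]] := stripped_ex [::] lT; move: (fv T ++ zs) => A s.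
have [x [ns [U1 [zs1 [us1 nn1 s1]]]]] := stripped_step A s st1.
have [y [ms [U2 [zs2 [us2 nn2 s2]]]]] := stripped_step (x :: ns ++ A) s1 st2.
have [V us3 us4] := ust_ust us1 us2 ij il kj kl.
have [|T1' [zs3 [st3 s3]]] := stripped_ust s us3.
  by apply: newnamesW nn2 => w wA; rewrite !(inE, mem_cat) wA !orbT.
have [|T2' [zs4 [st4 s4]]] := stripped_ust s3 us4.
  case/andP: nn1 => u1 f1; rewrite /newnames u1; apply/allP => w wx.
  have wA : w \notin A by have := allP f1 _ wx; rewrite mem_cat negb_or => /andP[].
  case/andP: nn2 => _ f2.
  have wy : w \notin y :: ms.
    apply/negP => wy; have := allP f2 _ wy; rewrite mem_cat negb_or inE mem_cat.
    by move: wx; rewrite inE => /orP[->|->]; rewrite ?orbT.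
  by move: wy; rewrite !inE mem_cat !negb_or => /andP[-> ->].
exists T1', T2'; split=> //; apply: (stripped_tequiv (A := y :: ms ++ x :: ns ++ A)) s2 _.
apply: strippedW s4 => w; rewrite !(inE, mem_cat).
by do 4?[case/orP]; move=> ->; rewrite ?orbT.
Qed.

(** The constraint that a path puts on a label [b] coming after [a]. *)
Definition nopre a b := [&& ~~ prefix b.1 a.1, ~~ prefix b.1 a.2, ~~ prefix b.2 a.1
  & ~~ prefix b.2 a.2].

Lemma indep_nopre a b : nopre a b -> nopre b a -> indep_lab a b.
Proof.
by case/and4P=> h1 h2 h3 h4 /and4P[g1 g2 g3 g4]; split; rewrite /indep_pos; apply/andP.
Qed.

Lemma indep_labC a b : indep_lab a b -> indep_lab b a.
Proof.
by case=> h1 h2 h3 h4; split; rewrite /indep_pos andbC.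
Qed.

Lemma valid_dn T p T1 i : valid_to T p T1 -> dn T i -> dn T1 i.
Proof. by elim=> // {T p T1} P j k P1 p P2 st _ IH /(dn_step st)/IH. Qed.

Lemma valid_mem T p T1 b : valid_to T p T1 -> b \in p ->
  exists T2 T3, [/\ step T2 (Int b.1 b.2) T3, (forall i, dn T i -> dn T2 i)
    & exists p1 p2, p = p1 ++ b :: p2 /\ valid_to T p1 T2 ].
Proof.
move=> v /path.splitPr ep; case: ep v => p1 p2 /valid_to_cat[T2 v1 /valid_toP[T3 st _]].
exists T2, T3; split=> //; last by exists p1, p2.
by move=> i; apply: valid_dn v1.
Qed.

Lemma step_int_pos T a T1 i k : step T (Int a.1 a.2) T1 -> i \in [:: a.1; a.2] -> prefix k i ->
  dn T1 k /\ dn T k = (k != i).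
Proof. by move=> st ia ki; apply: (step_pos st). Qed.

Lemma nopreP a b : reflect (forall i k, i \in [:: a.1; a.2] -> k \in [:: b.1; b.2] -> ~~ prefix k i)
  (nopre a b).
Proof.
apply: (iffP and4P) => [[h1 h2 h3 h4] i k|h].
  by rewrite !inE => /orP[]/eqP-> /orP[]/eqP->.
by split; apply: h; rewrite !inE eqxx ?orbT.
Qed.

(** Once [a] has fired, all prefixes of its positions are passed for ever, and no label fires at a
    passed position. *)
Lemma valid_nopre T a p T1 b : valid_to T (a :: p) T1 -> b \in p -> nopre a b.
Proof.
case/valid_toP => T2 st v bp; apply/nopreP => i k ia kb; apply/negP => ki.
have [dk _] := step_int_pos st ia ki.
have [T3 [T4 [st' dnT _]]] := valid_mem v bp.
have [_] := step_int_pos st' kb (prefix_refl k).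
by rewrite eqxx (dnT _ dk).
Qed.

(** A label [a] enabled at the start has all its strict prefixes passed at the start, so no [b]
    firing before [a] can sit above it; the other direction is [valid_nopre]. *)
Lemma enabled_indep T a T1 c1 c2 T2 b : step T (Int a.1 a.2) T1 ->
  valid_to T (c1 ++ a :: c2) T2 -> b \in c1 -> indep_lab b a.
Proof.
move=> st v bc; have [T3 v1 v2] := (valid_to_cat _ _ _ _).1 v.
have ba : nopre b a.
  case/path.splitPr: bc v => c3 c4; rewrite -catA => /valid_to_cat[T4 _].
  by move/valid_nopre; apply; rewrite mem_cat mem_head orbT.
apply: indep_nopre => //; apply/nopreP => i k ia kb; apply/negP => ki.
have [T4 [T5 [st' dnT _]]] := valid_mem v1 bc.
have [_] := step_int_pos st' kb (prefix_refl k); rewrite eqxx => ndn.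
have [_] := step_int_pos st ia ki; case: (eqVneq k i) => [eki _|_ /dnT]; last by rewrite ndn.
by have /nopreP/(_ k i kb ia) := ba; rewrite eki prefix_refl.
Qed.

Lemma valid_uniq T p T1 : valid_to T p T1 -> uniq p.
Proof.
elim: p T => //= a p IH T v; have [T2 _ /IH->] := (valid_toP _ _ _ _).1 v.
rewrite andbT; apply/negP => /(valid_nopre v)/nopreP/(_ a.1 a.1 (mem_head _ _) (mem_head _ _)).
by rewrite prefix_refl.
Qed.

Lemma homot_cat r s p q : homot p q -> homot (r ++ p ++ s) (r ++ q ++ s).
Proof.
elim=> {p q} [p|p q _|p q t _ IH1 _|t1 t2 a b ab]; try by constructor.
- exact: ho_trans IH1.
- by have := ho_swap (r ++ t1) (t2 ++ s) ab; rewrite -!catA !cat_cons.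
Qed.

Lemma homot_cons a p q : homot p q -> homot (a :: p) (a :: q).
Proof. by move/(homot_cat [:: a] [::]); rewrite /= !cats0. Qed.

Lemma homot_perm p q : homot p q -> perm_eq p q.
Proof.
elim=> // {p q} [p q _|p q r _ IH1 _ IH2|s t a b _]; first by rewrite perm_sym.
  exact: perm_trans IH1 IH2.
by rewrite perm_cat2l -cat1s -[b :: a :: t]cat1s -[a :: t]cat1s -[b :: t]cat1s perm_catCA.
Qed.

Lemma homot_front c1 a c2 : (forall b, b \in c1 -> indep_lab b a) ->
  homot (c1 ++ a :: c2) (a :: c1 ++ c2).
Proof.
elim: c1 => [|b c1 IH] h /=; first exact: ho_refl.
apply: (ho_trans (q := b :: a :: c1 ++ c2)).
  by apply/homot_cons/IH => d dc; apply: h; rewrite inE dc orbT.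
apply: (@ho_swap [::]); apply: h; exact: mem_head.
Qed.

Lemma valid_swap T s t a b T1 : lc T -> valid_to T (s ++ a :: b :: t) T1 -> indep_lab a b ->
  exists2 T2, valid_to T (s ++ b :: a :: t) T2 & tequiv T1 T2.
Proof.
move=> lT /valid_to_cat[T3 v3 /valid_toP[T4 s4 /valid_toP[T5 s5 v5]]] ab.
have lT3 := lc_valid v3 lT.
have [|T4' [T5' [s4' s5' e5]]] := step_swap lT3 s4 s5; first by case: (a) (b) ab => ? ? [].
have [T2 v2 e2] := tequiv_valid e5 v5; exists T2 => //.
apply/valid_to_cat; exists T3 => //; apply/valid_toP; exists T4' => //.
by apply/valid_toP; exists T5'.
Qed.

Lemma homot_valid p q : homot p q -> forall T, lc T ->
  (forall T1, valid_to T p T1 -> exists2 T2, valid_to T q T2 & tequiv T1 T2) /\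
  (forall T1, valid_to T q T1 -> exists2 T2, valid_to T p T2 & tequiv T1 T2).
Proof.
elim=> {p q} [p|p q _ IH|p q r _ IH1 _ IH2|s t a b ab] T lT.
- by split=> T1 v; exists T1 => //; apply: tequiv_refl.
- by have [h1 h2] := IH T lT.
- have [h1 h2] := IH1 T lT; have [g1 g2] := IH2 T lT; split=> T1.
    by move/h1 => [T2 /g1[T3 v3 e3] e2]; exists T3 => //; apply: tequiv_trans e3.
  by move/g2 => [T2 /h2[T3 v3 e3] e2]; exists T3 => //; apply: tequiv_trans e3.
- split=> T1 v; first exact: valid_swap v ab.
  exact: valid_swap v (indep_labC ab).
Qed.

Lemma valid_homot T p q T1 : lc T -> valid_to T p T1 -> homot p q ->
  exists2 T2, valid_to T q T2 & tequiv T1 T2.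
Proof. by move=> lT v /homot_valid/(_ T lT)[h _]; apply: h. Qed.

(** Induction on [p]: its first label is enabled, hence independent of all labels that precede it in
    [q], and can be moved to the front of [q]. *)
Lemma residual T p T1 q T2 : lc T -> valid_to T p T1 -> valid_to T q T2 -> {subset p <= q} ->
  exists2 r, homot q (p ++ r) & exists2 T3, valid_to T1 r T3 & tequiv T2 T3.
Proof.
elim: p T q T2 => [|a p IH] T q T2 lT.
  move=> /valid_to_nil-> vq _; exists q; first exact: ho_refl.
  by exists T2 => //; apply: tequiv_refl.
move=> vp vq sub; have [T3 st v3] := (valid_toP _ _ _ _).1 vp.
have /path.splitPr eq_q : a \in q by apply: sub; apply: mem_head.
case: eq_q vq sub => c1 c2 vq sub.
have hf : homot (c1 ++ a :: c2) (a :: c1 ++ c2).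
  by apply: homot_front => b; apply: enabled_indep st vq.
have [T4 v4 e4] := valid_homot lT vq hf.
have [T5 st5 v5] := (valid_toP _ _ _ _).1 v4.
rewrite -(step_int_det st st5) in v5.
have [|r h [T6 v6 e6]] := IH _ _ _ (lc_step st lT) v3 v5.
  move=> b bp; have := sub b; rewrite inE bp orbT !mem_cat inE => /(_ isT).
  case: (eqVneq b a) => [ba _|//].
  by have := valid_uniq vp; rewrite /= -ba bp.
exists r; last by exists T6 => //; apply: tequiv_trans e4 e6.
exact: ho_trans hf (homot_cons a h).
Qed.

Lemma perm_homot T p q T1 T2 : lc T -> valid_to T p T1 -> valid_to T q T2 -> perm_eq p q ->
  homot p q.
Proof.
move=> lT vp vq pq.
have sub : {subset p <= q} by move=> x; rewrite (perm_mem pq).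
have [r h _] := residual lT vp vq sub.
have := homot_perm h; rewrite perm_sym => /perm_size; rewrite size_cat -(perm_size pq).
move/eqP; rewrite -{2}[size p]addn0 eqn_add2l size_eq0 => /eqP r0.
by move: h; rewrite r0 cats0; apply: ho_sym.
Qed.

Lemma perm_valid T p q T1 T2 : lc T -> valid_to T p T1 -> valid_to T q T2 -> perm_eq p q ->
  tequiv T1 T2.
Proof.
move=> lT vp vq pq; have [T3 v3 e3] := valid_homot lT vp (perm_homot lT vp vq pq).
by rewrite (valid_to_det vq v3).
Qed.

Lemma homot_filter (A : pred (position * position)) p :
  (forall p1 p2 a b, p = p1 ++ a :: p2 -> ~~ A a -> b \in p2 -> A b -> indep_lab a b) ->
  homot p (filter A p ++ filter (predC A) p).
Proof.
elim: p => [|a p IH] h /=; first exact: ho_refl.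
have {}IH : homot p (filter A p ++ filter (predC A) p).
  by apply: IH => p1 p2 b c ep; apply: (h (a :: p1)); rewrite ep.
case: ifP => Aa /=; first exact: homot_cons.
apply: ho_trans (homot_cons a IH) _; apply: ho_sym; apply: homot_front => b.
rewrite mem_filter => /andP[Ab bp]; apply/indep_labC.
by apply: (h [::] p); rewrite ?Aa.
Qed.

(** Let [a] in [p] but not in [q] precede [b] in both. Up to homotopy [r] is [q] followed by labels
    among which [a] occurs, so [b] also comes before [a] in a valid path. The two are then
    independent, and the labels shared with [q] can be gathered at the front of [p]. *)
Lemma valid_inter T p q r T1 T2 T3 : lc T -> valid_to T p T1 -> valid_to T q T2 ->
  valid_to T r T3 -> {subset p <= r} -> {subset q <= r} ->
  exists T4, valid_to T [seq a <- p | a \in q] T4.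
Proof.
move=> lT vp vq vr pr qr.
have [s hr [T5 v5 _]] := residual lT vq vr qr.
have vqs : valid_to T (q ++ s) T5 by apply/valid_to_cat; exists T2.
have [|T6 v6 _] := valid_homot lT vp (@homot_filter [in q] p _).
  move=> p1 p2 a b ep aq bp bq.
  apply: indep_nopre.
    move: vp; rewrite ep => /valid_to_cat[T7 _ v7]; exact: valid_nopre v7 bp.
  have as' : a \in s.
    have /pr : a \in p by rewrite ep mem_cat mem_head orbT.
    by rewrite (perm_mem (homot_perm hr)) mem_cat (negPf aq).
  case/path.splitPr: bq vqs => q1 q2; rewrite -catA => /valid_to_cat[T7 _ v7].
  by apply: valid_nopre v7 _; rewrite mem_cat as' orbT.
by have [T7 v7 _] := (valid_to_cat _ _ _ _).1 v6; exists T7.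
Qed.

(** Each step consumes an action, so [acts] bounds the length of paths, and enabled labels only use
    positions from a finite list. *)
Lemma valid_finite T : lc T -> exists L : seq Defs.path, forall p, valid T p -> p \in L.
Proof.
elim: {T}(acts T).+1 {-2}T (leqnn (acts T).+1) => // n IH T; rewrite ltnS => le lT.
have [L0 hL0] : exists L, forall a p, a \in [seq (i, k) | i <- poss T, k <- poss T] ->
    valid T (a :: p) -> p \in (L a : seq Defs.path).
  suff [L hL] : exists L : position * position -> seq Defs.path,
      forall a p, valid T (a :: p) -> p \in L a.
    by exists L => a p _; apply: hL.
  suff H a : exists L : seq Defs.path, forall p, valid T (a :: p) -> p \in L.
    by exists (fun a => sval (constructive_indefinite_description _ (H a))) => a p; case: constructive_indefinite_description => /= L; apply.
  case: (excluded_middle_informative (exists T1, step T (Int a.1 a.2) T1)) => [[T1 st]|ns].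
    have [||L hL] := IH T1; first by apply: leq_trans le; apply: acts_step st.
      exact: lc_step st lT.
    exists L => p [T2 /valid_toP[T3 st3 v]]; apply: hL; exists T2.
    by rewrite (step_int_det st st3).
  by exists [::] => p [T2 /valid_toP[T3 st3 v]]; case: ns; exists T3.
exists ([::] :: flatten [seq [seq a :: p | p <- L0 a] | a <- [seq (i, k) | i <- poss T, k <- poss T]]).
move=> [|a p] // v; rewrite inE; apply/orP; right; apply/flattenP.
have aT : a \in [seq (i, k) | i <- poss T, k <- poss T].
  case: v => T2 /valid_toP[T3 st3 _]; have sub := step_poss st3.
  case: a st3 sub => i k /= _ sub; apply/allpairsP; exists (i, k); split=> //=; apply: sub.
    exact: mem_head.
  by rewrite !inE eqxx orbT.
exists [seq a :: p | p <- L0 a]; first by apply: map_f.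
by apply: map_f; apply: hL0.
Qed.

End Traces.

(** * Outcomes as sums over permutation classes, and their invariance under bisimulation *)

Section Outcomes.
Variable K : comPzSemiRingType.
Implicit Types (P Q T U V : term K) (a b : position * position) (p q : Defs.path)
  (A zs ns : seq name).

(** Meaningful on valid paths, where [valid_to_det] makes the reached term unique. *)
Definition after T p : term K := epsilon (inhabits T) (valid_to T p).
Definition value T p := state (after T p).

Lemma after_eq T p T1 : valid_to T p T1 -> after T p = T1.
Proof.
move=> v; have := epsilon_spec (inhabits T) (valid_to T p) (ex_intro _ _ v).
by move/(valid_to_det v).
Qed.

Lemma maximalP T p T1 : valid_to T p T1 ->
  maximal T p <-> forall a T2, ~ step T1 (Int a.1 a.2) T2.
Proof.
move=> v; split=> [[_ mx] a T2 st|h].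
  have vr : valid T (p ++ [:: a]).
    by exists T2; apply/valid_to_cat; exists T1 => //; apply/valid_toP; exists T2 => //; constructor.
  have /(congr1 size) := mx _ vr (prefix_prefix _ _).
  by rewrite size_cat addn1 => /n_Sn.
split; first by exists T1.
move=> q [T2 vq] /prefixP[r eq_q]; rewrite {}eq_q in vq *.
case: r vq => [|a r]; first by rewrite cats0.
case/valid_to_cat => T3 /(valid_to_det v)<- /valid_toP[T4 st _].
by case: (h a T4).
Qed.

Lemma maximal_valid T p : maximal T p -> valid_to T p (after T p).
Proof. by case=> -[T1 v] _; rewrite (after_eq v). Qed.

Lemma tequiv_stuck T T' : tequiv T T' -> (forall a T2, ~ step T (Int a.1 a.2) T2) ->
  forall a T2, ~ step T' (Int a.1 a.2) T2.
Proof.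
move=> [_ h] st a T2 st2; have [|T3 /valid_toP[T4 st4 _] _] := h [:: a] T2.
  by apply/valid_toP; exists T2 => //; constructor.
exact: st st4.
Qed.

Lemma value_permfun T : lc T -> permfun (maximal T) (value T).
Proof.
move=> lT p q /maximal_valid vp /maximal_valid vq pq.
exact: tequiv_state (perm_valid lT vp vq pq).
Qed.

Lemma permsum_maximal_ex T : lc T -> exists k, permsum (maximal T) (value T) k.
Proof.
move=> lT; have [L hL] := valid_finite lT.
have [|ps tr] := @perm_transversal_ex _ (maximal T) L; first by move=> p [/hL].
by exists (\sum_(p <- ps) value T p)%R, ps.
Qed.

(** Homotopy and permutation agree on the valid paths of a closed term, so representatives of
    homotopy classes and transversals for permutations are the same thing. *)
Lemma outcome_isE T k : lc T -> outcome_is T k <-> permsum (maximal T) (value T) k.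
Proof.
move=> lT; split=> [[rs [[h1 h2 h3] ->]]|[ps [h1 h2 h3] ->]].
  have inP r0 : r0 \in [seq r.1 | r <- rs] -> exists2 r, List.In r rs & r.1 = r0.
    elim: rs {h1 h2 h3} => //= r rs IH; rewrite inE => /orP[/eqP->|/IH[r' ? <-]].
      by exists r => //; left.
    by exists r' => //; right.
  exists [seq r.1 | r <- rs].
    split.
    - by move=> p /inP[r /h1[? _] <-].
    - apply/(pairwiseP [::]) => i j; rewrite !inE size_map => ilt jlt ij; apply/negP => pij.
      case: (h2 i j); first by rewrite ij jlt.
      have mx i0 : i0 < size rs -> valid_to T (nth ([::], T) rs i0).1 (nth ([::], T) rs i0).2.
        move=> lt0; have /h1[_] // : List.In (nth ([::], T) rs i0) rs.
        elim: (rs) i0 lt0 => //= r rs' IH [_|i0 /IH]; [by left | by right].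
      apply: perm_homot lT (mx _ ilt) (mx _ jlt) _.
      by move: pij; rewrite !(nth_map ([::], T)).
    - move=> p /h3[r rrs pr]; apply/hasP; exists r.1; last exact: homot_perm.
      by elim: (rs) rrs => //= r' rs' IH [->|/IH]; rewrite inE ?eqxx // => ->; rewrite orbT.
  rewrite big_map; elim: rs h1 {h2 h3 inP} => [|r rs IH] h1; first by rewrite !big_nil.
  rewrite !big_cons IH => [|r' rr']; last by apply: h1; right.
  by have [_ v] := h1 r (or_introl erefl); rewrite /value (after_eq v).
exists [seq (p, after T p) | p <- ps]; split; last by rewrite big_map.
have inP r : List.In r [seq (p, after T p) | p <- ps] -> exists2 p, p \in ps & r = (p, after T p).
  elim: ps {h1 h2 h3} => //= p ps IH [<-|/IH[q ? ->]]; first by exists p; rewrite ?mem_head.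
  by exists q; rewrite // inE orbC; apply/orP; left.
split.
- by move=> r /inP[p /h1 mp ->] /=; split=> //; apply: maximal_valid.
- move=> i j; rewrite size_map => /andP[ij jlt] /homot_perm.
  have ilt := ltn_trans ij jlt; rewrite !(nth_map [::]) //= => pij.
  by have /(pairwiseP [::])/(_ i j ilt jlt ij) := h2; rewrite /nperm pij.
- move=> p mp; have /hasP[q qps pq] := h3 _ mp; exists (q, after T q) => /=.
    elim: (ps) qps => //= q' ps' IH; rewrite inE => /orP[/eqP->|/IH]; [by left | by right].
  exact: perm_homot lT (maximal_valid mp) (maximal_valid (h1 _ qps)) pq.
Qed.

Lemma outcome_permsum T : lc T -> permsum (maximal T) (value T) (outcome T).
Proof.
move=> lT; have [k /(outcome_isE _ lT) tk] := permsum_maximal_ex lT.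
by apply/(outcome_isE _ lT); apply: epsilon_spec; exists k.
Qed.

Lemma outcomeE T k : lc T -> permsum (maximal T) (value T) k -> outcome T = k.
Proof. by move=> lT; apply: permsum_uniq (value_permfun lT) (outcome_permsum lT). Qed.

Lemma tequiv_outcome T T' : lc T -> lc T' -> tequiv T T' -> outcome T = outcome T'.
Proof.
move=> lT lT' e; apply: outcomeE => //; have [ps [h1 h2 h3] ->] := outcome_permsum lT'.
have mxE p : maximal T p <-> maximal T' p.
  suff mx T3 T4 : tequiv T3 T4 -> maximal T3 p -> maximal T4 p.
    by split; apply: mx => //; apply: tequiv_sym.
  move=> e34 /[dup] m /maximal_valid v; have [T5 v5 e5] := tequiv_valid e34 v.
  by apply/(maximalP v5)/(tequiv_stuck e5)/(maximalP v).
exists ps; first by split=> // p; [move/h1/mxE | move/mxE/h3].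
rewrite big_seq [RHS]big_seq; apply: eq_bigr => p /h1 /[dup] /mxE /maximal_valid v /maximal_valid v'.
have [T5 v5 e5] := tequiv_valid e v; rewrite /value (after_eq v5) .
by rewrite (tequiv_state e5).
Qed.

Section Bisimulation.
Variables (R : term K -> term K -> Prop) (f g : position * position -> position * position).
Hypothesis R_state : forall T T', R T T' -> state T = state T'.
Hypothesis R_fwd : forall T T' a T1, R T T' -> step T (Int a.1 a.2) T1 ->
  exists T1', [/\ step T' (Int (f a).1 (f a).2) T1', R T1 T1' & g (f a) = a].
Hypothesis R_bwd : forall T T' b T1', R T T' -> step T' (Int b.1 b.2) T1' ->
  exists T1, [/\ step T (Int (g b).1 (g b).2) T1, R T1 T1' & f (g b) = b].

Lemma bisim_path T T' p T1 : R T T' -> valid_to T p T1 ->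
  exists T1', [/\ valid_to T' (map f p) T1', R T1 T1' & map g (map f p) = p].
Proof.
elim: p T T' => [|a p IH] T T' RT; first by move/valid_to_nil->; exists T'; split=> //; constructor.
case/valid_toP => T2 /(R_fwd RT)[T2' [st RT2 ga]] v.
have [T1' [v1 R1 e1]] := IH _ _ RT2 v; exists T1'; split=> //=; last by rewrite ga e1.
by apply/valid_toP; exists T2'.
Qed.

Lemma bisim_path_back T T' p T1' : R T T' -> valid_to T' p T1' ->
  exists T1, [/\ valid_to T (map g p) T1, R T1 T1' & map f (map g p) = p].
Proof.
elim: p T T' => [|a p IH] T T' RT; first by move/valid_to_nil->; exists T; split=> //; constructor.
case/valid_toP => T2 /(R_bwd RT)[T2' [st RT2 ga]] v.
have [T1 [v1 R1 e1]] := IH _ _ RT2 v; exists T1; split=> //=; last by rewrite ga e1.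
by apply/valid_toP; exists T2'.
Qed.

(** The relabellings only have to be inverse to each other on labels that actually occur; this
    suffices for mapping along [f] to preserve and reflect permutations of runs. *)
Lemma bisim_outcome T T' : R T T' -> lc T -> lc T' -> outcome T = outcome T'.
Proof.
move=> RT lT lT'.
have fwd p : maximal T p -> [/\ maximal T' (map f p), value T p = value T' (map f p)
    & map g (map f p) = p].
  move=> /[dup] mp /maximal_valid v; have [T1 [v1 R1 e1]] := bisim_path RT v.
  split=> //; last by rewrite /value (after_eq v1) (R_state R1).
  apply/(maximalP v1) => b T2 st; have [T3 [st3 _ _]] := R_bwd R1 st.
  exact: (maximalP v).1 mp _ _ st3.
apply: (permsum_map (h := map f)) (outcome_permsum lT) (outcome_permsum lT') (value_permfun lT') _ _ _.
- by move=> p /fwd[].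
- move=> p q /fwd[_ _ gp] /fwd[_ _ gq]; apply/idP/idP; last exact: perm_map.
  by move/(perm_map g); rewrite gp gq.
- move=> q mq; right; have vq := maximal_valid mq.
  have [T1 [v1 R1 e1]] := bisim_path_back RT vq; exists (map g q); last by rewrite e1.
  apply/(maximalP v1) => b T2 st; have [T3 [st3 _ _]] := R_fwd R1 st.
  exact: (maximalP vq).1 mq _ _ st3.
Qed.

End Bisimulation.

Section StrippedBisimulation.
Variables (E : seq name -> term K -> term K -> Prop) (f g : position * position -> position * position).
Hypothesis E_state : forall A U V, E A U V -> state U = state V.
Hypothesis E_fwd : forall A U V a x U' ns, E A U V -> newnames A x ns ->
  ust U a.1 a.2 x U' ns -> exists V' ns', [/\ ust V (f a).1 (f a).2 x V' ns', perm_eq ns' ns,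
    E (x :: ns ++ A) U' V' & g (f a) = a].
Hypothesis E_bwd : forall A U V b x V' ns, E A U V -> newnames A x ns ->
  ust V b.1 b.2 x V' ns -> exists U' ns', [/\ ust U (g b).1 (g b).2 x U' ns', perm_eq ns' ns,
    E (x :: ns ++ A) U' V' & f (g b) = b].

Lemma newnames_perm A x ns ns' : perm_eq ns' ns -> newnames A x ns -> newnames A x ns'.
Proof.
move=> pe; rewrite /newnames /= (perm_uniq pe) (perm_mem pe) => /and3P[-> -> /allP h].
by apply/allP => w; rewrite (perm_mem pe); apply: h.
Qed.

(** [E] carries the names in use, so simulation is required for fresh choices only. [ns'] may be a
    permutation of [ns] because moving components around changes the order in which the uncovered
    names are listed. *)
Lemma strip_bisim_outcome A T T' U V zs ws : stripped A T U zs -> stripped A T' V ws ->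
  E A U V -> outcome T = outcome T'.
Proof.
move=> s s' eUV.
have lT := stripped_lc s; have lT' := stripped_lc s'.
pose R T T' := exists A U V zs ws, [/\ stripped A T U zs, stripped A T' V ws & E A U V].
have next A0 T0 V0 x ns ns' zs0 : perm_eq ns' ns -> stripped (x :: ns' ++ A0) T0 V0 zs0 ->
    stripped (x :: ns ++ A0) T0 V0 zs0.
  by move=> pe; apply: strippedW => w; rewrite !inE !mem_cat (perm_mem pe).
apply: (@bisim_outcome R f g) => //; last by exists A, U, V, zs, ws.
- move=> {lT lT' eUV s s'}T {}T' [B [U1 [V1 [z1 [w1 [s s' e]]]]]].
  by rewrite (sr_state (stripped_sr s)) (sr_state (stripped_sr s')) (E_state e).
- move=> {lT lT' eUV s s'}T {}T' a T1 [B [U1 [V1 [z1 [w1 [s s' e]]]]]] st.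
  have [x [ns [U2 [z2 [us nn s2]]]]] := stripped_step B s st.
  have {}nn : newnames B x ns by apply: newnamesW nn => w wB; rewrite mem_cat wB.
  have [V2 [ns' [us' pe e2 ga]]] := E_fwd e nn us.
  have [T1' [w2 [st' s2']]] := stripped_ust s' us' (newnames_perm pe nn).
  exists T1'; split=> //; exists (x :: ns ++ B), U2, V2, z2, w2; split=> //.
  exact: next pe s2'.
- move=> {lT lT' eUV s s'}T {}T' b T1' [B [U1 [V1 [z1 [w1 [s s' e]]]]]] st.
  have [x [ns [V2 [w2 [us nn s2]]]]] := stripped_step B s' st.
  have {}nn : newnames B x ns by apply: newnamesW nn => w wB; rewrite mem_cat wB.
  have [U2 [ns' [us' pe e2 ga]]] := E_bwd e nn us.
  have [T1 [z2 [st' s2']]] := stripped_ust s us' (newnames_perm pe nn).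
  exists T1; split=> //; exists (x :: ns ++ B), U2, V2, z2, w2; split=> //.
  exact: next pe s2'.
Qed.

End StrippedBisimulation.

End Outcomes.

(** * Structural laws *)

Section Laws.
Variable K : comPzSemiRingType.
Implicit Types (P Q R S T U V : term K) (i j k : position) (A zs ns : seq name).

Lemma lc_par P Q : lc (Par P Q) = lc P && lc Q. Proof. by []. Qed.
Lemma lc_spar P Q : lc (SPar P Q) = lc P && lc Q. Proof. by []. Qed.
Lemma lc_diam P : lc (Diam P) = lc P. Proof. by []. Qed.

Lemma sr_par_inv P Q U zs : sr (Par P Q) U zs ->
  exists V W z1 z2, [/\ U = Par V W, zs = z1 ++ z2, sr P V z1 & sr Q W z2].
Proof. by move=> s; inversion s; subst; exists U0, V, zs0, ws. Qed.

Lemma sr_spar_inv P Q U zs : sr (SPar P Q) U zs ->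
  exists V W z1 z2, [/\ U = SPar V W, zs = z1 ++ z2, sr P V z1 & sr Q W z2].
Proof. by move=> s; inversion s; subst; exists U0, V, zs0, ws. Qed.

Lemma sr_diam_inv P U zs : sr (Diam P) U zs -> exists2 V, U = Diam V & sr P V zs.
Proof. by move=> s; inversion s; subst; exists U0. Qed.

Lemma stripped_perm A T T' U U' zs zs' : stripped A T U zs -> lc T' -> sr T' U' zs' ->
  perm_eq zs' zs -> {subset fv T' <= fv T} -> stripped A T' U' zs'.
Proof.
move=> [lT sT uz fz fT zA] lT' sT' pe sub; split=> //.
- by rewrite (perm_uniq pe).
- apply/allP => w; rewrite (perm_mem pe) => /(allP fz); exact/contra/sub.
- by move=> w /sub/fT.
- by move=> w; rewrite (perm_mem pe) => /zA.
Qed.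

Definition relabel (h : position -> position) (a : position * position) := (h a.1, h a.2).

Lemma par_comm P Q : lc P -> lc Q -> outcome (Par P Q) = outcome (Par Q P).
Proof.
move=> lP lQ; have lT : lc (Par P Q) by rewrite lc_par lP.
have [W [zs [s _]]] := stripped_ex [::] lT.
have [U [V [z1 [z2 [eW ez sP sQ]]]]] := sr_par_inv (stripped_sr s); subst.
have s' : stripped (fv (Par P Q) ++ z1 ++ z2) (Par Q P) (Par V U) (z2 ++ z1).
  apply: stripped_perm s _ _ _ _; [by rewrite lc_par lQ| by constructor| by rewrite perm_catC|].
  by move=> w; rewrite /= !mem_cat orbC.
(* A synchronisation lists its position in the left component first, so exchanging the components
   also exchanges the two entries of the label. *)
pose c (a : position * position) := match a with
| (1 :: i, 1 :: k) => (2 :: i, 2 :: k) | (2 :: i, 2 :: k) => (1 :: i, 1 :: k)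
| (1 :: i, 2 :: k) => (1 :: k, 2 :: i) | _ => a end.
pose E (A : seq name) (U V : term K) := exists X Y, U = Par X Y /\ V = Par Y X.
apply: (strip_bisim_outcome (E := E) (f := c) (g := c)) s s' _; last by exists U, V.
- by move=> _ _ _ [X [Y [-> ->]]]; rewrite /= mulrC.
- move=> A _ _ [a1 a2] x U' ns [X [Y [-> ->]]] _ /= us; inversion us; subst => /=.
  + by exists (Par Y P'), ns; split=> //; [constructor | exists P', Y].
  + by exists (Par Q' X), ns; split=> //; [constructor | exists X, Q'].
  + exists (Par Q' P'), (ms ++ ns0); split; [|by rewrite perm_catC|by exists P', Q'|by []].
    by apply: us_comm; [eassumption|rewrite negbK].
- move=> A _ _ [a1 a2] x U' ns [X [Y [-> ->]]] _ /= us; inversion us; subst => /=.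
  + by exists (Par X P'), ns; split=> //; [constructor | exists X, P'].
  + by exists (Par Q' Y), ns; split=> //; [constructor | exists Q', Y].
  + exists (Par Q' P'), (ms ++ ns0); split; [|by rewrite perm_catC|by exists Q', P'|by []].
    by apply: us_comm; [eassumption|rewrite negbK].
Qed.

Lemma par_assoc P Q R : lc P -> lc Q -> lc R ->
  outcome (Par (Par P Q) R) = outcome (Par P (Par Q R)).
Proof.
move=> lP lQ lR; have lT : lc (Par (Par P Q) R) by rewrite !lc_par lP lQ.
have [W [zs [s _]]] := stripped_ex [::] lT.
have [U0 [Z [z0 [z3 [eW ez s0 sR]]]]] := sr_par_inv (stripped_sr s); subst.
have [X [Y [z1 [z2 [eW ez sP sQ]]]]] := sr_par_inv s0; subst.
have s' : stripped (fv (Par (Par P Q) R) ++ (z1 ++ z2) ++ z3)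
    (Par P (Par Q R)) (Par X (Par Y Z)) (z1 ++ (z2 ++ z3)).
  apply: stripped_perm s _ _ _ _; [by rewrite !lc_par lP lQ| by do !constructor| by rewrite catA|].
  by move=> w; rewrite /= catA.
pose c i := match i with 1 :: 1 :: i => 1 :: i | 1 :: 2 :: i => 2 :: 1 :: i
  | 2 :: i => 2 :: 2 :: i | _ => i end.
pose d i := match i with 1 :: i => 1 :: 1 :: i | 2 :: 1 :: i => 1 :: 2 :: i
  | 2 :: 2 :: i => 2 :: i | _ => i end.
pose E (A : seq name) (U V : term K) :=
  exists X Y Z, U = Par (Par X Y) Z /\ V = Par X (Par Y Z).
apply: (strip_bisim_outcome (E := E) (f := relabel c) (g := relabel d)) s s' _; last by exists X, Y, Z.
- by move=> _ _ _ [? [? [? [-> ->]]]]; rewrite /= mulrA.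
- move=> A _ _ [a1 a2] x U' ns [X1 [Y1 [Z1 [-> ->]]]] _ /= us.
  inversion us as [|? ? ? ? ? ? ? us'| | | |? ? ? ? ? ? ? ? ? ? ? fi fj]; subst.
  + inversion us'; subst.
    * by do 2 eexists; split; first (by constructor; eassumption); rewrite //; do 3 eexists.
    * by do 2 eexists; split; first (by do 2 constructor; eassumption); rewrite //; do 3 eexists.
    * by do 2 eexists; split; first (by eapply us_comm; [|constructor]; eassumption); rewrite //; do 3 eexists.
  + by do 2 eexists; split; first (by do 2 constructor; eassumption); rewrite //; do 3 eexists.
  + inversion fi; subst.
    * by do 2 eexists; split; first (by eapply us_comm; [|apply: fi_parR]; eassumption); rewrite //; do 3 eexists.
    * by do 2 eexists; split; first (by constructor; eapply us_comm; eassumption); rewrite //; do 3 eexists.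
- move=> A _ _ [a1 a2] x U' ns [X1 [Y1 [Z1 [-> ->]]]] _ /= us.
  inversion us as [| |? ? ? ? ? ? ? us'| | |? ? ? ? ? ? ? ? ? ? ? fi fj]; subst.
  + by do 2 eexists; split; first (by do 2 constructor; eassumption); rewrite //; do 3 eexists.
  + inversion us'; subst.
    * by do 2 eexists; split; first (by do 2 constructor; eassumption); rewrite //; do 3 eexists.
    * by do 2 eexists; split; first (by apply: us_parR; eassumption); rewrite //; do 3 eexists.
    * by do 2 eexists; split; first (by eapply us_comm; [apply: fi_parR|]; eassumption); rewrite //; do 3 eexists.
  + inversion fj; subst.
    * by do 2 eexists; split; first (by constructor; eapply us_comm; eassumption); rewrite //; do 3 eexists.
    * by do 2 eexists; split; first (by eapply us_comm; [apply: fi_parL|]; eassumption); rewrite //; do 3 eexists.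
Qed.

Lemma par_diam P S : lc P -> lc S -> outcome (Par (Diam P) S) = outcome (Par P S).
Proof.
move=> lP lS; have lT : lc (Par (Diam P) S) by rewrite lc_par lc_diam lP.
have [W [zs [s _]]] := stripped_ex [::] lT.
have [X0 [Y [z1 [z2 [eW ez s0 sS]]]]] := sr_par_inv (stripped_sr s); subst.
have [X eX sP] := sr_diam_inv s0; subst.
have s' : stripped (fv (Par (Diam P) S) ++ (z1 ++ z2)) (Par P S) (Par X Y) (z1 ++ z2).
  by apply: stripped_perm s _ _ _ _; [rewrite lc_par lP| constructor | |].
pose c i := match i with 1 :: 1 :: i => 1 :: i | _ => i end.
pose d i := match i with 1 :: i => 1 :: 1 :: i | _ => i end.
pose E (A : seq name) (U V : term K) := exists X Y, U = Par (Diam X) Y /\ V = Par X Y.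
apply: (strip_bisim_outcome (E := E) (f := relabel c) (g := relabel d)) s s' _; last by exists X, Y.
- by move=> _ _ _ [? [? [-> ->]]].
- move=> A _ _ [a1 a2] x U' ns [X1 [Y1 [-> ->]]] _ /= us.
  inversion us as [|? ? ? ? ? ? ? us'| | | |? ? ? ? ? ? ? ? ? ? ? fi fj]; subst.
  + inversion us'; subst.
    by do 2 eexists; split; first (by constructor; eassumption); rewrite //; do 2 eexists.
  + by do 2 eexists; split; first (by constructor; eassumption); rewrite //; do 2 eexists.
  + inversion fi; subst.
    by do 2 eexists; split; first (by eapply us_comm; eassumption); rewrite //; do 2 eexists.
- move=> A _ _ [a1 a2] x U' ns [X1 [Y1 [-> ->]]] _ /= us.
  inversion us; subst.
  + by do 2 eexists; split; first (by do 2 constructor; eassumption); rewrite //; do 2 eexists.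
  + by do 2 eexists; split; first (by apply: us_parR; eassumption); rewrite //; do 2 eexists.
  + by do 2 eexists; split; first (by eapply us_comm; [apply: fi_diam|]; eassumption); rewrite //; do 2 eexists.
Qed.

Lemma par_spar_comm P R S : lc P -> lc R -> lc S ->
  outcome (Par (SPar P R) S) = outcome (Par (SPar R P) S).
Proof.
move=> lP lR lS; have lT : lc (Par (SPar P R) S) by rewrite lc_par lc_spar lP lR.
have [W [zs [s _]]] := stripped_ex [::] lT.
have [U0 [Z [z0 [z3 [eW ez s0 sS]]]]] := sr_par_inv (stripped_sr s); subst.
have [X [Y [z1 [z2 [eW ez sP sR]]]]] := sr_spar_inv s0; subst.
have s' : stripped (fv (Par (SPar P R) S) ++ (z1 ++ z2) ++ z3)
    (Par (SPar R P) S) (Par (SPar Y X) Z) ((z2 ++ z1) ++ z3).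
  apply: stripped_perm s _ _ _ _; [by rewrite lc_par lc_spar lR lP| by do !constructor| |].
    by rewrite perm_cat2r perm_catC.
  by move=> w; rewrite /= !mem_cat (orbC (w \in fv R)).
pose c i := match i with 1 :: 1 :: i => 1 :: 2 :: i | 1 :: 2 :: i => 1 :: 1 :: i | _ => i end.
pose E (A : seq name) (U V : term K) :=
  exists X Y Z, U = Par (SPar X Y) Z /\ V = Par (SPar Y X) Z.
have fwd A U V a x U' ns : E A U V -> newnames A x ns -> ust U a.1 a.2 x U' ns ->
    exists V' ns', [/\ ust V (relabel c a).1 (relabel c a).2 x V' ns', perm_eq ns' ns,
      E (x :: ns ++ A) U' V' & relabel c (relabel c a) = a].
  case: a => a1 a2 [X1 [Y1 [Z1 [-> ->]]]] _ /= us.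
  inversion us as [|? ? ? ? ? ? ? us'| | | |? ? ? ? ? ? ? ? ? ? ? fi fj]; subst.
  + inversion us'; subst.
    * by do 2 eexists; split; first (by do 2 constructor; eassumption); rewrite //; do 3 eexists.
    * by do 2 eexists; split; first (by do 2 constructor; eassumption); rewrite //; do 3 eexists.
  + by do 2 eexists; split; first (by constructor; eassumption); rewrite //; do 3 eexists.
  + inversion fi; subst.
    * by do 2 eexists; split; first (by eapply us_comm; [apply: fi_sparR|]; eassumption); rewrite //; do 3 eexists.
    * by do 2 eexists; split; first (by eapply us_comm; [apply: fi_sparL|]; eassumption); rewrite //; do 3 eexists.
apply: (strip_bisim_outcome (E := E) (f := relabel c) (g := relabel c)) s s' _; last by exists X, Y, Z.
- by move=> _ _ _ [X1 [Y1 [? [-> ->]]]]; rewrite /= [(state X1 * _)%R]mulrC.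
- exact: fwd.
- move=> A U V b x V' ns [X1 [Y1 [Z1 [eU eV]]]] nn us.
  have [|U' [ns' [us' pe [X2 [Y2 [Z2 [e1 e2]]]] eb]]] := fwd A V U b x V' ns _ nn us.
    by exists Y1, X1, Z1.
  by exists U', ns'; split=> //; exists Y2, X2, Z2.
Qed.

Lemma outcome_sw x z T : lc T -> outcome (tmap (sw x z) T) = outcome T.
Proof.
move=> lT; apply: esym.
apply: (@bisim_outcome _ (fun T T' => T' = tmap (sw x z) T) id id) => //; last by rewrite /lc lc_tmap.
- by move=> {lT} T T' ->; rewrite state_tmap.
- move=> {lT} T _ a T1 -> st; exists (tmap (sw x z) T1); split=> //.
  by have := step_tmap (@sw_inj x z) st.
- move=> {lT} T _ a T1 -> st; exists (tmap (sw x z) T1); split=> //; last by rewrite tmapK.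
  by have := step_tmap (@sw_inj x z) st; rewrite tmapK.
Qed.

(** Both sides have the same opened form: [z] is an opened name on the left and a free name on the
    right. *)
Lemma par_nu P S z : lc (Nu P) -> lc S -> z \notin fv P -> z \notin fv S ->
  outcome (Par (Nu P) S) = outcome (Par (open z P) S).
Proof.
move=> lP lS zP zS; have lo : lc (open z P) by apply: lc_open.
have lT : lc (Par (open z P) S) by rewrite lc_par lo.
have [W [zs [s fz]]] := stripped_ex [:: z] lT.
have [X [Y [z1 [z2 [eW ez sP sS]]]]] := sr_par_inv (stripped_sr s); subst.
have lT' : lc (Par (Nu P) S) by rewrite lc_par lP.
apply: tequiv_outcome => //.
set A := z :: fv (Par (open z P) S) ++ (z1 ++ z2).
apply: (@stripped_tequiv _ A _ _ _ (z :: z1 ++ z2) (z1 ++ z2)); last first.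
  by apply: strippedW s => w wA; rewrite inE wA orbT.
have sub : {subset fv (Par (Nu P) S) <= fv (Par (open z P) S)}.
  by move=> w; rewrite /= !mem_cat => /orP[/(sub_fv_open 0 z)->|->]; rewrite ?orbT.
case: s => _ _ uz ft _ _; split=> //.
- by rewrite -cat_cons; constructor=> //; constructor.
- rewrite /= uz andbT; apply/negP => /(allP fz); by rewrite inE eqxx.
- rewrite /fresh /= mem_cat negb_or zP zS; exact: freshW sub ft.
- by move=> w /sub wT; rewrite inE mem_cat wT orbT.
- by move=> w; rewrite !inE !mem_cat => /or3P[->|->|->]; rewrite ?orbT.
Qed.

Lemma obs_equiv_parL P Q R : lc P -> lc Q -> lc R -> obs_equiv P Q -> obs_equiv (Par P R) (Par Q R).
Proof. by move=> lP lQ lR PQ S lS; rewrite !par_assoc // PQ // lc_par lR. Qed.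

Lemma obs_equiv_parR P Q R : lc P -> lc Q -> lc R -> obs_equiv P Q -> obs_equiv (Par R P) (Par R Q).
Proof.
move=> lP lQ lR PQ S lS; rewrite !par_assoc // (par_comm lR) ?lc_par ?lP //.
by rewrite (par_comm lR) ?lc_par ?lQ // !par_assoc // PQ // lc_par lS.
Qed.

Lemma obs_equiv_diam P Q : lc P -> lc Q -> obs_equiv P Q -> obs_equiv (Diam P) (Diam Q).
Proof. by move=> lP lQ PQ S lS; rewrite !par_diam // PQ. Qed.

(** A transposition of the whole composition preserves the outcome, so the one applied to [P] can be
    moved onto the observer. *)
Lemma obs_equiv_sw x z P Q S : lc P -> lc Q -> lc S -> obs_equiv P Q ->
  outcome (Par (tmap (sw x z) P) S) = outcome (Par (tmap (sw x z) Q) S).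
Proof.
move=> lP lQ lS PQ; have sE T : lc T ->
    outcome (Par (tmap (sw x z) T) S) = outcome (Par T (tmap (sw x z) S)).
  move=> lT; rewrite -(outcome_sw x z) /= ?tmapK //.
  by rewrite lc_par /lc lc_tmap; apply/andP.
by rewrite !sE // PQ // /lc lc_tmap.
Qed.

(** Opening both hidings with one fresh [z] amounts to transposing [x] and [z]. *)
Lemma obs_equiv_nu x P Q : lc P -> lc Q -> obs_equiv P Q -> obs_equiv (nu x P) (nu x Q).
Proof.
move=> lP lQ PQ S lS; have [z] := fresh_name (fv P ++ fv Q ++ fv S).
rewrite !mem_cat !negb_or => /and3P[zP zQ zS].
have zc T : z \notin fv T -> z \notin fv (close x T).
  by rewrite fv_close mem_filter negb_and => ->; rewrite orbT.
rewrite !(par_nu (z := z)) ?zc //; try exact: lc_close.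
rewrite /open /close !open_close_sw //; exact: obs_equiv_sw.
Qed.

End Laws.

(** * Prefixing *)

Section Primes.
Variable K : comPzSemiRingType.
Implicit Types (P Q S T U V : term K) (a b : position * position) (p q c D : Defs.path).
(** Meant for the labels that fire one fixed action: they share a position, so a path contains at
    most one of them. *)
Variable mark : pred (position * position).
Hypothesis mark_pos : forall a b, mark a -> mark b -> a.1 = b.1.

Lemma mark_uniq T p T1 a b : valid_to T p T1 -> a \in p -> b \in p -> mark a -> mark b -> a = b.
Proof.
move=> v ap bp ma mb; have e := mark_pos ma mb.
case/path.splitPr: ap v bp => p1 p2 /valid_to_cat[T2 v1 v2].
rewrite mem_cat inE => /or3P[bp|/eqP->//|/(valid_nopre v2)/nopreP/(_ a.1 b.1)]; last first.
  by rewrite !inE !eqxx e prefix_refl => /(_ isT isT).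
have v : valid_to T (p1 ++ a :: p2) T1 by apply/valid_to_cat; exists T2.
case/path.splitPr: bp v => p3 p4; rewrite -catA => /valid_to_cat[T3 _ v3].
have /(valid_nopre v3)/nopreP/(_ b.1 a.1) : a \in p4 ++ a :: p2 by rewrite mem_cat mem_head orbT.
by rewrite !inE !eqxx e prefix_refl => /(_ isT isT).
Qed.

(** In the language of event structures, a prime configuration whose top event is marked. *)
Definition min_marked T D := [/\ valid T D, has mark D &
  forall D', valid T D' -> has mark D' -> {subset D' <= D} -> {subset D <= D'}].

Lemma valid_prefix T p q : valid T (p ++ q) -> valid T p.
Proof. by case=> T1 /valid_to_cat[T2 v _]; exists T2. Qed.

Lemma split_mark p : has mark p -> exists q a r, [/\ p = q ++ a :: r, mark a & ~~ has mark q].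
Proof.
elim: p => //= a p IH; case ma: (mark a) => /=.
  by move=> _; exists [::], a, p.
by move/IH => [q [b [r [-> mb nq]]]]; exists (a :: q), b, r; split=> //=; rewrite ma.
Qed.

(** Cutting [D] right after its mark leaves a marked valid path, so minimality forces the mark to be
    last. *)
Lemma min_marked_split T D : min_marked T D -> exists q a, [/\ D = rcons q a, mark a & ~~ has mark q].
Proof.
case=> vD /split_mark[q [a [r [eD ma nq]]]] min.
exists q, a; split=> //; rewrite -cats1 eD; congr (_ ++ _).
have sub := min (q ++ [:: a]).
case: r eD => // b r eD; have bD : b \in D by rewrite eD mem_cat !inE eqxx !orbT.
have [T1 v] := vD; have := valid_uniq v.
rewrite {1}eD -cat1s catA cat_uniq => /and3P[_ /hasPn/(_ b (mem_head _ _)) + _].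
rewrite sub //.
- by apply: (@valid_prefix _ _ (b :: r)); rewrite -catA -eD.
- by rewrite has_cat /= ma orbT.
- by move=> w; rewrite eD !mem_cat !inE => /orP[->|->]; rewrite ?orbT.
Qed.

Lemma min_marked_ex T c : valid T c -> has mark c -> exists2 D, min_marked T D & {subset D <= c}.
Proof.
elim: {c}(size c).+1 {-2}c (leqnn (size c).+1) => // n IH c; rewrite ltnS => le vc mc.
case: (excluded_middle_informative (min_marked T c)) => [pc|npc]; first by exists c.
have [D' [v' m' sub nsub]] : exists D', [/\ valid T D', has mark D', {subset D' <= c}
    & ~ {subset c <= D'}].
  case: (excluded_middle_informative (exists D', [/\ valid T D', has mark D', {subset D' <= c}
    & ~ {subset c <= D'}])) => // h; case: npc; split=> // D' v' m' sub x xc.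
  by apply/negPn/negP => xD'; apply: h; exists D'; split=> // sub'; move: xD'; rewrite sub'.
have lt : size D' < size c.
  rewrite ltnNge; apply/negP => le'; have [T1 v1] := v'.
  by have [_ eq_m] := uniq_min_size (valid_uniq v1) sub le'; apply: nsub => x; rewrite eq_m.
have [D pD subD] := IH D' (leq_trans lt le) v' m'.
by exists D => // x /subD/sub.
Qed.

(** Inside a common path both carry the same mark, so their intersection, valid by [valid_inter], is
    again marked; minimality then gives the inclusion. *)
Lemma min_marked_sub T D1 D2 c : lc T -> min_marked T D1 -> min_marked T D2 -> valid T c ->
  {subset D1 <= c} -> {subset D2 <= c} -> {subset D1 <= D2}.
Proof.
move=> lT [[T1 v1] /hasP[a aD1 ma] min1] [[T2 v2] /hasP[b bD2 mb] min2] [T3 v3] s1 s2.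
have ab : a = b by apply: mark_uniq v3 _ _ ma mb; [apply: s1 | apply: s2].
have vi := valid_inter lT v1 v2 v3 s1 s2.
have sub : {subset D1 <= [seq d <- D1 | d \in D2]}.
  apply: (min1 _ vi) => [|y]; last by rewrite mem_filter => /andP[].
  by apply/hasP; exists a => //; rewrite mem_filter aD1 ab bD2.
by move=> x /sub; rewrite mem_filter => /andP[].
Qed.

Lemma min_marked_perm T D1 D2 c : lc T -> min_marked T D1 -> min_marked T D2 -> valid T c ->
  {subset D1 <= c} -> {subset D2 <= c} -> perm_eq D1 D2.
Proof.
move=> lT p1 p2 vc s1 s2; have [[T1 v1] _ _] := p1; have [[T2 v2] _ _] := p2.
apply: uniq_perm; [exact: valid_uniq v1 | exact: valid_uniq v2 | move=> x].
by apply/idP/idP; [apply: (min_marked_sub lT p1 p2 vc) | apply: (min_marked_sub lT p2 p1 vc)].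
Qed.

(** By [residual], a run containing the labels of [D] is, up to permutation, [D] followed by a run
    of what remains. *)
Lemma permsum_above T D : lc T -> valid T D ->
  permsum (fun p => maximal T p /\ {subset D <= p}) (value T) (outcome (after T D)).
Proof.
move=> lT [T1 v]; rewrite (after_eq v); have lT1 := lc_valid v lT.
have [L hL] := valid_finite lT.
have [|ps tr] := @perm_transversal_ex _ (fun p => maximal T p /\ {subset D <= p}) L.
  by move=> p [[/hL]].
have inv : permfun (fun p => maximal T p /\ {subset D <= p}) (value T).
  by move=> p q [mp _] [mq _]; apply: value_permfun.
have vcat p T2 : valid_to T1 p T2 -> valid_to T (D ++ p) T2.
  by move=> v2; apply/valid_to_cat; exists T1.
have -> : outcome T1 = (\sum_(p <- ps) value T p)%R; last by exists ps.
apply: (permsum_map (h := cat D)) (outcome_permsum lT1) _ inv _ _ _.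
- by exists ps; first exact: tr.
- move=> p /[dup] mp /maximal_valid v1; have v2 := vcat _ _ v1; split.
    split; last by move=> x xD; rewrite mem_cat xD.
    by apply/(maximalP v2); apply/(maximalP v1).
  by rewrite /value (after_eq v2).
- by move=> p q _ _; rewrite perm_cat2l.
- move=> q [/[dup] mq /maximal_valid vq sub]; right.
  have [r hr [T3 v3 e3]] := residual lT v vq sub; exists r; last exact: homot_perm.
  by apply/(maximalP v3)/(tequiv_stuck e3)/(maximalP vq).
Qed.

(** Up to permutation a marked run contains exactly one minimal marked path: existence is
    [min_marked_ex], uniqueness is [min_marked_perm]. *)
Lemma outcome_primes T Ds k : lc T -> perm_transversal (min_marked T) Ds ->
  permsum (fun p => maximal T p /\ ~~ has mark p) (value T) k ->
  outcome T = (k + \sum_(D <- Ds) outcome (after T D))%R.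
Proof.
move=> lT [h1 h2 h3] sk; apply: outcomeE => //.
have uDs : uniq Ds.
  elim: (Ds) h2 => //= D Ds' IH /andP[/allP hD /IH->]; rewrite andbT.
  by apply/negP => /hD; rewrite /nperm perm_refl.
have pD D1 D2 : D1 \in Ds -> D2 \in Ds -> perm_eq D1 D2 -> D1 = D2.
  elim: (Ds) h2 => //= D Ds' IH /andP[/allP hD pw]; rewrite !inE.
  case/orP=> [/eqP->|i1] /orP[/eqP->|i2] // e; last exact: IH.
    by have := hD _ i2; rewrite /nperm e.
  by have := hD _ i1; rewrite /nperm perm_sym e.
apply: (permsum_cat sk).
- apply: (permsum_bigcup (N := fun D p => maximal T p /\ {subset D <= p})) uDs _ _.
    by move=> D /h1[vD _ _]; apply: permsum_above.
  move=> D1 D2 p q i1 i2 [mp s1] [mq s2] pq; apply: pD => //.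
  apply: (min_marked_perm lT (h1 _ i1) (h1 _ i2) mp.1 s1) => x /s2.
  by rewrite (perm_mem pq).
- move=> p; split=> [mp|[[]|[D _ []]] //].
  have [hp|hp] := boolP (has mark p); last by left.
  right; have [D pr sub] := min_marked_ex mp.1 hp.
  have /hasP[D' D'Ds pe] := h3 _ pr; exists D' => //; split=> // x.
  by rewrite -(perm_mem pe) => /sub.
- move=> p q [_ np] [D /h1[_ /hasP[a aD ma] _] [_ sub]]; apply/negP => pq.
  by case/hasP: np; exists a => //; rewrite (perm_mem pq) sub.
Qed.

(** Intended for terms that differ only below the marked action: they simulate each other up to the
    mark, and beyond it only the outcomes have to agree. *)
Variable R : term K -> term K -> Prop.
Hypothesis R_sym : forall T T', R T T' -> R T' T.
Hypothesis R_state : forall T T', R T T' -> state T = state T'.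
Hypothesis R_step : forall T T' a T1, R T T' -> step T (Int a.1 a.2) T1 -> ~~ mark a ->
  exists2 T1', step T' (Int a.1 a.2) T1' & R T1 T1'.
Hypothesis R_mark : forall T T' a T1, R T T' -> step T (Int a.1 a.2) T1 -> mark a ->
  exists2 T1', step T' (Int a.1 a.2) T1' & outcome T1 = outcome T1'.

Lemma unmarked_path T T' p T1 : R T T' -> valid_to T p T1 -> ~~ has mark p ->
  exists2 T1', valid_to T' p T1' & R T1 T1'.
Proof.
elim: p T T' => [|a p IH] T T' RT.
  by move/valid_to_nil->; exists T' => //; constructor.
case/valid_toP => T2 st v /=; rewrite negb_or => /andP[na np].
have [T2' st' R2] := R_step RT st na; have [T1' v' R1] := IH _ _ R2 v np.
by exists T1' => //; apply/valid_toP; exists T2'.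
Qed.

Lemma marked_path T T' p a : R T T' -> valid T (rcons p a) -> ~~ has mark p -> mark a ->
  valid T' (rcons p a) /\ outcome (after T (rcons p a)) = outcome (after T' (rcons p a)).
Proof.
rewrite -cats1 => RT [T1 v] np ma; rewrite (after_eq v).
have [T2 v2 /valid_toP[T3 st v3]] := (valid_to_cat _ _ _ _).1 v.
rewrite (valid_to_nil v3).
have [T2' v2' R2] := unmarked_path RT v2 np; have [T3' st' o3] := R_mark R2 st ma.
have v' : valid_to T' (p ++ [:: a]) T3'.
  by apply/valid_to_cat; exists T2' => //; apply/valid_toP; exists T3' => //; constructor.
by split; [exists T3' | rewrite (after_eq v')].
Qed.

(** The mark being the last label, the simulation covers everything before it; minimality transfers
    because competitors can be truncated after their mark and brought back by symmetry. *)
Lemma min_marked_transfer T T' D : R T T' -> min_marked T D ->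
  min_marked T' D /\ outcome (after T D) = outcome (after T' D).
Proof.
move=> RT pD; have [p [a [eD ma np]]] := min_marked_split pD.
case: pD => vD mD min.
rewrite eD in vD; have [vD' oD] := marked_path RT vD np ma.
rewrite -eD in vD oD vD'; split=> //; split=> //.
move=> D' vD1 /split_mark[q [b [r [e' mb nq]]]] sub.
have vq : valid T' (rcons q b).
  by apply: (@valid_prefix _ _ r); rewrite -cats1 -catA -e'.
have [vqT _] := marked_path (R_sym RT) vq nq mb.
have subq : {subset rcons q b <= D'}.
  by move=> x; rewrite e' mem_rcons mem_cat !inE => /orP[->|->]; rewrite ?orbT.
move=> x xD; apply: (subq); apply: min xD => //; first by rewrite has_rcons mb.
by move=> y /subq/sub.
Qed.

Lemma unmarked_maximal T T' p : R T T' -> maximal T p /\ ~~ has mark p ->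
  (maximal T' p /\ ~~ has mark p) /\ value T p = value T' p.
Proof.
move=> RT [/[dup] mp /maximal_valid v np].
have [T1 v1 R1] := unmarked_path RT v np; split.
  split=> //; apply/(maximalP v1) => a T2 st; case ma: (mark a).
    have [T3 st3 _] := R_mark (R_sym R1) st ma; exact: (maximalP v).1 mp _ _ st3.
  have [|T3 st3 _] := R_step (R_sym R1) st; first by rewrite ma.
  exact: (maximalP v).1 mp _ _ st3.
by rewrite /value (after_eq v1) (R_state R1).
Qed.

Lemma mark_outcome T T' : R T T' -> lc T -> lc T' -> outcome T = outcome T'.
Proof.
move=> RT lT lT'; have [L hL] := valid_finite lT.
have [|Ds trD] := @perm_transversal_ex _ (min_marked T) L; first by move=> D [/hL].
have trD' : perm_transversal (min_marked T') Ds.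
  case: trD => h1 h2 h3; split=> // [D /h1/(min_marked_transfer RT)[]//|D].
  by move/(min_marked_transfer (R_sym RT)) => [/h3].
have [|ps tr] := @perm_transversal_ex _ (fun p => maximal T p /\ ~~ has mark p) L.
  by move=> p [[/hL]].
have tr' : perm_transversal (fun p => maximal T' p /\ ~~ has mark p) ps.
  case: (tr) => h1 h2 h3; split=> // [p /h1/(unmarked_maximal RT)[]//|p].
  by move/(unmarked_maximal (R_sym RT)) => [/h3].
rewrite (outcome_primes lT trD (k := (\sum_(p <- ps) value T p)%R)); last by exists ps.
rewrite (outcome_primes lT' trD' (k := (\sum_(p <- ps) value T' p)%R)); last by exists ps.
congr (_ + _)%R; rewrite big_seq [RHS]big_seq; apply: eq_bigr => x.
  by case: tr => h1 _ _ /h1/(unmarked_maximal RT)[].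
by case: trD => h1 _ _ /h1/(min_marked_transfer RT)[].
Qed.

End Primes.

(** * Two guards in front of equivalent continuations *)

Section Prefix.
Variable K : comPzSemiRingType.
Implicit Types (P Q S T U V : term K) (A zs ns : seq name).

Definition open_equiv P Q := [/\ lc_at 1 P, lc_at 1 Q & forall z S, z \notin fv P -> z \notin fv Q -> lc S ->
  outcome (Par (open z P) S) = outcome (Par (open z Q) S)].

Definition guarded_pair T T' := exists A u e P Q V zs ws,
  [/\ open_equiv P Q, stripped A T (Par (Act u e P) V) zs & stripped A T' (Par (Act u e Q) V) ws].

(** The guard is the left component of the whole term: its position is [[:: 1]], and a
    synchronisation with the right component lists it first. *)
Definition at_guard (a : position * position) := a.1 == [:: 1].

Lemma guarded_pair_sym T T' : guarded_pair T T' -> guarded_pair T' T.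
Proof.
move=> [A [u [e [P [Q [V [zs [ws [[lP lQ h] s s']]]]]]]]].
exists A, u, e, Q, P, V, ws, zs; split=> //; split=> // z S zQ zP lS.
by rewrite h.
Qed.

Lemma guarded_pair_step T T' a T1 : guarded_pair T T' -> step T (Int a.1 a.2) T1 -> ~~ at_guard a ->
  exists2 T1', step T' (Int a.1 a.2) T1' & guarded_pair T1 T1'.
Proof.
case: a => i k [A [u [e [P [Q [V [zs [ws [PQ s s']]]]]]]]] /= st ng.
have [x [ns [U1 [z1 [us nn s1]]]]] := stripped_step A s st.
have {}nn : newnames A x ns by apply: newnamesW nn => w wA; rewrite mem_cat wA.
inversion us as [|? ? ? ? ? ? ? us'|? ? ? ? ? V1 ? us'| | |? ? ? ? ? ? ? ? ? ? ? fi fj]; subst.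
- by inversion us'.
- have us2 := us_parR (Act u e Q) us'.
  have [T1' [w1 [st' s1']]] := stripped_ust s' us2 nn.
  exists T1' => //; exists (x :: ns ++ A), u, e, P, Q, V1, z1, w1; split=> //.
- by inversion fi; subst.
Qed.

Lemma open_diam_outcome A T P V B zs ns x : lc_at 1 P -> lc V -> sr (open x P) B ns ->
  uniq ns -> fresh (x :: fv P ++ fv V) ns -> sr V V [::] ->
  stripped A T (Par (Diam B) V) zs -> outcome T = outcome (Par (open x P) V).
Proof.
move=> lP lV sB un fn sV s; have lo : lc (open x P) by apply: lc_open.
rewrite -par_diam //.
have lD : lc (Par (Diam (open x P)) V) by rewrite lc_par lc_diam lo.
apply: (tequiv_outcome (stripped_lc s) lD).
set A' := A ++ fv (Par (Diam (open x P)) V) ++ ns.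
apply: (@stripped_tequiv _ A' _ _ _ zs ns).
  by apply: strippedW s => w wA; rewrite mem_cat wA.
split=> //.
- by rewrite -[ns]cats0; constructor=> //; constructor.
- apply: freshW fn => w /=; rewrite mem_cat inE mem_cat => /orP[/fv_open|->]; last by rewrite !orbT.
  by rewrite inE => /orP[]->; rewrite ?orbT.
- by move=> w wT; rewrite !mem_cat; move: wT; rewrite /= mem_cat => ->; rewrite ?orbT.
- by move=> w wn; rewrite !mem_cat wn !orbT.
Qed.

Lemma guarded_pair_mark T T' a T1 : guarded_pair T T' -> step T (Int a.1 a.2) T1 -> at_guard a ->
  exists2 T1', step T' (Int a.1 a.2) T1' & outcome T1 = outcome T1'.
Proof.
case: a => i k [A [u [e [P [Q [V [zs [ws [[lP lQ PQ] s s']]]]]]]]] /= st /eqP/= ei; subst i.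
have [x [ns [U1 [z1 [us nn s1]]]]] := stripped_step A s st.
have {}nn : newnames A x ns by apply: newnamesW nn => w wA; rewrite mem_cat wA.
inversion us as [|? ? ? ? ? ? ? us'|? ? ? ? ? V1 ? us'| | |? ? ? l v f y P1 V1 n1 n2 fi fj]; subst.
  by inversion us'.
inversion fi as [v' f' P' y' B n1' sB| | | | |]; subst.
have fU := stripped_fvU s; have fU' := stripped_fvU s'.
(* The continuations of the two guards uncover unrelated hidings, so the second side needs names of
   its own, away from those uncovered by the partner. *)
have [B' [n1' [sB' un1' fn1']]] := sr_ex (open x Q) (x :: n2 ++ A).
have fi' : fire (Act (F v) f Q) [::] v f x (Diam B') n1' by constructor.
have us2 := us_comm fi' fj.
case/andP: (nn) => /= /andP[xns uns] /andP[xA fns].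
move: uns xns fns; rewrite cat_uniq fresh_catl mem_cat negb_or.
move=> /and3P[un1 dj un2] /andP[xn1 xn2] /andP[fn1 fn2].
have nn' : newnames A x (n1' ++ n2).
  rewrite /newnames /= xA mem_cat negb_or xn2 andbT cat_uniq un1' un2 fresh_catl fn2 !andbT /=.
  rewrite -?andbA.
  apply/and3P; split.
  - by apply/negP => /(allP fn1'); rewrite inE eqxx.
  - apply/hasPn => w wn2; apply/negP => /(allP fn1'); by rewrite inE mem_cat wn2 !orbT.
  - by apply: freshW fn1' => w wA; rewrite inE mem_cat wA !orbT.
have [T1' [w1 [st' s1']]] := stripped_ust s' us2 nn'.
exists T1' => //.
have lV1 : lc V1 by have := stripped_lcU s1; rewrite lc_par => /andP[].
have sV1 : sr V1 V1 [::].
  have := sr_id (stripped_sr s1) => /sr_par_inv[? [? [a1 [a2 [[_ <-] + _]]]]].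
  by case: a1 => //= <-.
have fvV1 w : w \in fv V1 -> [|| w == x, w \in n2 | w \in A].
  move/(fire_fv fj); rewrite inE mem_cat => /or3P[->|->|wV]; rewrite /= ?orbT //.
  by rewrite (fU w) ?orbT //= inE mem_cat wV !orbT.
rewrite (open_diam_outcome lP lV1 sB un1 _ sV1 s1).
  rewrite (open_diam_outcome lQ lV1 sB' un1' _ sV1 s1').
    apply: PQ => //; apply: contra xA => xP.
    by apply: fU; rewrite /= inE mem_cat xP !orbT.
    by apply: fU'; rewrite /= inE mem_cat xP !orbT.
  apply: freshW fn1' => w; rewrite !inE !mem_cat => /or3P[->|wQ|/fvV1/or3P[]->]; rewrite ?orbT //.
  by rewrite (fU' w) ?orbT //= inE mem_cat wQ !orbT.
apply/allP => w wn1; rewrite !inE mem_cat !negb_or; apply/and3P; split.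
- by apply: contraNneq xn1 => <-.
- by apply: contra (allP fn1 _ wn1) => wP; apply: fU; rewrite /= inE mem_cat wP !orbT.
- apply/negP => /fvV1/or3P[/eqP wx|wn2|wA].
  + by rewrite -wx wn1 in xn1.
  + by have /hasPn/(_ _ wn2) := dj; rewrite wn1.
  + by have := allP fn1 _ wn1; rewrite wA.
Qed.

(** The marked labels fire the prefix. After that, [P] and [Q] appear with [x] transposed with a
    fresh name, which is the case of [obs_equiv_sw]. *)
Lemma obs_equiv_act u e x P Q : lc P -> lc Q -> obs_equiv P Q ->
  obs_equiv (act u e x P) (act u e x Q).
Proof.
move=> lP lQ PQ S lS.
have lact T : lc T -> lc (Par (act u e x T) S).
  by move=> lT; rewrite lc_par lS andbT /lc /=; apply: lc_close.
apply: (@mark_outcome _ at_guard _ guarded_pair) => //; try exact: lact.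
- by move=> a b /eqP-> /eqP->.
- exact: guarded_pair_sym.
- move=> T T' [A [v [f [P0 [Q0 [V [zs [ws [_ s s']]]]]]]]].
  by rewrite (sr_state (stripped_sr s)) (sr_state (stripped_sr s')).
- exact: guarded_pair_step.
- exact: guarded_pair_mark.
have [W [zs [s fz]]] := stripped_ex (fv (Par (act u e x Q) S)) (lact _ lP).
set A := fv (Par (act u e x P) S) ++ zs in s.
exists (fv (Par (act u e x Q) S) ++ A), (F u), e, (close x P), (close x Q).
have [X [V [z1 [z2 [eW ez sP sS]]]]] := sr_par_inv (stripped_sr s); subst.
inversion sP; subst; exists V, ([::] ++ z2), ([::] ++ z2); split.
- split; try exact: lc_close.
  move=> z R; rewrite !fv_close !mem_filter => zP zQ lR.
  rewrite /open /close !open_close_sw //; first exact: obs_equiv_sw.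
    by move=> zx; move: zQ; rewrite zx.
  by move=> zx; move: zP; rewrite zx.
- by apply: strippedW s => w wA; rewrite mem_cat wA orbT.
- case: s => _ _ uz _ _ zA; split=> //; first exact: lact.
  + by constructor=> //; constructor.
  + by move=> w wT; rewrite mem_cat wT.
  + by move=> w /zA wA; rewrite mem_cat wA orbT.
Qed.

End Prefix.

(** * Composition without interaction *)

Section FreshChoice.
Variable K : comPzSemiRingType.
Implicit Types (T U : term K) (i k : position) (zs ns A : seq name).

Lemma fire_fresh U i u e x U' ns y A : fire U i u e x U' ns ->
  exists U2 ms, [/\ fire U i u e y U2 ms, uniq ms & fresh A ms].
Proof.
elim=> {U i u e x U' ns}.
- move=> u e P x B ns _; have [B' [ms [s un f]]] := sr_ex (open y P) A.
  by exists (Diam B'), ms; split=> //; constructor.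
- by move=> P i u e x P' ns _ [U2 [ms [? ? ?]]]; exists (Diam U2), ms; split=> //; constructor.
- by move=> P Q i u e x P' ns _ [U2 [ms [? ? ?]]]; exists (Par U2 Q), ms; split=> //; constructor.
- by move=> P Q i u e x P' ns _ [U2 [ms [? ? ?]]]; exists (Par P U2), ms; split=> //; constructor.
- by move=> P Q i u e x P' ns _ [U2 [ms [? ? ?]]]; exists (SPar U2 Q), ms; split=> //; constructor.
- by move=> P Q i u e x P' ns _ [U2 [ms [? ? ?]]]; exists (SPar P U2), ms; split=> //; constructor.
Qed.

Lemma ust_fresh U i k x U' ns A : ust U i k x U' ns ->
  exists y U2 ms, ust U i k y U2 ms /\ newnames A y ms.
Proof.
elim=> {U i k x U' ns}.
- by move=> P i k x P' ns _ [y [U2 [ms [? ?]]]]; exists y, (Diam U2), ms; split=> //; constructor.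
- by move=> P Q i k x P' ns _ [y [U2 [ms [? ?]]]]; exists y, (Par U2 Q), ms; split=> //; constructor.
- by move=> P Q i k x P' ns _ [y [U2 [ms [? ?]]]]; exists y, (Par P U2), ms; split=> //; constructor.
- by move=> P Q i k x P' ns _ [y [U2 [ms [? ?]]]]; exists y, (SPar U2 Q), ms; split=> //; constructor.
- by move=> P Q i k x P' ns _ [y [U2 [ms [? ?]]]]; exists y, (SPar P U2), ms; split=> //; constructor.
- move=> P Q i k u e x P' Q' ns ms f1 f2; have [y yA] := fresh_name A.
  have [P2 [ns2 [g1 u1 h1]]] := fire_fresh y (y :: A) f1.
  have [Q2 [ms2 [g2 u2 h2]]] := fire_fresh y (y :: A ++ ns2) f2.
  exists y, (Par P2 Q2), (ns2 ++ ms2); split; first exact: us_comm g1 g2.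
  rewrite /newnames -cat_cons fresh_catl /= yA mem_cat cat_uniq u1 u2 negb_or andbT /=.
  have yn : y \notin ns2 by apply/negP => /(allP h1); rewrite mem_head.
  have ym : y \notin ms2 by apply/negP => /(allP h2); rewrite mem_head.
  rewrite yn ym /=; apply/and3P; split.
  + by apply/hasPn => w /(allP h2); rewrite inE mem_cat !negb_or => /and3P[].
  + by apply: freshW h1 => w wA; rewrite inE wA orbT.
  + by apply: freshW h2 => w wA; rewrite inE mem_cat wA !orbT.
Qed.

(** A transition of the opened form may use clashing names; [ust_fresh] renews them, and the result
    lifts to the term. *)
Lemma stuck_ust A T U zs i k x U' ns : stripped A T U zs -> ust U i k x U' ns ->
  exists T', step T (Int i k) T'.
Proof.
move=> s /(ust_fresh A)[y [U2 [ms [us nn]]]].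
by have [T' [_ [st _]]] := stripped_ust s us nn; exists T'.
Qed.

End FreshChoice.

(** * Translation along a guess, and its transitions *)

Section Guess.
Variable K : comPzSemiRingType.
Implicit Types (P Q S T U V N Y Z : term K) (a i j k l : position) (zs ns A : seq name)
  (u v w x : name) (e b : bool).

(** A factor 0 that is not under an action survives every transition, so no continuation of the run
    recovers a nonzero value. *)
Fixpoint dead T : Prop := match T with
| Const c => c = 0%R
| Act _ _ _ => False
| Diam P | Nu P => dead P
| Par P Q | SPar P Q => dead P \/ dead Q end.

Lemma dead_state T : dead T -> state T = 0%R.
Proof.
by elim: T => //= [P IP Q IQ|P IP Q IQ] [/IP->|/IQ->]; rewrite ?mul0r ?mulr0.
Qed.

Lemma dead_fire T i u e x T' ns : fire T i u e x T' ns -> dead T -> dead T'.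
Proof.
elim=> //= {T i u e x T' ns} P Q i u e x P' ns _ IH [d|d];
  by [left; apply: IH | right | left | right; apply: IH].
Qed.

Lemma dead_ust T i k x T' ns : ust T i k x T' ns -> dead T -> dead T'.
Proof.
elim=> //= {T i k x T' ns} [P Q i k x P' ns _ IH [d|d]|P Q i k x P' ns _ IH [d|d]
  |P Q i k x P' ns _ IH [d|d]|P Q i k x P' ns _ IH [d|d]|P Q i k u e x P' Q' ns ms fP fQ [d|d]];
  by [left; apply: IH | right | left | right; apply: IH | left; apply: dead_fire fP d
  | right; apply: dead_fire fQ d].
Qed.

(* [t a] is the guess for the action at address [a]: unfired, or fired with a
   partner in [R] or not.  [free a]: the subject of that action is a free name
   of the initial term.  [own a]: the address is in [R].  [hat c] and [mk] create names
   outside of the initial names [< base]. *)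
Variables (t : position -> option bool) (free own : pred position).
Variables (hat : nat -> name -> name) (mk : position -> name) (base : nat) (A0 : seq name).
Hypothesis A0_base : forall u, u < base -> u \in A0.
Hypothesis hat_A0 : forall c u, c < 3 -> u < base -> hat c u \in A0.
Hypothesis hat_base : forall c u, base <= hat c u.
Hypothesis hat_inj : forall c u d v, hat c u = hat d v -> c = d /\ u = v.
Hypothesis mk_A0 : forall a, t a -> mk a \in A0.
Hypothesis mk_base : forall a, base <= mk a.
Hypothesis mk_inj : injective mk.
Hypothesis mk_hat : forall a c u, mk a <> hat c u.

(* Two opposite actions have the same face iff they have the same subject and
   each one is in the class that the other one guesses. *)
Definition face o u e b := match o, b with
| false, false => u
| true, true => hat 2 u
| false, true => hat (~~ e) u
| true, false => hat e u end.

(** Subjects that are not initial names need no copy: names created later are never shared by [P]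
    and [R]. *)
Definition pf a u e b := if free a then face (own a) u e b else u.
Definition pfn a (n : nm) e b := if n is F u then F (pf a u e b) else n.

(** Visible as a possible partner, but using it costs a factor 0. *)
Definition blk (n : nm) e : term K := Act n e (Const 0%R).
(** Puts the left argument of a composition exactly where the continuation of a fired action ends
    up, beside its [mplus]; one map on digits then translates all positions. *)
Definition wrap Y M : term K := Diam (SPar Y M).
Definition mplus a : term K := Act (F (mk a)) true (Const 1%R).
Definition mminus a : term K := Act (F (mk a)) false (Const 1%R).
Definition mzero a : term K := Act (F (mk a)) true (Const 0%R).
Definition mdone : term K := Diam (Const 1%R).

Fixpoint gl a T : seq (position * bool) := match T with
| Const _ => [::]
| Act _ _ P => (if t a is Some b then [:: (a, b)] else [::]) ++ gl (rcons a 1) P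
| Diam P => gl (rcons a 1) P
| Par P Q | SPar P Q => gl (rcons a 1) P ++ gl (rcons a 2) Q
| Nu P => gl a P end.

(* The final state of [tr a T] is dead unless exactly the actions guessed to fire have fired:
   [mminus a] has to synchronise either with [mplus a], which is
   available once the action at [a] has fired, or with [mzero a]; an action
   guessed not to fire offers all its faces to its environment and is followed by [0]. *)
Fixpoint tr a T : term K := match T with
| Const c => Const c
| Act n e P => match t a with
  | Some b => if b && ~~ free a then Const 0%R else
      Par (Act (pfn a n e b) e (SPar (tr (rcons a 1) P) (mplus a))) (Par (mminus a) (mzero a))
  | None => if gl (rcons a 1) P == [::]
      then SPar (blk (pfn a n e false) e) (blk (pfn a n e true) e) else Const 0%R end
| Diam P => Par (wrap (tr (rcons a 1) P) (Const 1%R)) (Const 1%R)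
| Par P Q => Par (wrap (tr (rcons a 1) P) (Const 1%R)) (tr (rcons a 2) Q)
| SPar P Q => SPar (wrap (tr (rcons a 1) P) (Const 1%R)) (tr (rcons a 2) Q)
| Nu P => Nu (tr a P) end.

(** The invariant on names: a subject that is not an initial one lies outside [A0], so it clashes
    with neither a copy nor a test name in use; a bound subject is never initial. *)
Fixpoint wk a T : bool := match T with
| Const _ => true
| Act n e P => match n with B _ => ~~ free a
    | F u => if free a then u < base else u \notin A0 end && wk (rcons a 1) P
| Diam P => wk (rcons a 1) P
| Par P Q | SPar P Q => wk (rcons a 1) P && wk (rcons a 2) Q
| Nu P => wk a P end.

Lemma gl_open n x a T : gl a (open_rec n x T) = gl a T.
Proof. by elim: T n a => //= [m e P IP|P IP Q IQ|P IP Q IQ] n a; rewrite ?IP ?IQ. Qed.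

Lemma tr_open n x a T : wk a T -> x \notin A0 -> tr a (open_rec n x T) = open_rec n x (tr a T).
Proof.
move=> + xA; elim: T n a => //= [m e P IP|P IP|P IP Q IQ|P IP Q IQ|P IP] n a.
- case/andP=> hm wP; rewrite gl_open.
  have pfE b : pfn a (nm_open n x m) e b = nm_open n x (pfn a m e b).
    by case: m hm => //= i nf; case: eqP => //= _; rewrite /pf (negPf nf).
  case: (t a) => [b|]; last by case: eqP => //= _; rewrite !pfE.
  by case: ifP => //= _; rewrite pfE IP.
- by move=> wP; rewrite IP.
- by case/andP=> wP wQ; rewrite IP // IQ.
- by case/andP=> wP wQ; rewrite IP // IQ.
- by move=> wP; rewrite IP.
Qed.

Lemma wk_open n x a T : wk a T -> x \notin A0 -> wk a (open_rec n x T).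
Proof.
move=> + xA; elim: T n a => //= [m e P IP|P IP|P IP Q IQ|P IP Q IQ|P IP] n a.
- case/andP=> hm wP; rewrite IP // andbT.
  by case: m hm => //= i nf; case: eqP => //= _; rewrite (negPf nf).
- by move=> wP; rewrite IP.
- by case/andP=> wP wQ; rewrite IP // IQ.
- by case/andP=> wP wQ; rewrite IP // IQ.
- by move=> wP; rewrite IP.
Qed.

(** Digit 1 has to cross the [Par] or [SPar], then the [Diam] and the [SPar] of a [wrap]; digit 2
    remains a right argument. *)
Definition dig d : position := if d == 1 then [:: 1; 1; 1] else [:: d].
Definition spos i : position := flatten (map dig i).
(** The final 1 reaches the action inside the [Par] that also holds its test. *)
Definition fpos i := spos i ++ [:: 1].
(** The synchronisation of [mplus], beside the continuation of the fired action, with [mminus], the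
    left half of the test next to it. *)
Definition mlab i := (spos i ++ [:: 1; 1; 2], spos i ++ [:: 2; 1]).
Definition lift (s : position) (pd : seq (position * position)) :=
  [seq (s ++ y.1, s ++ y.2) | y <- pd].

Definition comp s P Q := if s then Par P Q else SPar P Q.

Lemma fv_comp s P Q : fv (comp s P Q) = fv P ++ fv Q. Proof. by case: s. Qed.
Lemma state_comp s P Q : state (comp s P Q) = (state P * state Q)%R. Proof. by case: s. Qed.
Lemma dead_comp s P Q : dead P \/ dead Q -> dead (comp s P Q). Proof. by case: s. Qed.

Lemma sr_comp s P Q U V zs ws : sr P U zs -> sr Q V ws -> sr (comp s P Q) (comp s U V) (zs ++ ws).
Proof. by case: s; constructor. Qed.

Lemma sr_comp_inv s P Q U zs : sr (comp s P Q) U zs ->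
  exists V W z1 z2, [/\ U = comp s V W, zs = z1 ++ z2, sr P V z1 & sr Q W z2].
Proof. by case: s => [/sr_par_inv|/sr_spar_inv]. Qed.

Lemma fire_left s P Q i u e x P' ns :
  fire P i u e x P' ns -> fire (comp s P Q) (1 :: i) u e x (comp s P' Q) ns.
Proof. by case: s; constructor. Qed.

Lemma fire_right s P Q i u e x Q' ns :
  fire Q i u e x Q' ns -> fire (comp s P Q) (2 :: i) u e x (comp s P Q') ns.
Proof. by case: s; constructor. Qed.

Lemma ust_left s P Q i k x P' ns : ust P i k x P' ns -> ust (comp s P Q) (1 :: i) (1 :: k) x (comp s P' Q) ns.
Proof. by case: s; constructor. Qed.

Lemma ust_right s P Q i k x Q' ns : ust Q i k x Q' ns -> ust (comp s P Q) (2 :: i) (2 :: k) x (comp s P Q') ns.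
Proof. by case: s; constructor. Qed.

Lemma fire_comp_inv s P Q i u e x V ns : fire (comp s P Q) i u e x V ns ->
  (exists j P', [/\ i = 1 :: j, fire P j u e x P' ns & V = comp s P' Q]) \/
  (exists j Q', [/\ i = 2 :: j, fire Q j u e x Q' ns & V = comp s P Q']).
Proof.
by case: s => f; inversion f; subst; [left|right|left|right]; do 2 eexists; split=> //; eassumption.
Qed.

Lemma ust_comp_inv s P Q i k x V ns : ust (comp s P Q) i k x V ns ->
  [\/ exists j l P', [/\ i = 1 :: j, k = 1 :: l, ust P j l x P' ns & V = comp s P' Q],
      exists j l Q', [/\ i = 2 :: j, k = 2 :: l, ust Q j l x Q' ns & V = comp s P Q']
    | exists j l u e P', exists Q' n1 n2, [/\ s, i = 1 :: j /\ k = 2 :: l, fire P j u e x P' n1,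
        fire Q l u (~~ e) x Q' n2 & V = comp s P' Q' /\ ns = n1 ++ n2]].
Proof.
by case: s => f; inversion f; subst; [apply: Or31|apply: Or32|apply: Or33|apply: Or31|apply: Or32];
  repeat eexists; eassumption.
Qed.

Lemma fire_diam_inv P i u e x V ns : fire (Diam P) i u e x V ns ->
  exists j P', [/\ i = 1 :: j, fire P j u e x P' ns & V = Diam P'].
Proof. by move=> f; inversion f; subst; do 2 eexists; split=> //; eassumption. Qed.

Lemma ust_diam_inv P i k x V ns : ust (Diam P) i k x V ns ->
  exists j l P', [/\ i = 1 :: j, k = 1 :: l, ust P j l x P' ns & V = Diam P'].
Proof. by move=> f; inversion f; subst; do 3 eexists; split=> //; eassumption. Qed.

Lemma ust_const_inv c j l x V ns : ~ ust (Const c : term K) j l x V ns.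
Proof. by move=> u; inversion u. Qed.

Lemma ust_act_inv n f P j l x V ns : ~ ust (Act n f P) j l x V ns.
Proof. by move=> u; inversion u. Qed.

Lemma fire_prefix_inv n f P j w e x V ns : fire (Act n f P) j w e x V ns ->
  [/\ n = F w, f = e, j = [::] & exists2 B, V = Diam B & sr (open x P) B ns].
Proof. by move=> fi; inversion fi; subst; split=> //; exists B. Qed.

Lemma sr_const_inv c U zs : sr (Const c) U zs -> U = Const c /\ zs = [::].
Proof. by move=> s; inversion s. Qed.

Lemma tr_act a n e P : tr a (Act n e P) = match t a with
  | Some b => if b && ~~ free a then Const 0%R else
      Par (Act (pfn a n e b) e (SPar (tr (rcons a 1) P) (mplus a))) (Par (mminus a) (mzero a))
  | None => if gl (rcons a 1) P == [::]
      then SPar (blk (pfn a n e false) e) (blk (pfn a n e true) e) else Const 0%R end.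
Proof. by []. Qed.

(* [gadget a M W pd]: the states of the test for the firing of the action at [a]; there is
   none for the other nodes. *)
Inductive gadget a : term K -> term K -> seq (position * position) -> Prop :=
| gad_none : gadget a (Const 1%R) (Const 1%R) [::]
| gad_pend : t a -> gadget a (mplus a) (Par (mminus a) (mzero a)) [:: ([:: 1; 1; 2], [:: 2; 1])]
| gad_done : t a -> gadget a mdone (Par mdone (mzero a)) [::].

(* [rg]: the guesses still to be realised; [pd]: the synchronisations of
   [mminus] with [mplus] that are enabled. *)
Inductive G : position -> term K -> term K -> seq (position * bool) ->
    seq (position * position) -> Prop :=
| G_const a c : G a (Const c) (Const c) [::] [::]
| G_act a n e P : wk a (Act n e P) -> G a (Act n e P) (tr a (Act n e P)) (gl a (Act n e P)) [::]
| G_box a P Y M W rg pd pd0 : gadget a M W pd0 -> G (rcons a 1) P Y rg pd ->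
    G a (Diam P) (comp true (wrap Y M) W) rg (pd0 ++ lift [:: 1; 1; 1] pd)
| G_comp a s P Q Y Z rg pd rg' pd' : G (rcons a 1) P Y rg pd -> G (rcons a 2) Q Z rg' pd' ->
    G a (comp s P Q) (comp s (wrap Y (Const 1%R)) Z) (rg ++ rg')
      (lift [:: 1; 1; 1] pd ++ lift [:: 2] pd').

Lemma fire_wrap Y M i u e x Y' ns : fire Y i u e x Y' ns ->
  fire (wrap Y M) [:: 1, 1 & i] u e x (wrap Y' M) ns.
Proof. by move=> f; do 2!constructor. Qed.

Lemma ust_wrap Y M i k x Y' ns : ust Y i k x Y' ns ->
  ust (wrap Y M) [:: 1, 1 & i] [:: 1, 1 & k] x (wrap Y' M) ns.
Proof. by move=> f; do 2!constructor. Qed.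

Lemma fire_wrap_inv Y M j w e x V ns : fire (wrap Y M) j w e x V ns ->
  (exists k Y', [/\ j = [:: 1, 1 & k], fire Y k w e x Y' ns & V = wrap Y' M]) \/
  (exists k M', [/\ j = [:: 1, 2 & k], fire M k w e x M' ns & V = wrap Y M']).
Proof.
by case/fire_diam_inv => [k [Z [-> /(@fire_comp_inv false)[] [l [W [-> f ->]]] ->]]]; [left|right]; exists l, W.
Qed.

Lemma ust_wrap_inv Y M j l x V ns : ust (wrap Y M) j l x V ns ->
  (exists j' l' Y', [/\ j = [:: 1, 1 & j'], l = [:: 1, 1 & l'], ust Y j' l' x Y' ns & V = wrap Y' M]) \/
  (exists j' l' M', ust M j' l' x M' ns).
Proof.
case/ust_diam_inv => [j1 [l1 [Z [-> -> /(@ust_comp_inv false)[]]]]].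
- by case=> [j2 [l2 [W [-> -> u ->]]]] ->; left; exists j2, l2, W.
- by case=> [j2 [l2 [W [_ _ u _]]]] _; right; exists j2, l2, W.
- by case=> [? [? [? [? [? [? [? [? []]]]]]]]].
Qed.

Lemma mk_fire a e' c j w e x V ns : fire (Act (F (mk a)) e' (Const c)) j w e x V ns ->
  [/\ w = mk a, e = e', j = [::] & V = Diam (Const c)].
Proof. by case/fire_prefix_inv => [[->] -> -> [B -> /sr_const_inv[-> _]]]. Qed.

Lemma mdone_fire j w e x V ns : ~ fire mdone j w e x V ns.
Proof. by case/fire_diam_inv => [k [P [_ f _]]]; inversion f. Qed.

Lemma gadget_fire a M W pd j w e x V ns : gadget a M W pd ->
  fire M j w e x V ns \/ fire W j w e x V ns -> t a /\ w = mk a.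
Proof.
case=> [|ta|ta] [f|f].
- by inversion f.
- by inversion f.
- by have [] := mk_fire f.
- by case/(@fire_comp_inv true): f => [] [k [P [_ /mk_fire[]]]].
- by case: (mdone_fire f).
- case/(@fire_comp_inv true): f => [] [k [P [_ f _]]]; first by case: (mdone_fire f).
  by have [] := mk_fire f.
Qed.

Lemma gadget_ustM a M W pd j l x V ns : gadget a M W pd -> ~ ust M j l x V ns.
Proof.
case=> [|_|_]; [exact: ust_const_inv|exact: ust_act_inv|].
by case/ust_diam_inv => [k [k' [P [_ _ /ust_const_inv]]]].
Qed.

(** Inside [W] the only possible synchronisation is [mminus] with [mzero], which produces the factor
    0. *)
Lemma gadget_ustW a M W pd j l x V ns : gadget a M W pd -> ust W j l x V ns -> dead V /\ pd <> [::].
Proof.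
case=> [|_|_]; first by move/ust_const_inv.
  case/(@ust_comp_inv true) => [[? [? [? [_ _ /ust_act_inv //]]]]|[? [? [? [_ _ /ust_act_inv //]]]]|].
  case=> [j1 [l1 [u [b [P [Q [n1 [n2 [_ _ f1 f2 [-> _]]]]]]]]]].
  by have [_ _ _ ->] := mk_fire f2; split=> //; right.
case/(@ust_comp_inv true) => [[? [? [? [_ _ u _]]]]|[? [? [? [_ _ /ust_act_inv //]]]]|].
  by case/ust_diam_inv: u => [k [k' [P [_ _ /ust_const_inv]]]].
by case=> [j1 [l1 [u [b [P [Q [n1 [n2 [_ _ /mdone_fire]]]]]]]]].
Qed.

Lemma gadget_comm a M W pd j l w e x M' W' n1 n2 : gadget a M W pd -> fire M j w e x M' n1 ->
  fire W l w (~~ e) x W' n2 ->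
  dead W' \/ [/\ pd = [:: ([:: 1, 1, 2 & j], 2 :: l)], gadget a M' W' [::] & n1 = [::] /\ n2 = [::]].
Proof.
case=> [|ta|ta] f1; [by inversion f1| |by case: (mdone_fire f1)].
have [_ ee -> ->] := mk_fire f1; case/(@fire_comp_inv true) => [] [k [P [-> f2 ->]]].
  have [_ _ -> ->] := mk_fire f2; right; split=> //; first exact: gad_done.
  have nilP f (c : K) j' v b V ns : fire (Act f b (Const c)) j' v b x V ns -> ns = [::].
    by case/fire_prefix_inv => _ _ _ [B _ s]; inversion s.
  subst e; split; first exact: nilP f1.
  by case/fire_prefix_inv: f2 => _ _ _ [B _ s]; inversion s.
by have [_ _ _ ->] := mk_fire f2; left; right.
Qed.

Lemma sr_par0 U V : sr U U [::] -> sr V V [::] -> sr (Par U V) (Par U V) [::].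
Proof. by move=> sU sV; rewrite -[[::]]/([::] ++ [::]); constructor. Qed.

Lemma sr_spar0 U V : sr U U [::] -> sr V V [::] -> sr (SPar U V) (SPar U V) [::].
Proof. by move=> sU sV; rewrite -[[::]]/([::] ++ [::]); constructor. Qed.

Lemma sr_tr_act a n e P : sr (tr a (Act n e P)) (tr a (Act n e P)) [::].
Proof.
move=> /=; case: (t a) => [b|]; case: ifP => _; try by constructor.
  by apply: sr_par0; [constructor | apply: sr_par0; constructor].
by apply: sr_spar0; constructor.
Qed.

Lemma sr_inj0 T U zs : sr T U zs -> sr T T [::] -> U = T /\ zs = [::].
Proof.
elim=> //= {T U zs}.
- by move=> P U zs _ IH s; inversion s; subst; case: IH => // -> ->.
- move=> P Q U V zs ws _ IP _ IQ /sr_par_inv[V1 [W1 [z1 [z2 [[<- <-]]]]]].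
  case: z1 z2 => [|//] [|//] _ sP sQ.
  by case: (IP sP) => -> ->; case: (IQ sQ) => -> ->.
- move=> P Q U V zs ws _ IP _ IQ /sr_spar_inv[V1 [W1 [z1 [z2 [[<- <-]]]]]].
  case: z1 z2 => [|//] [|//] _ sP sQ.
  by case: (IP sP) => -> ->; case: (IQ sQ) => -> ->.
- by move=> z P U zs _ _ _ s; inversion s.
Qed.

Lemma sr_wrap T U zs M : sr T U zs -> sr M M [::] -> sr (wrap T M) (wrap U M) zs.
Proof. by move=> s sM; rewrite -[zs]cats0; do 2!constructor. Qed.

Lemma tr_fv a T : wk a T -> {subset fv (tr a T) <= fv T ++ A0}.
Proof.
have pf_fv a0 u e b : (if free a0 then u < base else u \notin A0) -> pf a0 u e b \in u :: A0.
  rewrite /pf inE; case: ifP => [_ ub|_ _]; last by rewrite eqxx.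
  by case: (own a0) b => -[] /=; rewrite ?eqxx ?hat_A0 ?orbT //; case: (e).
elim: T a => //= [n e P IP|P IP|P IP Q IQ|P IP Q IQ] a.
- case/andP=> hn wP w; case ta: (t a) => [b|]; case: ifP => //= _.
    have mA : mk a \in A0 by apply: mk_A0; rewrite ta.
    rewrite !(mem_cat, inE) -!orbA => /or3P[|/(IP _ wP)|wm]; last first.
    + have /eqP-> : w == mk a by case/or3P: wm.
      by rewrite mA !orbT.
    + by rewrite mem_cat => /orP[->|->]; rewrite ?orbT.
    + case: n hn => [u|i] //= hu; rewrite inE => /eqP->.
      by have := pf_fv a u e b hu; rewrite !inE => /orP[->|->]; rewrite ?orbT.
  case: n hn => [u|i] //= hu; rewrite !inE => /orP[]/eqP->.
    by have := pf_fv a u e false hu; rewrite !inE ?mem_cat => /orP[->|->]; rewrite ?orbT.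
  by have := pf_fv a u e true hu; rewrite !inE ?mem_cat => /orP[->|->]; rewrite ?orbT.
- by move=> wP w; rewrite !cats0 => /(IP _ wP).
- case/andP=> wP wQ w; rewrite cats0 !mem_cat => /orP[/(IP _ wP)|/(IQ _ wQ)];
  by rewrite mem_cat => /orP[->|->]; rewrite ?orbT.
- case/andP=> wP wQ w; rewrite cats0 !mem_cat => /orP[/(IP _ wP)|/(IQ _ wQ)];
  by rewrite mem_cat => /orP[->|->]; rewrite ?orbT.
Qed.

Lemma G_strip_comp a s T1 T2 U V zs ws Y Z : sr (tr (rcons a 1) T1) Y zs ->
  G (rcons a 1) U Y (gl (rcons a 1) T1) [::] -> sr (tr (rcons a 2) T2) Z ws ->
  G (rcons a 2) V Z (gl (rcons a 2) T2) [::] ->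
  exists2 X, sr (comp s (wrap (tr (rcons a 1) T1) (Const 1%R)) (tr (rcons a 2) T2)) X (zs ++ ws)
    & G a (comp s U V) X (gl (rcons a 1) T1 ++ gl (rcons a 2) T2) [::].
Proof.
move=> s1 g1 s2 g2; exists (comp s (wrap Y (Const 1%R)) Z); last exact: (G_comp s g1 g2).
by apply: sr_comp => //; apply: sr_wrap => //; constructor.
Qed.

(** Names outside [A0] are left alone by the translation, so hidings can be opened before or after
    it. [G_strip_back] is the converse. *)
Lemma G_strip a T U zs : sr T U zs -> wk a T -> fresh A0 zs ->
  exists2 Y, sr (tr a T) Y zs & G a U Y (gl a T) [::].
Proof.
move=> s; elim: s a => {T U zs} /=.
- by move=> c a _ _; exists (Const c); constructor.
- move=> n e P a wP _; exists (tr a (Act n e P)); [exact: sr_tr_act | exact: G_act].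
- move=> P U zs _ IH a wP fz; have [Y sY gY] := IH _ wP fz.
  exists (comp true (wrap Y (Const 1%R)) (Const 1%R)).
    by rewrite -[zs]cats0; constructor; [apply: sr_wrap; last constructor | constructor].
  exact: (G_box (gad_none a) gY).
- move=> P Q U V zs ws _ IP _ IQ a /andP[wP wQ]; rewrite fresh_catl => /andP[fz fw].
  have [Y sY gY] := IP _ wP fz; have [Z sZ gZ] := IQ _ wQ fw.
  exact: (G_strip_comp true sY gY sZ gZ).
- move=> P Q U V zs ws _ IP _ IQ a /andP[wP wQ]; rewrite fresh_catl => /andP[fz fw].
  have [Y sY gY] := IP _ wP fz; have [Z sZ gZ] := IQ _ wQ fw.
  exact: (G_strip_comp false sY gY sZ gZ).
- move=> z P U zs zP _ IH a wP /andP[zA fz].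
  have [Y] := IH a (wk_open 0 wP zA) fz; rewrite gl_open tr_open // => sY gY.
  exists Y => //; constructor=> //.
  by apply/negP => /(tr_fv wP); rewrite mem_cat (negPf zP) (negPf zA).
Qed.

Lemma sr_wrap_inv T U zs M : sr (wrap T M) U zs -> sr M M [::] -> exists2 V, U = wrap V M & sr T V zs.
Proof.
move=> /sr_diam_inv[V -> /sr_spar_inv[V1 [V2 [z1 [z2 [-> -> s1 s2]]]]]] sM.
by have [-> ->] := sr_inj0 s2 sM; rewrite cats0; exists V1.
Qed.

Lemma G_strip_back a T Y zs : sr (tr a T) Y zs -> wk a T -> fresh A0 zs -> fresh (fv T) zs ->
  uniq zs -> exists2 U, sr T U zs & G a U Y (gl a T) [::].
Proof.
(* Induction on the size again, because of opened hidings. *)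
elim: {T}(term_size T).+1 {-2}T a Y zs (leqnn (term_size T).+1) => // n IH T a Y zs; rewrite ltnS.
have compC s P Q : term_size P + term_size Q < n ->
    sr (comp s (wrap (tr (rcons a 1) P) (Const 1%R)) (tr (rcons a 2) Q)) Y zs ->
    wk (rcons a 1) P && wk (rcons a 2) Q -> fresh A0 zs -> fresh (fv P ++ fv Q) zs -> uniq zs ->
    exists2 U, sr (comp s P Q) U zs & G a U Y (gl (rcons a 1) P ++ gl (rcons a 2) Q) [::].
  move=> lt /sr_comp_inv[V1 [Z [z1 [z2 [-> -> s1 s2]]]]].
  have [|Y1 -> s3] := sr_wrap_inv s1; first by constructor.
  rewrite !fresh_cat !fresh_catl cat_uniq.
  move=> /andP[wP wQ] /andP[fA1 fA2] /andP[/andP[fP _] /andP[_ fQ]] /and3P[u1 _ u2].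
  have [|U sU gU] := IH P _ _ _ _ s3 wP fA1 fP u1; first by rewrite (leq_trans _ lt) ?ltnS ?leq_addr.
  have [|V sV gV] := IH Q _ _ _ _ s2 wQ fA2 fQ u2; first by rewrite (leq_trans _ lt) ?ltnS ?leq_addl.
  by exists (comp s U V); [exact: sr_comp | exact: (G_comp s gU gV)].
case: T => [c|m e P|P|P Q|P Q|P] lt s wT fA fT uz; rewrite /= in lt s wT.
- by inversion s; subst; exists (Const c); constructor.
- have s0 := sr_tr_act a m e P.
  have [-> ->] := sr_inj0 s s0.
  by exists (Act m e P); [constructor | exact: G_act].
- have [V1 [V2 [z1 [z2 [eY ez s1 s2]]]]] := sr_par_inv s.
  have [eV ez2] := sr_inj0 s2 (sr_const _); subst; rewrite cats0 in fA fT uz *.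
  have [|Y1 -> s3] := sr_wrap_inv s1; first by constructor.
  have [U sU gU] := IH P _ _ _ lt s3 wT fA fT uz.
  by exists (Diam U); [exact: sr_diam | exact: (G_box (gad_none a) gU)].
- exact: (compC true).
- exact: (compC false).
- inversion s as [| | | | |z Q U zs' zP sU]; subst.
  case/andP: fA => zA fA; case/andP: fT => zT fT; case/andP: uz => zz uz.
  rewrite /open -tr_open // in sU.
  have lt' : term_size (open z P) < n by rewrite term_size_open.
  have [|U1 sU1 gU] := IH (open z P) _ _ _ lt' sU (wk_open 0 wT zA) fA _ uz.
    apply/allP => w wz; apply/negP => /fv_open; rewrite inE => /orP[/eqP ewz|].
      by rewrite -ewz wz in zz.
    by apply/negP; apply: (allP fT).
  by exists U1; [constructor | rewrite gl_open in gU].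
Qed.

Definition subj_ok a u := if free a then u < base else u \notin A0.

Lemma G_subj a N Y rg pd i u e x N' ns : G a N Y rg pd -> fire N i u e x N' ns -> subj_ok (a ++ i) u.
Proof.
move=> g; elim: g i N' => {a N Y rg pd}.
- by move=> a c i N' fi; inversion fi.
- by move=> a n f P /andP[wn _] i N' fi; inversion fi; subst; rewrite cats0.
- by move=> a P Y M W rg pd pd0 _ _ IH i N' /fire_diam_inv[j [P' [-> f _]]]; rewrite -cat_rcons; apply: IH f.
- move=> a s P Q Y Z rg pd rg' pd' _ IP _ IQ i N' /fire_comp_inv[] [j [P' [-> f _]]]; rewrite -cat_rcons.
    exact: IP f.
  exact: IQ f.
Qed.

(** Copies 0 and 1 record the polarity on the side of [R]: an action of [R] with its partner in [S]
    uses [hat e u], and that partner, of the opposite polarity, computes the same index. With a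
    single copy, two opposite actions of [R] that both expect partners in [S] could meet. Copy 2 is
    for synchronisations inside [R]. *)
Lemma pf_match a u e b a' v b' : subj_ok a u -> subj_ok a' v -> (b -> free a) -> (b' -> free a') ->
  pf a u e b = pf a' v (~~ e) b' -> [/\ u = v, b = free a && own a' & b' = free a' && own a].
Proof.
rewrite /subj_ok /pf.
have hlt c w w' : w' < base -> hat c w <> w'.
  by move=> lt e0; have := hat_base c w; rewrite e0 leqNgt lt.
have faceA a1 w f d : w < base -> face (own a1) w f d \in A0.
  by case: (own a1) d => -[] /= lt; rewrite ?hat_A0 ?A0_base //; case: (f).
case: (free a) => [ub|uA]; case: (free a') => [vb|vA] hb hb' /=.
- case: (own a) (own a') b b' {hb hb' faceA} => -[] [] [] /=; try by [];
    try (by move=> ->); try (by move/hlt; case); try (by move/esym/hlt; case);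
    case: e => /hat_inj[] //.
- by move=> ev; move: vA; rewrite -ev faceA.
- by move=> ev; move: uA; rewrite ev faceA.
- move=> <-; split=> //; first by case: b hb => // /(_ isT).
  by case: b' hb' => // /(_ isT).
Qed.

(** The converse of [pf_match]: when both guesses are right, the translated actions can still
    meet. *)
Lemma pf_sync a u e a' : subj_ok a u -> subj_ok a' u ->
  pf a u e (free a && own a') = pf a' u (~~ e) (free a' && own a).
Proof.
rewrite /subj_ok /pf; case: (free a) => [ub|uA]; case: (free a') => [vb|vA] //=.
- by case: (own a) (own a') e => -[] [].
- by rewrite A0_base in vA.
- by rewrite A0_base in uA.
Qed.

Lemma pf_mk a u e b a' w : subj_ok a u -> t a' -> w = pf a u e b -> w <> mk a'.
Proof.
move=> + + ->; rewrite /subj_ok /pf => + ta; case: (free a) => [ub|uA em]; last by rewrite em mk_A0 in uA.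
have nu : u <> mk a' by move=> em; have := mk_base a'; rewrite -em leqNgt ub.
by case: (own a) b => -[] //= /esym/mk_hat.
Qed.

Lemma perm_catl (X : eqType) (c s s' r : seq X) : perm_eq s (c ++ s') -> perm_eq (s ++ r) (c ++ s' ++ r).
Proof. by move=> pe; rewrite catA perm_cat2r. Qed.

Lemma perm_catr (X : eqType) (c s s' r : seq X) : perm_eq s (c ++ s') -> perm_eq (r ++ s) (c ++ r ++ s').
Proof.
move=> pe; rewrite (perm_trans (perm_cat (perm_refl r) pe)) //.
by rewrite perm_catCA.
Qed.

Lemma perm_cons2 (X : eqType) (x y : X) s s' r r' : perm_eq s (x :: s') -> perm_eq r (y :: r') ->
  perm_eq (s ++ r) [:: x, y & s' ++ r'].
Proof.
move=> p1 p2; rewrite (perm_trans (perm_cat p1 p2)) //= perm_cons.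
by rewrite -cat1s perm_catCA.
Qed.

Lemma perm_lift s c pd pd' : perm_eq pd' (c ++ pd) -> perm_eq (lift s pd') (lift s c ++ lift s pd).
Proof. by rewrite /lift -map_cat => /perm_map. Qed.

Lemma G_fire a N Y rg pd i u e x N' ns b : G a N Y rg pd -> fire N i u e x N' ns ->
  x \notin A0 -> fresh A0 ns -> t (a ++ i) = Some b -> (b -> free (a ++ i)) ->
  exists Y' rg' pd', [/\ fire Y (fpos i) (pf (a ++ i) u e b) e x Y' ns, G a N' Y' rg' pd',
    perm_eq rg ((a ++ i, b) :: rg') & perm_eq pd' (mlab i :: pd)].
Proof.
move=> g fi xA fA; elim: g i N' fi => {a N Y rg pd}.
- by move=> a c i N' fi; inversion fi.
- move=> a n f P w i N' fi; inversion fi as [u' e' P' x' B ns' sB| | | | |]; subst.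
  rewrite !cats0 /= => ta hb; rewrite ta.
  have {}hb : b && ~~ free a = false by case: (b) hb => // ->.
  case/andP: w => _ wP; rewrite hb.
  have [YB sY gY] := G_strip sB (wk_open 0 wP xA) fA.
  rewrite gl_open tr_open // in sY gY.
  (* Firing makes [mplus] available, so the pair of positions of this node, which is [mlab [::]],
     becomes pending. *)
  exists (comp true (wrap YB (mplus a)) (Par (mminus a) (mzero a))), (gl (rcons a 1) P),
    ([:: ([:: 1; 1; 2], [:: 2; 1])] ++ lift [:: 1; 1; 1] [::]); split=> //.
    apply: fi_parL; apply: fi_act; rewrite -[ns]cats0.
    by apply: sr_spar sY _; constructor.
  by apply: G_box gY; apply: gad_pend; rewrite ta.
- move=> a P Y M W rg pd pd0 gad _ IH i N' /fire_diam_inv[j [P' [-> f ->]]]; rewrite -cat_rcons => ta hb.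
  have [Y' [rg' [pd' [f' g' pr pe]]]] := IH _ _ f ta hb.
  exists (comp true (wrap Y' M) W), rg', (pd0 ++ lift [:: 1; 1; 1] pd'); split=> //.
  + by apply: fire_left; apply: fire_wrap.
  + exact: G_box.
  + exact: (perm_catr _ (perm_lift [:: 1; 1; 1] (c := [:: _]) pe)).
- move=> a s P Q Y Z rg pd rg1 pd1 gP IP gQ IQ i N' /fire_comp_inv[] [j [P' [-> f ->]]];
    rewrite -cat_rcons => ta hb.
    have [Y' [rg' [pd' [f' g' pr pe]]]] := IP _ _ f ta hb.
    exists (comp s (wrap Y' (Const 1%R)) Z), (rg' ++ rg1), (lift [:: 1; 1; 1] pd' ++ lift [:: 2] pd1); split=> //.
    * by apply: fire_left; apply: fire_wrap.
    * exact: G_comp.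
    * exact: (perm_catl (c := [:: _])).
    * exact: (perm_catl _ (perm_lift [:: 1; 1; 1] (c := [:: _]) pe)).
  have [Z' [rg' [pd' [f' g' pr pe]]]] := IQ _ _ f ta hb.
  exists (comp s (wrap Y (Const 1%R)) Z'), (rg ++ rg'), (lift [:: 1; 1; 1] pd ++ lift [:: 2] pd'); split=> //.
  * exact: fire_right.
  * exact: G_comp.
  * exact: (perm_catr (c := [:: _])).
  * exact: (perm_catr _ (perm_lift [:: 2] (c := [:: _]) pe)).
Qed.

(** The second alternative is half of a synchronisation of tests; [prefix a a'] locates it, so that
    it can be matched or excluded where the other half appears. *)
Definition fire_back a N Y' rg pd j w e x ns :=
  [\/ dead Y', exists a', [/\ prefix a a', t a' & w = mk a']
    | exists i u b N', exists rg' pd', [/\ j = fpos i, w = pf (a ++ i) u e b,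
      t (a ++ i) = Some b /\ (b -> free (a ++ i)), fire N i u e x N' ns &
      [/\ G a N' Y' rg' pd', perm_eq rg ((a ++ i, b) :: rg') & perm_eq pd' (mlab i :: pd)]]].

Lemma prefix_rcons_trans (a a' : position) d : prefix (rcons a d) a' -> prefix a a'.
Proof. by apply: prefix_trans; rewrite -cats1 prefix_prefix. Qed.

Lemma G_fire_back a N Y rg pd j w e x Y' ns : G a N Y rg pd -> fire Y j w e x Y' ns ->
  x \notin A0 -> fresh A0 ns -> x \notin fv N -> fresh (fv N) ns -> x \notin ns -> uniq ns ->
  fire_back a N Y' rg pd j w e x ns.
Proof.
move=> g fi xA fA xN fN xn un; elim: g j Y' fi xN fN => {a N Y rg pd}.
- by move=> a c j Y' fi; inversion fi.
- move=> a n f P wP j Y' + xN fN; rewrite tr_act /=.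
  case ta: (t a) => [b|]; last first.
    case: ifP => _ fi; last by inversion fi.
    apply: Or31; case/(@fire_comp_inv false): fi => [] [k [B [_ /fire_prefix_inv[_ _ _ [D -> /sr_const_inv[-> _]]] ->]]].
      by left.
    by right.
  case: ifP => hb fi; first by inversion fi.
  case/(@fire_comp_inv true): fi => [] [k [B [ej f1 ->]]]; last first.
    by case: (gadget_fire (gad_pend (a := a) _) (or_intror f1)); rewrite ta // => _ ->; apply: Or32; exists a;
      rewrite prefix_refl ta.
  have [en ef ei [B' -> sB]] := fire_prefix_inv f1; subst f.
  case: n en wP xN fN {f1} => [u|//] [ew] /andP[wu wP]; rewrite /= inE negb_or => /andP[xu xP] fN.
  have [Y1 [Y2 [z1 [z2 [eB ens s1 s2]]]]] := sr_spar_inv sB.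
  have [eY2 ez2] := sr_inj0 s2 (sr_act _ _ _); rewrite eY2 in eB; rewrite ez2 cats0 in ens.
  have {}s1 : sr (open_rec 0 x (tr (rcons a 1) P)) Y1 ns by rewrite ens.
  rewrite -tr_open // in s1.
  have fP : fresh (fv (open x P)) ns.
    apply/allP => y yn; apply/negP => /fv_open; rewrite inE => /orP[/eqP eyx|yP].
      by rewrite -eyx yn in xn.
    by have := allP fN _ yn; rewrite inE yP orbT.
  have [U sU gU] := G_strip_back s1 (wk_open 0 wP xA) fA fP un.
  apply: Or33; exists [::], u, b, (Diam U), (gl (rcons a 1) P), [:: mlab [::]].
  rewrite cats0 ej ei; split=> //.
  + by split=> // hb'; move: hb; rewrite hb' => /negbFE.
  + by constructor.
  + split=> //; rewrite gl_open in gU; rewrite eB.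
    by apply: (G_box (gad_pend (a := a) _) gU); rewrite ta.
- move=> a P Y M W rg pd pd0 gad gP IH j Y' fi xN fN.
  have gadF k V m : fire M k w e x V m \/ fire W k w e x V m ->
      exists a', [/\ prefix a a', t a' & w = mk a'].
    by case/(gadget_fire gad) => ta ->; exists a; rewrite prefix_refl.
  case/fire_comp_inv: fi => [] [k [Y1 [-> f1 ->]]]; last by apply: Or32; apply: gadF; right; exact: f1.
  case: (fire_wrap_inv f1) => [[l [Y2 [-> f2 ->]]]|[l [V [_ f2 _]]]];
    last by apply: Or32; apply: gadF; left; exact: f2.
  case: (IH _ _ f2 xN fN) => [d|[a' [pa ta ew]]|[i [u [b [N1 [rg' [pd' [-> -> tb f3 [g1 p1 p2]]]]]]]]].
  + by apply: Or31; left; left.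
  + by apply: Or32; exists a'; split=> //; apply: prefix_rcons_trans pa.
  + apply: Or33; exists (1 :: i), u, b, (Diam N1), rg', (pd0 ++ lift [:: 1; 1; 1] pd').
    rewrite -cat_rcons; split=> //; first by constructor.
    split=> //; first exact: G_box.
    exact: (perm_catr _ (perm_lift [:: 1; 1; 1] (c := [:: _]) p2)).
- move=> a s P Q Y Z rg pd rg1 pd1 gP IP gQ IQ j Y' fi.
  rewrite fv_comp mem_cat negb_or fresh_cat => /andP[xP xQ] /andP[fP fQ].
  case/fire_comp_inv: fi => [] [k [Y1 [-> f1 ->]]].
    case: (fire_wrap_inv f1) => [[l [Y2 [-> f2 ->]]]|[l [V [_ f2 _]]]]; last by inversion f2.
    case: (IP _ _ f2 xP fP) => [d|[a' [pa ta ew]]|[i [u [b [N1 [rg' [pd' [-> -> tb f3 [g1 p1 p2]]]]]]]]].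
    * by apply: Or31; apply: dead_comp; left; left.
    * by apply: Or32; exists a'; split=> //; apply: prefix_rcons_trans pa.
    * apply: Or33; exists (1 :: i), u, b, (comp s N1 Q), (rg' ++ rg1), (lift [:: 1; 1; 1] pd' ++ lift [:: 2] pd1).
      rewrite -cat_rcons; split=> //; first exact: fire_left.
      split; [exact: G_comp | exact: (perm_catl (c := [:: _])) |].
      exact: (perm_catl _ (perm_lift [:: 1; 1; 1] (c := [:: _]) p2)).
  case: (IQ _ _ f1 xQ fQ) => [d|[a' [pa ta ew]]|[i [u [b [N1 [rg' [pd' [-> -> tb f3 [g1 p1 p2]]]]]]]]].
  * by apply: Or31; apply: dead_comp; right.
  * by apply: Or32; exists a'; split=> //; apply: prefix_rcons_trans pa.
  * apply: Or33; exists (2 :: i), u, b, (comp s P N1), (rg ++ rg'), (lift [:: 1; 1; 1] pd ++ lift [:: 2] pd').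
    rewrite -cat_rcons; split=> //; first exact: fire_right.
    split; [exact: G_comp | exact: (perm_catr (c := [:: _])) |].
    exact: (perm_catr _ (perm_lift [:: 2] (c := [:: _]) p2)).
Qed.

(* The guess realised at address [p] by a synchronisation with address [q]. *)
Definition gdl p q := (p, free p && own q).

Lemma G_ust a N Y rg pd i k x N' ns : G a N Y rg pd -> ust N i k x N' ns ->
  x \notin A0 -> fresh A0 ns -> t (a ++ i) = Some (free (a ++ i) && own (a ++ k)) ->
  t (a ++ k) = Some (free (a ++ k) && own (a ++ i)) ->
  exists Y' rg' pd', [/\ ust Y (fpos i) (fpos k) x Y' ns, G a N' Y' rg' pd',
    perm_eq rg [:: gdl (a ++ i) (a ++ k), gdl (a ++ k) (a ++ i) & rg'] &
    perm_eq pd' [:: mlab i, mlab k & pd]].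
Proof.
move=> g us xA fA; elim: g i k N' us => {a N Y rg pd}.
- by move=> a c i k N' us; inversion us.
- by move=> a n f P w i k N' us; inversion us.
- move=> a P Y M W rg pd pd0 gad _ IH i k N' /ust_diam_inv[j [l [P' [-> -> u ->]]]].
  rewrite -!cat_rcons => ti tk; have [Y' [rg' [pd' [u' g' pr pe]]]] := IH _ _ _ u ti tk.
  exists (comp true (wrap Y' M) W), rg', (pd0 ++ lift [:: 1; 1; 1] pd'); split=> //.
  + by apply: ust_left; apply: ust_wrap.
  + exact: G_box.
  + exact: (perm_catr _ (perm_lift [:: 1; 1; 1] (c := [:: _; _]) pe)).
- move=> a s P Q Y Z rg pd rg1 pd1 gP IP gQ IQ i k N' /ust_comp_inv[[j [l [P' [-> -> u ->]]]]|[j [l [P' [-> -> u ->]]]]|].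
  + rewrite -!cat_rcons => ti tk; have [Y' [rg' [pd' [u' g' pr pe]]]] := IP _ _ _ u ti tk.
    exists (comp s (wrap Y' (Const 1%R)) Z), (rg' ++ rg1), (lift [:: 1; 1; 1] pd' ++ lift [:: 2] pd1); split=> //.
    * by apply: ust_left; apply: ust_wrap.
    * exact: G_comp.
    * exact: (perm_catl (c := [:: _; _])).
    * exact: (perm_catl _ (perm_lift [:: 1; 1; 1] (c := [:: _; _]) pe)).
  + rewrite -!cat_rcons => ti tk; have [Z' [rg' [pd' [u' g' pr pe]]]] := IQ _ _ _ u ti tk.
    exists (comp s (wrap Y (Const 1%R)) Z'), (rg ++ rg'), (lift [:: 1; 1; 1] pd ++ lift [:: 2] pd'); split=> //.
    * exact: ust_right.
    * exact: G_comp.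
    * exact: (perm_catr (c := [:: _; _])).
    * exact: (perm_catr _ (perm_lift [:: 2] (c := [:: _; _]) pe)).
  + case=> [j [l [u [e [P' [Q' [n1 [n2 [es [-> ->] fP fQ [-> ens]]]]]]]]]]; have {}es : s = true by []; subst s ns.
    move: fA; rewrite fresh_catl -!cat_rcons => /andP[fA1 fA2] ti tk.
    have h1 : free (rcons a 1 ++ j) && own (rcons a 2 ++ l) -> free (rcons a 1 ++ j) by case/andP.
    have h2 : free (rcons a 2 ++ l) && own (rcons a 1 ++ j) -> free (rcons a 2 ++ l) by case/andP.
    have [Y' [rg' [pd' [f1 g1 pr1 pe1]]]] := G_fire gP fP xA fA1 ti h1.
    have [Z' [rg2 [pd2 [f2 g2 pr2 pe2]]]] := G_fire gQ fQ xA fA2 tk h2.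
    rewrite -(pf_sync e (G_subj gP fP) (G_subj gQ fQ)) in f2.
    exists (comp true (wrap Y' (Const 1%R)) Z'), (rg' ++ rg2), (lift [:: 1; 1; 1] pd' ++ lift [:: 2] pd2); split.
    * exact: us_comm (fire_wrap _ f1) f2.
    * exact: G_comp.
    * exact: perm_cons2.
    * exact: (perm_cons2 (perm_lift [:: 1; 1; 1] (c := [:: _]) pe1) (perm_lift [:: 2] (c := [:: _]) pe2)).
Qed.

Definition ust_back a N Y' rg pd j l x ns :=
  [\/ dead Y', exists pd', perm_eq pd ((j, l) :: pd') /\ G a N Y' rg pd'
    | exists i k N' rg', exists pd', [/\ j = fpos i /\ l = fpos k,
      t (a ++ i) = Some (free (a ++ i) && own (a ++ k)) /\
      t (a ++ k) = Some (free (a ++ k) && own (a ++ i)), ust N i k x N' ns &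
      [/\ G a N' Y' rg' pd',
        perm_eq rg [:: gdl (a ++ i) (a ++ k), gdl (a ++ k) (a ++ i) & rg'] &
        perm_eq pd' [:: mlab i, mlab k & pd]]]].

Lemma mk_neq_below a a' d : prefix (rcons a d) a' -> mk a' <> mk a.
Proof. by move=> pa /mk_inj ea; move: pa; rewrite ea => /size_prefix; rewrite size_rcons ltnn. Qed.

Lemma mk_neq_sibling a a1 a2 : prefix (rcons a 1) a1 -> prefix (rcons a 2) a2 -> mk a1 <> mk a2.
Proof.
move=> p1 p2 /mk_inj ea; move: p1 p2; rewrite ea !prefixE !size_rcons => /eqP-> /eqP.
by move/rcons_inj => [].
Qed.

(** A test name belongs to a single address and is never a face, so halves of different kinds or of
    different nodes do not meet. Two genuine halves meet only if their guesses fit, by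
    [pf_match]. *)
Lemma G_ust_back a N Y rg pd j l x Y' ns : G a N Y rg pd -> ust Y j l x Y' ns ->
  x \notin A0 -> fresh A0 ns -> x \notin fv N -> fresh (fv N) ns -> x \notin ns -> uniq ns ->
  ust_back a N Y' rg pd j l x ns.
Proof.
move=> g us xA fA xN fN xn un; elim: g j l Y' us xN fN => {a N Y rg pd}.
- by move=> a c j l Y' /ust_const_inv.
- move=> a n f P wP j l Y' + xN fN; rewrite tr_act /=.
  case ta: (t a) => [b|]; case: ifP => _; try by move/ust_const_inv.
    have gad := gad_pend (a := a) (etrans (congr1 isSome ta) erefl).
    case/(@ust_comp_inv true) => [[? [? [? [_ _ /ust_act_inv //]]]]|[? [? [V [_ _ u ->]]]]|].
      by apply: Or31; right; case: (gadget_ustW gad u).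
    case=> [? [? [v [g [? [? [? [? [_ _ f1 f2 _]]]]]]]]].
    have [en _ _ _] := fire_prefix_inv f1; have [_ ev] := gadget_fire gad (or_intror f2).
    case: n en wP {f1 xN fN} => // u [ep] /andP[wu _].
    by case: (@pf_mk a u f b a v); rewrite ?ta // -ep.
  by case/(@ust_comp_inv false) => [[? [? [? [_ _ /ust_act_inv //]]]]|[? [? [? [_ _ /ust_act_inv //]]]]|[? [? [? [? [? [? [? [? []]]]]]]]]].
- move=> a P Y M W rg pd pd0 gad gP IH j l Y' us xN fN.
  case/ust_comp_inv: us => [[j1 [l1 [Y1 [-> -> u1 ->]]]]|[j1 [l1 [Y1 [_ _ u1 ->]]]]|].
  + case: (ust_wrap_inv u1) => [[j2 [l2 [Y2 [-> -> u2 ->]]]]|[? [? [? /(gadget_ustM gad) //]]]].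
    case: (IH _ _ _ u2 xN fN) => [d|[pd' [pe g']]|[i [k [N1 [rg' [pd' [[-> ->] tt u3 [g1 p1 p2]]]]]]]].
    * by apply: Or31; left; left.
    * apply: Or32; exists (pd0 ++ lift [:: 1; 1; 1] pd'); split; last exact: G_box.
      exact: (perm_catr _ (perm_lift [:: 1; 1; 1] (c := [:: _]) pe)).
    * apply: Or33; exists (1 :: i), (1 :: k), (Diam N1), rg', (pd0 ++ lift [:: 1; 1; 1] pd').
      rewrite -!cat_rcons; split=> //; first by constructor.
      split=> //; first exact: G_box.
      exact: (perm_catr _ (perm_lift [:: 1; 1; 1] (c := [:: _; _]) p2)).
  + by apply: Or31; right; case: (gadget_ustW gad u1).
  + case=> [j1 [l1 [v [e [Y1 [Z1 [n1 [n2 [_ [-> ->] f1 f2 [-> ens]]]]]]]]]]; subst ns.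
    case: (fire_wrap_inv f1) => [[k [Y2 [_ f3 ->]]]|[k [M1 [-> f3 ->]]]]; last first.
      case: (gadget_comm gad f3 f2) => [d|[-> gad' _]]; first by apply: Or31; right.
      apply: Or32; exists (lift [:: 1; 1; 1] pd); split=> //; exact: (G_box gad' gP).
    have [ta ev] := gadget_fire gad (or_intror f2).
    move: fA fN un xn; rewrite !fresh_catl cat_uniq mem_cat negb_or.
    move=> /andP[fA _] /andP[fN _] /and3P[un _ _] /andP[xn _].
    case: (G_fire_back gP f3 xA fA xN fN xn un) => [d|[a' [pa _ ea]]|].
    * by apply: Or31; left; left.
    * by case: (mk_neq_below pa); rewrite -ea.
    * case=> i [u [b [N1 [rg' [pd' [_ ew _ f4 _]]]]]].
      by case: (pf_mk (G_subj gP f4) ta ew ev).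
- move=> a s P Q Y Z rg pd rg1 pd1 gP IP gQ IQ j l Y' us.
  rewrite fv_comp mem_cat negb_or fresh_cat => /andP[xP xQ] /andP[fP fQ].
  case/ust_comp_inv: us => [[j1 [l1 [Y1 [-> -> u1 ->]]]]|[j1 [l1 [Y1 [-> -> u1 ->]]]]|].
  + case: (ust_wrap_inv u1) => [[j2 [l2 [Y2 [-> -> u2 ->]]]]|[? [? [? /ust_const_inv //]]]].
    case: (IP _ _ _ u2 xP fP) => [d|[pd' [pe g']]|[i [k [N1 [rg' [pd' [[-> ->] tt u3 [g1 p1 p2]]]]]]]].
    * by apply: Or31; apply: dead_comp; left; left.
    * apply: Or32; exists (lift [:: 1; 1; 1] pd' ++ lift [:: 2] pd1); split; last exact: G_comp.
      exact: (perm_catl _ (perm_lift [:: 1; 1; 1] (c := [:: _]) pe)).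
    * apply: Or33; exists (1 :: i), (1 :: k), (comp s N1 Q), (rg' ++ rg1), (lift [:: 1; 1; 1] pd' ++ lift [:: 2] pd1).
      rewrite -!cat_rcons; split=> //; first exact: ust_left.
      split; [exact: G_comp | exact: (perm_catl (c := [:: _; _])) |].
      exact: (perm_catl _ (perm_lift [:: 1; 1; 1] (c := [:: _; _]) p2)).
  + case: (IQ _ _ _ u1 xQ fQ) => [d|[pd' [pe g']]|[i [k [N1 [rg' [pd' [[-> ->] tt u3 [g1 p1 p2]]]]]]]].
    * by apply: Or31; apply: dead_comp; right.
    * apply: Or32; exists (lift [:: 1; 1; 1] pd ++ lift [:: 2] pd'); split; last exact: G_comp.
      exact: (perm_catr _ (perm_lift [:: 2] (c := [:: _]) pe)).
    * apply: Or33; exists (2 :: i), (2 :: k), (comp s P N1), (rg ++ rg'), (lift [:: 1; 1; 1] pd ++ lift [:: 2] pd').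
      rewrite -!cat_rcons; split=> //; first exact: ust_right.
      split; [exact: G_comp | exact: (perm_catr (c := [:: _; _])) |].
      exact: (perm_catr _ (perm_lift [:: 2] (c := [:: _; _]) p2)).
  + case=> [j1 [l1 [v [e [Y1 [Z1 [n1 [n2 [es [-> ->] f1 f2 [-> ens]]]]]]]]]]; have {}es : s = true by []; subst s ns.
    case: (fire_wrap_inv f1) => [[j2 [Y2 [-> f3 ->]]]|[k [M1 [_ f3 _]]]]; last by inversion f3.
    move: fA fP fQ un xn; rewrite !fresh_catl cat_uniq mem_cat negb_or.
    move=> /andP[fA1 fA2] /andP[fP1 _] /andP[_ fQ2] /and3P[un1 _ un2] /andP[xn1 xn2].
    have b1 := G_fire_back gP f3 xA fA1 xP fP1 xn1 un1.
    have b2 := G_fire_back gQ f2 xA fA2 xQ fQ2 xn2 un2.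
    case: b1 => [d|[a1 [pa1 ta1 ev1]]|[i [u [b [N1 [rg' [pd' [-> ev1 [ti hi] fi [g1 pr1 pe1]]]]]]]]];
    case: b2 => [d'|[a2 [pa2 ta2 ev2]]|[k [u' [b' [N2 [rg2 [pd2 [-> ev2 [tk hk] fk [g2 pr2 pe2]]]]]]]]];
    try by [apply: Or31; left; left | apply: Or31; right].
    * by case: (mk_neq_sibling pa1 pa2); rewrite -ev1.
    * by case: (pf_mk (G_subj gQ fk) ta1 ev2 ev1).
    * by case: (pf_mk (G_subj gP fi) ta2 ev1 ev2).
    have [eu eb eb'] : [/\ u = u', b = free (rcons a 1 ++ i) && own (rcons a 2 ++ k)
        & b' = free (rcons a 2 ++ k) && own (rcons a 1 ++ i)].
      exact: pf_match (G_subj gP fi) (G_subj gQ fk) hi hk (etrans (esym ev1) ev2).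
    subst u'; apply: Or33; exists (1 :: i), (2 :: k), (Par N1 N2), (rg' ++ rg2),
      (lift [:: 1; 1; 1] pd' ++ lift [:: 2] pd2).
    rewrite -!cat_rcons; split=> //.
    * by rewrite ti tk -eb -eb'.
    * exact: us_comm fi fk.
    * split; first exact: (G_comp true g1 g2).
        by apply: perm_cons2; rewrite /gdl -?eb -?eb'.
      exact: (perm_cons2 (perm_lift [:: 1; 1; 1] (c := [:: _]) pe1) (perm_lift [:: 2] (c := [:: _]) pe2)).
Qed.

Lemma lift_mem s y pd : y \in lift s pd -> exists2 z, z \in pd & y = (s ++ z.1, s ++ z.2).
Proof. by case/mapP => z zpd ->; exists z. Qed.

(** Both halves of a pending test stay available whatever the rest of the term has done. The test
    creates [x] but uncovers no hiding, hence the empty list. *)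
Lemma G_flush a N Y rg pd y x : G a N Y rg pd -> y \in pd ->
  exists Y' pd', [/\ ust Y y.1 y.2 x Y' [::], G a N Y' rg pd' & perm_eq pd (y :: pd')].
Proof.
move=> g; elim: g y => {a N Y rg pd} //.
- move=> a P Y M W rg pd pd0 gad gP IH y; rewrite mem_cat => /orP[yp|/lift_mem[z /IH[Y' [pd' [u g' pe]]] ->]].
    case: gad yp => // ta; rewrite inE => /eqP->.
    exists (comp true (wrap Y mdone) (Par mdone (mzero a))), (lift [:: 1; 1; 1] pd); split=> //.
      rewrite -[[::]]/([::] ++ [::]); apply: us_comm.
        by apply: fi_diam; apply: fi_sparR; apply: fi_act; constructor.
      by apply: fi_parL; apply: fi_act; constructor.
    exact: (G_box (gad_done ta) gP).
  exists (comp true (wrap Y' M) W), (pd0 ++ lift [:: 1; 1; 1] pd'); split.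
  + by apply: ust_left; apply: ust_wrap.
  + exact: G_box.
  + exact: (perm_catr _ (perm_lift [:: 1; 1; 1] (c := [:: _]) pe)).
- move=> a s P Q Y Z rg pd rg1 pd1 gP IP gQ IQ y; rewrite mem_cat => /orP[]/lift_mem[z zp ->].
    have [Y' [pd' [u g' pe]]] := IP _ zp.
    exists (comp s (wrap Y' (Const 1%R)) Z), (lift [:: 1; 1; 1] pd' ++ lift [:: 2] pd1); split.
    + by apply: ust_left; apply: ust_wrap.
    + exact: G_comp.
    + exact: (perm_catl _ (perm_lift [:: 1; 1; 1] (c := [:: _]) pe)).
  have [Z' [pd' [u g' pe]]] := IQ _ zp.
  exists (comp s (wrap Y (Const 1%R)) Z'), (lift [:: 1; 1; 1] pd ++ lift [:: 2] pd'); split.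
  + exact: ust_right.
  + exact: G_comp.
  + exact: (perm_catr _ (perm_lift [:: 2] (c := [:: _]) pe)).
Qed.

(** * When the translation halts *)

Definition can_step Y := exists j l, forall x, exists Y' ns, ust Y j l x Y' ns.

Lemma can_step_wrap s Y M Z : can_step Y -> can_step (comp s (wrap Y M) Z).
Proof.
case=> j [l h]; exists [:: 1, 1, 1 & j], [:: 1, 1, 1 & l] => x; have [Y' [ns u]] := h x.
by exists (comp s (wrap Y' M) Z), ns; apply: ust_left; apply: ust_wrap.
Qed.

Lemma can_step_right s Y Z : can_step Z -> can_step (comp s Y Z).
Proof.
case=> j [l h]; exists (2 :: j), (2 :: l) => x; have [Z' [ns u]] := h x.
by exists (comp s Y Z'), ns; apply: ust_right.
Qed.

(** An unrealised guess keeps its [mminus] and [mzero] able to synchronise, or the term is already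
    dead. Hence a translation that halts without being dead has realised all its guesses. *)
Lemma G_progress a N Y rg pd : G a N Y rg pd -> [\/ dead Y, rg = [::] | can_step Y].
Proof.
elim=> {a N Y rg pd}.
- by move=> a c; apply: Or32.
- move=> a n e P _; rewrite tr_act /=; case: (t a) => [b|] /=.
    case: ifP => _; first by apply: Or31.
    apply: Or33; exists [:: 2; 1], [:: 2; 2] => x.
    do 2 eexists; apply: us_parR; apply: us_comm.
      by apply: fi_act; constructor.
    by apply: fi_act; constructor.
  by case: eqP => [->|_]; [apply: Or32 | apply: Or31].
- move=> a P Y M W rg pd pd0 _ _ [d|er|c]; [by apply: Or31; left; left | by apply: Or32 | apply: Or33].
  exact: can_step_wrap.
- move=> a s P Q Y Z rg pd rg1 pd1 _ [d _ _|-> _|c _ _]; [by apply: Or31; apply: dead_comp; left; left | | ].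
    case=> [d|->|c]; [by apply: Or31; apply: dead_comp; right | by apply: Or32 | apply: Or33].
    exact: can_step_right.
  by apply: Or33; apply: can_step_wrap.
Qed.

(** Quantified over the created name, so that two such actions can be synchronised on a common
    one. *)
Definition can_fire Y w e := exists j, forall y, exists Y' ns, fire Y j w e y Y' ns.

Lemma can_fire_wrap Y M w e : can_fire Y w e -> can_fire (wrap Y M) w e.
Proof.
by case=> j h; exists [:: 1, 1 & j] => y; have [Y' [ns u]] := h y; exists (wrap Y' M), ns; apply: fire_wrap.
Qed.

Lemma can_fire_left s Y Z w e : can_fire Y w e -> can_fire (comp s Y Z) w e.
Proof.
by case=> j h; exists (1 :: j) => y; have [Y' [ns u]] := h y; exists (comp s Y' Z), ns; apply: fire_left.
Qed.

Lemma can_fire_right s Y Z w e : can_fire Z w e -> can_fire (comp s Y Z) w e.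
Proof.
by case=> j h; exists (2 :: j) => y; have [Z' [ns u]] := h y; exists (comp s Y Z'), ns; apply: fire_right.
Qed.

Lemma can_step_comm Y Z w e : can_fire Y w e -> can_fire Z w (~~ e) -> can_step (Par Y Z).
Proof.
move=> [j hj] [l hl]; exists (1 :: j), (2 :: l) => x.
have [Y' [ns f1]] := hj x; have [Z' [ms f2]] := hl x.
by exists (Par Y' Z'), (ns ++ ms); apply: us_comm f1 f2.
Qed.

Lemma cat_nil (X : Type) (s r : seq X) : s ++ r = [::] -> s = [::] /\ r = [::].
Proof. by case: s. Qed.

Lemma lift_nil s pd : lift s pd = [::] -> pd = [::].
Proof. by case: pd. Qed.

(** Once every guess is realised, the active actions are those guessed not to fire, and they offer
    both faces; a synchronisation still possible in the source therefore prevents the translation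
    from halting. *)
Lemma G_final_fire a N Y rg pd i u e x N' ns b : G a N Y rg pd -> rg = [::] ->
  fire N i u e x N' ns -> can_fire Y (pf (a ++ i) u e b) e.
Proof.
move=> g; elim: g i N' => {a N Y rg pd}.
- by move=> a c i N' _ fi; inversion fi.
- move=> a n f P _ i N' + fi; have [-> ef -> _] := fire_prefix_inv fi; subst f.
  rewrite tr_act cats0 /=; case: (t a) => [//|] /= ->; rewrite eqxx.
  by exists (if b then [:: 2] else [:: 1]) => y;
    case: b => /=; do 2 eexists; [apply: fi_sparR | apply: fi_sparL]; apply: fi_act; constructor.
- move=> a P Y M W rg pd pd0 _ _ IH i N' er /fire_diam_inv[j [P' [-> f _]]]; rewrite -cat_rcons.
  by apply: can_fire_left; apply: can_fire_wrap; apply: IH f.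
- move=> a s P Q Y Z rg pd rg1 pd1 _ IP _ IQ i N' /cat_nil[er1 er2] /fire_comp_inv[] [j [P' [-> f _]]];
    rewrite -cat_rcons.
    by apply: can_fire_left; apply: can_fire_wrap; apply: IP f.
  by apply: can_fire_right; apply: IQ f.
Qed.

Lemma G_final_ust a N Y rg pd i k x N' ns : G a N Y rg pd -> rg = [::] -> ust N i k x N' ns -> can_step Y.
Proof.
move=> g; elim: g i k N' ns => {a N Y rg pd}.
- by move=> a c i k N' ns _ /ust_const_inv.
- by move=> a n f P _ i k N' ns _ /ust_act_inv.
- move=> a P Y M W rg pd pd0 _ _ IH i k N' ns er /ust_diam_inv[j [l [P' [_ _ u _]]]].
  by apply: can_step_wrap; apply: IH u.
- move=> a s P Q Y Z rg pd rg1 pd1 gP IP gQ IQ i k N' ns /cat_nil[er1 er2].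
  case/ust_comp_inv => [[j [l [P' [_ _ u _]]]]|[j [l [P' [_ _ u _]]]]|].
  + by apply: can_step_wrap; apply: IP u.
  + by apply: can_step_right; apply: IQ u.
  + case=> [j [l [v [e [P' [Q' [n1 [n2 [-> _ f1 f2 _]]]]]]]]].
    have h1 := G_final_fire (free (rcons a 1 ++ j) && own (rcons a 2 ++ l)) gP er1 f1.
    have h2 := G_final_fire (free (rcons a 2 ++ l) && own (rcons a 1 ++ j)) gQ er2 f2.
    apply: can_step_comm (can_fire_wrap _ h1) _.
    by rewrite (pf_sync e (G_subj gP f1) (G_subj gQ f2)).
Qed.

Lemma G_final_fire_back a N Y rg pd j w e x Y' ns : G a N Y rg pd -> rg = [::] ->
  fire Y j w e x Y' ns -> (exists a', [/\ prefix a a', t a' & w = mk a']) \/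
  exists i u b N' ns', [/\ fire N i u e x N' ns', w = pf (a ++ i) u e b & b -> free (a ++ i)].
Proof.
move=> g; elim: g j Y' => {a N Y rg pd}.
- by move=> a c j Y' _ fi; inversion fi.
- move=> a n f P _ j Y'; rewrite tr_act /=; case: (t a) => [//|] /= ->; rewrite eqxx => fi.
  have [b [en ef]] : exists b, pfn a n f b = F w /\ f = e.
    case/(@fire_comp_inv false): fi => [] [k [B [_ /fire_prefix_inv[? ? _ _] _]]]; by [exists false|exists true].
  case: n en {fi} => // u [ew]; subst f; right.
  have [B [ms [sB _ _]]] := sr_ex (open x P) [::].
  exists [::], u, (b && free a), (Diam B), ms; rewrite cats0; split; first by constructor.
    by rewrite -ew /pf; case: (free a); rewrite ?andbT.
  by case/andP.
- move=> a P Y M W rg pd pd0 gad _ IH j Y' er fi.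
  have gadF k V m : fire M k w e x V m \/ fire W k w e x V m ->
      exists a', [/\ prefix a a', t a' & w = mk a'].
    by case/(gadget_fire gad) => ta ->; exists a; rewrite prefix_refl.
  case/fire_comp_inv: fi => [] [k [Y1 [_ f1 _]]]; last by left; apply: gadF; right; exact: f1.
  case: (fire_wrap_inv f1) => [[l [Y2 [_ f2 _]]]|[l [V [_ f2 _]]]]; last by left; apply: gadF; left; exact: f2.
  case: (IH _ _ er f2) => [[a' [pa ta ew]]|[i [u [b [N1 [ns1 [f3 ew hb]]]]]]].
    by left; exists a'; split=> //; apply: prefix_rcons_trans pa.
  right; exists (1 :: i), u, b, (Diam N1), ns1; rewrite -cat_rcons; split=> //; by constructor.
- move=> a s P Q Y Z rg pd rg1 pd1 gP IP gQ IQ j Y' /cat_nil[er1 er2].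
  case/fire_comp_inv => [] [k [Y1 [_ f1 _]]].
    case: (fire_wrap_inv f1) => [[l [Y2 [_ f2 _]]]|[l [V [_ f2 _]]]]; last by inversion f2.
    case: (IP _ _ er1 f2) => [[a' [pa ta ew]]|[i [u [b [N1 [ns1 [f3 ew hb]]]]]]].
      by left; exists a'; split=> //; apply: prefix_rcons_trans pa.
    by right; exists (1 :: i), u, b, (comp s N1 Q), ns1; rewrite -cat_rcons; split=> //; apply: fire_left.
  case: (IQ _ _ er2 f1) => [[a' [pa ta ew]]|[i [u [b [N1 [ns1 [f3 ew hb]]]]]]].
    by left; exists a'; split=> //; apply: prefix_rcons_trans pa.
  by right; exists (2 :: i), u, b, (comp s P N1), ns1; rewrite -cat_rcons; split=> //; apply: fire_right.
Qed.

Lemma G_final_ust_back a N Y rg pd j l x Y' ns : G a N Y rg pd -> rg = [::] -> pd = [::] ->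
  ust Y j l x Y' ns -> exists i k N' ns', ust N i k x N' ns'.
Proof.
move=> g; elim: g j l Y' ns => {a N Y rg pd}.
- by move=> a c j l Y' ns _ _ /ust_const_inv.
- move=> a n f P _ j l Y' ns; rewrite tr_act /=; case: (t a) => [//|] /= -> _; rewrite eqxx.
  by case/(@ust_comp_inv false) => [[? [? [? [_ _ /ust_act_inv //]]]]|[? [? [? [_ _ /ust_act_inv //]]]]|[? [? [? [? [? [? [? [? []]]]]]]]]].
- move=> a P Y M W rg pd pd0 gad gP IH j l Y' ns er /cat_nil[ep0 /lift_nil ep].
  case/ust_comp_inv => [[? [? [? [_ _ u1 _]]]]|[? [? [? [_ _ u1 _]]]]|].
  + case: (ust_wrap_inv u1) => [[? [? [? [_ _ u2 _]]]]|[? [? [? /(gadget_ustM gad) //]]]].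
    have [i [k [N1 [ns1 u3]]]] := IH _ _ _ _ er ep u2.
    by exists (1 :: i), (1 :: k), (Diam N1), ns1; constructor.
  + by case: (gadget_ustW gad u1).
  + case=> [j1 [l1 [v [e [Y1 [Z1 [n1 [n2 [_ _ f1 f2 _]]]]]]]]].
    have [ta ev] := gadget_fire gad (or_intror f2).
    case: (fire_wrap_inv f1) => [[k [Y2 [_ f3 _]]]|[k [M1 [_ f3 _]]]]; last first.
      by case: gad ep0 f3 {f1 f2} => // [_ f3|_ _ /mdone_fire //]; inversion f3.
    case: (G_final_fire_back gP er f3) => [[a' [pa _ ea]]|[i [u [b [N1 [ns1 [f4 ew _]]]]]]].
      by case: (mk_neq_below pa); rewrite -ea.
    by case: (pf_mk (G_subj gP f4) ta ew ev).
- move=> a s P Q Y Z rg pd rg1 pd1 gP IP gQ IQ j l Y' ns /cat_nil[er1 er2] /cat_nil[/lift_nil ep1 /lift_nil ep2].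
  case/ust_comp_inv => [[? [? [? [_ _ u1 _]]]]|[? [? [? [_ _ u1 _]]]]|].
  + case: (ust_wrap_inv u1) => [[? [? [? [_ _ u2 _]]]]|[? [? [? /ust_const_inv //]]]].
    have [i [k [N1 [ns1 u3]]]] := IP _ _ _ _ er1 ep1 u2.
    by exists (1 :: i), (1 :: k), (comp s N1 Q), ns1; apply: ust_left.
  + have [i [k [N1 [ns1 u3]]]] := IQ _ _ _ _ er2 ep2 u1.
    by exists (2 :: i), (2 :: k), (comp s P N1), ns1; apply: ust_right.
  + case=> [j1 [l1 [v [e [Y1 [Z1 [n1 [n2 [es _ f1 f2 _]]]]]]]]]; rewrite es.
    case: (fire_wrap_inv f1) => [[k [Y2 [_ f3 _]]]|[k [M1 [_ f3 _]]]]; last by inversion f3.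
    case: (G_final_fire_back gP er1 f3) => [[a1 [pa1 ta1 ev1]]|[i [u [b [N1 [ns1 [f4 ev1 hi]]]]]]];
    case: (G_final_fire_back gQ er2 f2) => [[a2 [pa2 ta2 ev2]]|[l' [u' [b' [N2 [ns2 [f5 ev2 hk]]]]]]].
    * by case: (mk_neq_sibling pa1 pa2); rewrite -ev1.
    * by case: (pf_mk (G_subj gQ f5) ta1 ev2 ev1).
    * by case: (pf_mk (G_subj gP f4) ta2 ev1 ev2).
    have [eu _ _] := pf_match (G_subj gP f4) (G_subj gQ f5) hi hk (etrans (esym ev1) ev2).
    subst u'; exists (1 :: i), (2 :: l'), (Par N1 N2), (ns1 ++ ns2); exact: us_comm f4 f5.
Qed.

Lemma G_state a N Y rg pd : G a N Y rg pd -> rg = [::] -> state N = state Y.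
Proof.
elim=> {a N Y rg pd} //.
- move=> a n e P _; rewrite tr_act /=; case: (t a) => [//|] /= ->; by rewrite /= mulr1.
- by move=> a P Y M W rg pd pd0 [|_|_] _ IH /IH /= ->; rewrite !mulr1.
- by move=> a s P Q Y Z rg pd rg1 pd1 _ IP _ IQ /cat_nil[/IP e1 /IQ e2]; rewrite !state_comp e1 e2 /= mulr1.
Qed.

Lemma lc_tr n a T : lc_at n T -> lc_at n (tr a T).
Proof.
have pfn_lc m (k : nat) b b' a0 : (if m is B i then i < k else true) -> if pfn a0 m b b' is B i then i < k else true.
  by case: m.
elim: T n a => //= [m e P IP|P IP|P IP Q IQ|P IP Q IQ|P IP] n a; last by move/IP.
- case/andP=> hm /IP lP; case: (t a) => [b|]; case: ifP => //= _; rewrite !pfn_lc //=.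
  by rewrite lP.
- by move/IP->.
- by case/andP=> /IP-> /IQ->.
- by case/andP=> /IP-> /IQ->.
Qed.

(** * [P] without interaction with [R], observed by [S], against [P] beside the translation of
    [R|S] *)

Section System.
Variable adr : seq position.
Hypothesis own_R : forall i, own (1 :: i).
Hypothesis own_S : forall i, ~~ own (2 :: i).

Fixpoint addr a T : seq position := match T with
| Const _ => [::]
| Act _ _ P => a :: addr (rcons a 1) P
| Diam P => addr (rcons a 1) P
| Par P Q | SPar P Q => addr (rcons a 1) P ++ addr (rcons a 2) Q
| Nu P => addr a P end.

Lemma addr_open n x a T : addr a (open_rec n x T) = addr a T.
Proof. by elim: T n a => //= [m e P IP|P IP Q IQ|P IP Q IQ] n a; rewrite ?IP ?IQ. Qed.

Lemma addr_sr a T U zs : sr T U zs -> addr a U = addr a T.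
Proof.
move=> s; elim: s a => //= {T U zs} [P Q U V zs ws _ IP _ IQ|P Q U V zs ws _ IP _ IQ|z P U zs _ _ IP] a.
- by rewrite IP IQ.
- by rewrite IP IQ.
- by rewrite IP addr_open.
Qed.

Lemma fire_addr a N i u e x N' ns : fire N i u e x N' ns ->
  a ++ i \in addr a N /\ {subset addr a N' <= addr a N}.
Proof.
move=> f; elim: f a => //= {N i u e x N' ns}.
- move=> u e P x B ns sB a; rewrite cats0 mem_head (addr_sr _ sB) addr_open; split=> // w wP.
  by rewrite inE wP orbT.
- by move=> P i u e x P' ns _ IH a; rewrite -cat_rcons; apply: IH.
- move=> P Q i u e x P' ns _ IH a; rewrite -cat_rcons mem_cat; have [-> h] := IH (rcons a 1); split=> // w.
  by rewrite !mem_cat => /orP[/h->|->]; rewrite ?orbT.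
- move=> P Q i u e x P' ns _ IH a; rewrite -cat_rcons mem_cat; have [-> h] := IH (rcons a 2).
  rewrite orbT; split=> // w.
  by rewrite !mem_cat => /orP[->|/h->]; rewrite ?orbT.
- move=> P Q i u e x P' ns _ IH a; rewrite -cat_rcons mem_cat; have [-> h] := IH (rcons a 1); split=> // w.
  by rewrite !mem_cat => /orP[/h->|->]; rewrite ?orbT.
- move=> P Q i u e x P' ns _ IH a; rewrite -cat_rcons mem_cat; have [-> h] := IH (rcons a 2).
  rewrite orbT; split=> // w.
  by rewrite !mem_cat => /orP[->|/h->]; rewrite ?orbT.
Qed.

Lemma ust_addr a N i k x N' ns : ust N i k x N' ns ->
  [/\ a ++ i \in addr a N, a ++ k \in addr a N & {subset addr a N' <= addr a N}].
Proof.
move=> f; elim: f a => //= {N i k x N' ns}.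
- by move=> P i k x P' ns _ IH a; rewrite -!cat_rcons; apply: IH.
- move=> P Q i k x P' ns _ IH a; rewrite -!cat_rcons !mem_cat; have [-> -> h] := IH (rcons a 1); split=> // w.
  by rewrite !mem_cat => /orP[/h->|->]; rewrite ?orbT.
- move=> P Q i k x P' ns _ IH a; rewrite -!cat_rcons !mem_cat; have [-> -> h] := IH (rcons a 2).
  rewrite !orbT; split=> // w; by rewrite !mem_cat => /orP[->|/h->]; rewrite ?orbT.
- move=> P Q i k x P' ns _ IH a; rewrite -!cat_rcons !mem_cat; have [-> -> h] := IH (rcons a 1); split=> // w.
  by rewrite !mem_cat => /orP[/h->|->]; rewrite ?orbT.
- move=> P Q i k x P' ns _ IH a; rewrite -!cat_rcons !mem_cat; have [-> -> h] := IH (rcons a 2).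
  rewrite !orbT; split=> // w; by rewrite !mem_cat => /orP[->|/h->]; rewrite ?orbT.
- move=> P Q i k u e x P' Q' ns ms f1 f2 a; rewrite -!cat_rcons !mem_cat.
  have [-> h1] := fire_addr (rcons a 1) f1; have [-> h2] := fire_addr (rcons a 2) f2.
  rewrite !orbT; split=> // w; by rewrite !mem_cat => /orP[/h1->|/h2->]; rewrite ?orbT.
Qed.

(* Positions of [Par (SPar P R) S] as addresses in [Par R S], and their images
   in [Par P (tr [::] (Par R S))]; [psi] is a left inverse of [phi]. *)
Definition loc i : option position := match i with
| 1 :: 2 :: i => Some (1 :: i) | 2 :: i => Some (2 :: i) | _ => None end.
Definition phi i : position := match i with
| 1 :: 1 :: i => 1 :: i | 1 :: 2 :: i => 2 :: fpos (1 :: i) | 2 :: i => 2 :: fpos (2 :: i)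
| _ => [:: 1] end.
Fixpoint dec i : position := match i with
| [:: 1] => [::] | 1 :: 1 :: 1 :: i => 1 :: dec i | d :: i => d :: dec i | [::] => [::] end.
Definition psi i : position := match i with
| 1 :: i => [:: 1, 1 & i]
| 2 :: i => match dec i with 1 :: i => [:: 1, 2 & i] | i => i end | _ => i end.
(** A partner in [P] has no address and counts as lying outside of [R]. *)
Definition gd1 i k : seq (position * bool) :=
  if loc i is Some p then [:: (p, free p && if loc k is Some q then own q else false)] else [::].
Definition gd (y : position * position) := gd1 y.1 y.2 ++ gd1 y.2 y.1.
Definition ml1 i := if loc i is Some p then [:: mlab p] else [::].
Definition ml (y : position * position) := ml1 y.1 ++ ml1 y.2.

Lemma decK : cancel fpos dec.
Proof.
elim=> // d i IH; rewrite /fpos /spos /= /dig -/(spos i).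
case: eqP => [->|d1] /=; first by rewrite -/(fpos i) IH.
case: d d1 => [|[|d]] //= _; by rewrite -/(fpos i) IH.
Qed.

(** The conditions on names say that [P] meets copies and test names nowhere, and shares with [R]
    initial names only. They persist because a created name reaches its two partners alone. *)
Definition Sys A U V rg pd := exists X R S Y, [/\ U = Par (SPar X R) S, V = Par X Y,
  G [::] (Par R S) Y rg pd, {subset addr [::] (Par R S) <= adr} &
  [/\ {subset A0 <= A}, forall w, w \in fv X -> w \in A0 -> w < base
    & forall w, w \in fv X -> w \in fv R -> w < base]].

(** A transition of [P] is copied, one of [R|S] is translated, and one between [P] and [S] is
    translated on the side of [S] only. *)
Lemma Sys_fwd A U V rg pd i k x U' ns : Sys A U V rg pd -> {subset fv U <= A} ->
  newnames A x ns -> ust U i k x U' ns ->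
  (forall c, c \in gd (i, k) -> c.1 \in adr -> t c.1 = Some c.2) ->
  exists V' rg' pd', [/\ ust V (phi i) (phi k) x V' ns, Sys (x :: ns ++ A) U' V' rg' pd',
    perm_eq rg (gd (i, k) ++ rg'), perm_eq pd' (ml (i, k) ++ pd) &
    [/\ psi (phi i) = i, psi (phi k) = k & forall c, c \in gd (i, k) -> c.1 \in adr]].
Proof.
move=> [X [R [S [Y [-> -> g sub [A0A XA0 XR]]]]]] UA /andP[_ nA] us ok.
have xnA w : w \in x :: ns -> w \in A -> False.
  by move=> /(allP nA) /negP.
have XA w : w \in fv X -> w \in A by move=> wX; apply: UA; rewrite /= !mem_cat wX.
have RA w : w \in fv R -> w \in A by move=> wR; apply: UA; rewrite /= !mem_cat wR orbT.
have A0A' : {subset A0 <= x :: ns ++ A} by move=> w /A0A wA; rewrite inE mem_cat wA !orbT.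
have xA0 : x \notin A0 by apply/negP => /A0A; apply: xnA; exact: mem_head.
have nA0 : fresh A0 ns.
  by apply/allP => w wn; apply/negP => /A0A; apply: xnA; rewrite inE wn orbT.
have okX (X1 : term K) (ms : seq name) : {subset ms <= ns} -> {subset fv X1 <= x :: ms ++ fv X} ->
    (forall w, w \in fv X1 -> w \in A0 -> w < base) /\ (forall w, w \in fv X1 -> w \in fv R -> w < base).
  move=> msn h; split=> w /h; rewrite -cat_cons mem_cat => /orP[wn|wX] wA; try by [exact: XA0 | exact: XR].
    by case: (xnA w) => //; [move: wn; rewrite !inE => /orP[->//|/msn->]; rewrite orbT | exact: A0A].
  by case: (xnA w) => //; [move: wn; rewrite !inE => /orP[->//|/msn->]; rewrite orbT | exact: RA].
have okR (R1 : term K) (ms : seq name) : {subset ms <= ns} -> {subset fv R1 <= x :: ms ++ fv R} ->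
    forall w, w \in fv X -> w \in fv R1 -> w < base.
  move=> msn h w wX /h; rewrite -cat_cons mem_cat => /orP[wn|]; last exact: XR.
  by case: (xnA w) => //; [move: wn; rewrite !inE => /orP[->//|/msn->]; rewrite orbT | exact: XA].
have inner i1 k1 N1 R1 S1 : N1 = Par R1 S1 -> ust (Par R S) i1 k1 x N1 ns ->
    gd (i, k) = [:: gdl i1 k1; gdl k1 i1] -> ml (i, k) = [:: mlab i1; mlab k1] ->
    phi i = 2 :: fpos i1 -> phi k = 2 :: fpos k1 -> psi (phi i) = i -> psi (phi k) = k ->
    U' = Par (SPar X R1) S1 -> (forall w, w \in fv X -> w \in fv R1 -> w < base) ->
    exists V' rg' pd', [/\ ust (Par X Y) (phi i) (phi k) x V' ns, Sys (x :: ns ++ A) U' V' rg' pd',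
      perm_eq rg (gd (i, k) ++ rg'), perm_eq pd' (ml (i, k) ++ pd) &
      [/\ psi (phi i) = i, psi (phi k) = k & forall c, c \in gd (i, k) -> c.1 \in adr]].
  move=> eN u1 eg em ei ek pi pk eU XR1; have [ai ak asub] := ust_addr [::] u1.
  have iadr : i1 \in adr by apply: sub.
  have kadr : k1 \in adr by apply: sub.
  have ti : t i1 = Some (free i1 && own k1).
    by apply: (ok (gdl i1 k1)); rewrite ?eg ?mem_head.
  have tk : t k1 = Some (free k1 && own i1).
    by apply: (ok (gdl k1 i1)); rewrite ?eg ?inE ?eqxx ?orbT.
  have [Y1 [rg' [pd' [u2 g2 pr pe]]]] := G_ust g u1 xA0 nA0 ti tk.
  exists (Par X Y1), rg', pd'; split.
  - by rewrite ei ek; apply: us_parR.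
  - exists X, R1, S1, Y1; split=> //; first by rewrite -eN.
    by move=> w wN; apply: sub; apply: asub; rewrite eN.
  - by rewrite eg.
  - by rewrite em.
  - by split=> // c; rewrite eg !inE => /orP[]/eqP->.
inversion us as [|? ? ? ? ? ? ? u1|? ? i1 k1 ? S1 ? u1| | |? ? i1 k1 u e ? W S1 n1 n2 f1 f2]; subst.
- inversion u1 as [| | |? ? i1 k1 ? X1 ? u2|? ? i1 k1 ? R1 ? u2|]; subst.
    have [h1 h2] := okX X1 ns (fun w wn => wn) (ust_fv u2).
    exists (Par X1 Y), rg, pd; split=> //; first exact: us_parL.
    by exists X1, R, S, Y.
  apply: (inner (1 :: i1) (1 :: k1) (Par R1 S) R1 S) => //.
  + by constructor.
  + by rewrite /psi /phi decK.
  + by rewrite /psi /phi decK.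
  + exact: okR (ust_fv u2).
- apply: (inner (2 :: i1) (2 :: k1) (Par R S1) R S1) => //.
  + by apply: us_parR.
  + by rewrite /psi /phi decK.
  + by rewrite /psi /phi decK.
- inversion f1 as [| | | |? ? j1 ? ? ? X1 ? f3|? ? j1 ? ? ? R1 ? f3]; subst; last first.
    apply: (inner (1 :: j1) (2 :: k1) (Par R1 S1) R1 S1) => //.
    + by apply: us_comm f2.
    + by rewrite /psi /phi decK.
    + by rewrite /psi /phi decK.
    + apply: okR (fire_fv f3) => w wn; by rewrite mem_cat wn.
  have fN : fire (Par R S) (2 :: k1) u (~~ e) x (Par R S1) n2 by constructor.
  have [kadr asub] := fire_addr [::] fN; rewrite cat0s in kadr.
  have nS : own (2 :: k1) = false by apply/negbTE/own_S.
  have eg : gd ([:: 1, 1 & j1], 2 :: k1) = [:: (2 :: k1, false)] by rewrite /gd /gd1 /= andbF.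
  have tk : t (2 :: k1) = Some false.
    by apply: (ok (2 :: k1, false)); rewrite ?eg ?mem_head //; apply: sub.
  move: nA0; rewrite fresh_catl => /andP[_ nA02].
  (* The partner is in [P], so the guess realised by the action of [S] is [false], and the
     corresponding face is the subject itself. *)
  have [Y1 [rg' [pd' [f4 g4 pr pe]]]] := @G_fire [::] _ _ _ _ _ _ _ _ _ _ false g fN xA0 nA02 tk (fun h : false => match notF h with end).
  have ew : pf ([::] ++ 2 :: k1) u (~~ e) false = u by rewrite /pf /face cat0s nS; case: ifP.
  rewrite ew in f4.
  have [|h1 h2] := okX X1 n1 _ (fire_fv f3); first by move=> w wn; rewrite mem_cat wn.
  exists (Par X1 Y1), rg', pd'; split=> //.
  + exact: us_comm f3 f4.
  + exists X1, R, S1, Y1; split=> //; by move=> w wN; apply: sub; apply: asub.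
  + by rewrite eg.
  + split=> //; first by rewrite /psi /phi decK.
    by move=> c; rewrite eg inE => /eqP->; apply: sub.
Qed.


(** Actions of [R] show [P] only copies, or names created later that [P] does not share; so a face
    known to [P] is the unchanged subject of an action of [S]. *)
Lemma partner_S (R S : term K) w i u e x N' ns b : (w \in A0 -> w < base) -> (w \in fv R -> w < base) ->
  fire (Par R S) i u e x N' ns -> subj_ok ([::] ++ i) u -> (b -> free i) -> w = pf i u e b ->
  exists k S', [/\ i = 2 :: k, b = false, w = u, fire S k u e x S' ns & N' = Par R S'].
Proof.
move=> wA wR fN /= uok bi /eqP ew.
have hatF c : c < 3 -> free i -> w = hat c u -> False.
  move=> c3 fi ew'; have ub : u < base by move: uok; rewrite /subj_ok fi.
  by move: wA; rewrite ew' => /(_ (hat_A0 c3 ub)); rewrite ltnNge hat_base.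
inversion fN as [| |? ? i1 ? ? ? R1 ? f4|? ? i1 ? ? ? S1 ? f4| |]; subst.
  exfalso; move/eqP: ew; rewrite /pf /face own_R; case: ifP => fi.
    by case: (b) => /hatF; apply=> //; case: (e).
  move=> ew; have uR : w \in fv R by rewrite ew (fire_subj f4).
  by move: uok; rewrite /subj_ok fi -ew (A0_base (wR uR)).
exists i1, S1; have oi : own (2 :: i1) = false by apply/negbTE/own_S.
move/eqP: ew; rewrite /pf /face oi; case: ifP => fi; last first.
  by case: (b) bi => [|_ ->]; rewrite ?fi // => /(_ isT).
by case: (b) => [/hatF[]|->] //; case: (e).
Qed.

Definition Sys_back A U V' rg pd j l x ns :=
  [\/ dead V', exists pd', perm_eq pd ((behead j, behead l) :: pd') /\
        [/\ j = 2 :: behead j, l = 2 :: behead l & Sys (x :: ns ++ A) U V' rg pd']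
    | exists i k U' rg' pd', [/\ j = phi i /\ l = phi k, ust U i k x U' ns,
      Sys (x :: ns ++ A) U' V' rg' pd', perm_eq rg (gd (i, k) ++ rg') & perm_eq pd' (ml (i, k) ++ pd)]].

Lemma Sys_bwd A U V rg pd j l x V' ns : Sys A U V rg pd -> {subset fv U <= A} ->
  newnames A x ns -> ust V j l x V' ns -> Sys_back A U V' rg pd j l x ns.
Proof.
move=> [X [R [S [Y [-> -> g sub [A0A XA0 XR]]]]]] UA /andP[xu nA] us.
have xnA w : w \in x :: ns -> w \in A -> False.
  by move=> /(allP nA) /negP.
have XA w : w \in fv X -> w \in A by move=> wX; apply: UA; rewrite /= !mem_cat wX.
have RA w : w \in fv R -> w \in A by move=> wR; apply: UA; rewrite /= !mem_cat wR orbT.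
have NA w : w \in fv (Par R S) -> w \in A.
  by rewrite /= mem_cat => h; apply: UA; rewrite /= !mem_cat -orbA h orbT.
have A0A' : {subset A0 <= x :: ns ++ A} by move=> w /A0A wA; rewrite inE mem_cat wA !orbT.
have frA B : {subset B <= A} -> x \notin B /\ fresh B ns.
  move=> BA; split; first by apply/negP => /BA; apply: xnA; exact: mem_head.
  by apply/allP => w wn; apply/negP => /BA; apply: xnA; rewrite inE wn orbT.
have [xA0 nA0] := frA _ A0A; have [xN nN] := frA _ NA.
have [xns uns] : x \notin ns /\ uniq ns by apply/andP.
have okX (X1 : term K) (ms : seq name) : {subset ms <= ns} -> {subset fv X1 <= x :: ms ++ fv X} ->
    (forall w, w \in fv X1 -> w \in A0 -> w < base) /\ (forall w, w \in fv X1 -> w \in fv R -> w < base).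
  move=> msn h; split=> w /h; rewrite -cat_cons mem_cat => /orP[wn|wX] wA; try by [exact: XA0 | exact: XR].
    by case: (xnA w) => //; [move: wn; rewrite !inE => /orP[->//|/msn->]; rewrite orbT | exact: A0A].
  by case: (xnA w) => //; [move: wn; rewrite !inE => /orP[->//|/msn->]; rewrite orbT | exact: RA].
have okR (R1 : term K) (ms : seq name) : {subset ms <= ns} -> {subset fv R1 <= x :: ms ++ fv R} ->
    forall w, w \in fv X -> w \in fv R1 -> w < base.
  move=> msn h w wX /h; rewrite -cat_cons mem_cat => /orP[wn|]; last exact: XR.
  by case: (xnA w) => //; [move: wn; rewrite !inE => /orP[->//|/msn->]; rewrite orbT | exact: XA].
inversion us as [|? ? i1 k1 ? X1 ? u1|? ? j1 l1 ? Y1 ? u1| | |? ? j1 l1 w e ? X1 Y1 n1 n2 f1 f2]; subst.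
- have [h1 h2] := okX X1 ns (fun w wn => wn) (ust_fv u1).
  apply: Or33; exists [:: 1, 1 & i1], [:: 1, 1 & k1], (Par (SPar X1 R) S), rg, pd; split=> //.
    by do 2 constructor.
  by exists X1, R, S, Y.
- case: (G_ust_back g u1 xA0 nA0 xN nN xns uns) => [d|[pd' [pe g1]]|].
  + by apply: Or31; right.
  + apply: Or32; exists pd'; split=> //; split=> //; by exists X, R, S, Y1.
  case=> i [k [N1 [rg' [pd' [[-> ->] [ti tk] u2 [g1 pr pe]]]]]].
  have [_ _ asub] := ust_addr [::] u2; apply: Or33.
  inversion u2 as [|? ? i1 k1 ? R1 ? u3|? ? i1 k1 ? S1 ? u3| | |? ? i1 k1 u e ? R1 S1 n1 n2 f3 f4]; subst.
  + exists [:: 1, 2 & i1], [:: 1, 2 & k1], (Par (SPar X R1) S), rg', pd'; split=> //.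
      by do 2 constructor.
    exists X, R1, S, Y1; split=> //; first by move=> w wN; apply: sub; apply: asub.
    by split=> //; apply: okR (ust_fv u3).
  + exists (2 :: i1), (2 :: k1), (Par (SPar X R) S1), rg', pd'; split=> //.
      by constructor.
    by exists X, R, S1, Y1; split=> //; move=> w wN; apply: sub; apply: asub.
  + exists [:: 1, 2 & i1], (2 :: k1), (Par (SPar X R1) S1), rg', pd'; split=> //.
      by apply: us_comm f4; constructor.
    exists X, R1, S1, Y1; split=> //; first by move=> w wN; apply: sub; apply: asub.
    by split=> //; apply: okR (fire_fv f3) => w wn; rewrite mem_cat wn.
- have wX := fire_subj f1.
  have n2s : {subset n2 <= n1 ++ n2} by move=> w0 h; rewrite mem_cat h orbT.
  have xn2 : x \notin n2 by apply: contra xns; apply: n2s.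
  have un2 : uniq n2 by move: uns; rewrite cat_uniq => /and3P[].
  case: (G_fire_back g f2 xA0 (fresh_sub n2s nA0) xN (fresh_sub n2s nN) xn2 un2).
  + by move=> d; apply: Or31; right.
  + case=> a' [_ ta ew]; have := XA0 _ wX; rewrite ew => /(_ (mk_A0 ta)).
    by rewrite ltnNge mk_base.
  case=> i [u [b [N1 [rg' [pd' [-> ew [ti bi] f3 [g1 pr pe]]]]]]]; rewrite cat0s in ew ti bi pr.
  have [i1 [S1 [? ? ? f4 ?]]] := partner_S (XA0 _ wX) (XR _ wX) f3 (G_subj g f3) bi ew; clear ew; subst.
  have [_ asub] := fire_addr [::] f3; apply: Or33.
  have [|h1 h2] := okX X1 n1 _ (fire_fv f1); first by move=> w0 wn; rewrite mem_cat wn.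
  exists [:: 1, 1 & j1], (2 :: i1), (Par (SPar X1 R) S1), rg', pd'; split=> //.
  + by apply: us_comm f4; constructor.
  + exists X1, R, S1, Y1; split=> //; by move=> w0 wN; apply: sub; apply: asub.
  + by rewrite /gd /gd1 /= andbF.
Qed.

Lemma Sys_flush A U V rg pd y x : Sys A U V rg pd -> y \in pd ->
  exists V' pd', [/\ ust V (2 :: y.1) (2 :: y.2) x V' [::], Sys (x :: A) U V' rg pd'
    & perm_eq pd (y :: pd')].
Proof.
move=> [X [R [S [Y [-> -> g sub [A0A XA0 XR]]]]]] /(G_flush x g)[Y' [pd' [u g' pe]]].
exists (Par X Y'), pd'; split=> //; first by constructor.
by exists X, R, S, Y'; split=> //; split=> // w /A0A wA; rewrite inE wA orbT.
Qed.

Definition stuck U := forall i k x U' ns, ~ ust U i k x U' ns.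

Lemma Sys_final A U V : Sys A U V [::] [::] -> stuck V -> stuck U.
Proof.
move=> [X [R [S [Y [-> -> g sub [A0A XA0 XR]]]]]] stV i k x U' ns us.
have nstep : ~ can_step Y.
  by move=> [j [l /(_ 0)[Y' [ms u]]]]; apply: (stV _ _ _ _ _ (us_parR X u)).
inversion us as [|? ? ? ? ? ? ? u1|? ? i1 k1 ? S1 ? u1| | |? ? i1 k1 u e ? W S1 n1 n2 f1 f2]; subst.
- inversion u1 as [| | |? ? i1 k1 ? X1 ? u2|? ? i1 k1 ? R1 ? u2|]; subst.
    exact: stV (us_parL Y u2).
  exact: nstep (G_final_ust g erefl (us_parL S u2)).
- exact: nstep (G_final_ust g erefl (us_parR R u1)).
- inversion f1 as [| | | |? ? j1 ? ? ? X1 ? f3|? ? j1 ? ? ? R1 ? f3]; subst; last first.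
    exact: nstep (G_final_ust g erefl (us_comm f3 f2)).
  (* For an action of [S] the face for a partner outside [R] is its own subject, which is what [P]
     looks for. *)
  have [l /(_ x)[Y' [ms fY]]] := G_final_fire false g erefl (fi_parR R f2).
  rewrite (_ : pf _ _ _ _ = u) in fY; last by rewrite /pf /face (negPf (own_S k1)); case: ifP.
  exact: stV (us_comm f3 fY).
Qed.

Lemma Sys_final_back A U V : Sys A U V [::] [::] -> stuck U -> stuck V.
Proof.
move=> [X [R [S [Y [-> -> g sub [A0A XA0 XR]]]]]] stU j l x V' ns us.
inversion us as [|? ? i1 k1 ? X1 ? u1|? ? j1 l1 ? Y1 ? u1| | |? ? j1 l1 w e ? X1 Y1 n1 n2 f1 f2]; subst.
- exact: stU (us_parL S (us_sparL R u1)).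
- have [i [k [N' [ms u2]]]] := G_final_ust_back g erefl erefl u1.
  inversion u2 as [|? ? i1 k1 ? R1 ? u3|? ? i1 k1 ? S1 ? u3| | |? ? i1 k1 u e ? R1 S1 n1 n2 f3 f4]; subst.
  + exact: stU (us_parL S (us_sparR X u3)).
  + exact: stU (us_parR (SPar X R) u3).
  + exact: stU (us_comm (fi_sparR X f3) f4).
- have wX := fire_subj f1.
  case: (G_final_fire_back g erefl f2) => [[a' [_ ta ew]]|[i [u [b [N1 [ms [f3 ew bi]]]]]]].
    by have := XA0 _ wX; rewrite ew => /(_ (mk_A0 ta)); rewrite ltnNge mk_base.
  have [i1 [S1 [? ? ? f4 ?]]] := partner_S (XA0 _ wX) (XR _ wX) f3 (G_subj g f3) bi ew; clear ew; subst.
  exact: stU (us_comm (fi_sparL R f1) f4).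
Qed.

Lemma Sys_state A U V pd : Sys A U V [::] pd -> state U = state V.
Proof.
by move=> [X [R [S [Y [-> -> g _ _]]]]]; rewrite /= -(G_state g erefl) /= mulrA.
Qed.

Lemma Sys_progress A U V rg pd : Sys A U V rg pd -> stuck V -> dead V \/ rg = [::].
Proof.
move=> [X [R [S [Y [_ -> g _ _]]]]] st; case: (G_progress g) => [d|->|]; [by left; right|by right|].
by move=> [j [l /(_ 0)[Y' [ns u]]]]; case: (st _ _ _ _ _ (us_parR X u)).
Qed.

(** * From opened forms to terms, then to runs *)

Definition Rel T T' rg pd := exists A U V zs ws,
  [/\ stripped A T U zs, stripped A T' V ws & Sys A U V rg pd].

Definition dead_end T := exists A U zs, stripped A T U zs /\ dead U.

Definition ph (a : position * position) := (phi a.1, phi a.2).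
Definition ps (a : position * position) := (psi a.1, psi a.2).
Definition gds (c : seq (position * position)) := flatten (map gd c).
Definition mls (c : seq (position * position)) := flatten (map ml c).

Lemma dead_end_state T : dead_end T -> state T = 0%R.
Proof. by move=> [A [U [zs [[_ s _ _ _ _] d]]]]; rewrite (sr_state s) dead_state. Qed.

Lemma dead_end_valid T p T1 : valid_to T p T1 -> dead_end T -> dead_end T1.
Proof.
elim=> {T p T1} // T i k T1 p T2 st _ IH [A [U [zs [s d]]]]; apply: IH.
have [x [ns [U' [zs' [us _ s']]]]] := stripped_step [::] s st.
by exists (x :: ns ++ A), U', zs'; split=> //; apply: dead_ust us d.
Qed.

Definition consistent (c : seq (position * position)) :=
  forall d, d \in gds c -> d.1 \in adr -> t d.1 = Some d.2.

Lemma Rel_fwd T T' rg pd y T1 : Rel T T' rg pd -> step T (Int y.1 y.2) T1 -> consistent [:: y] ->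
  exists T1' rg' pd', [/\ step T' (Int (ph y).1 (ph y).2) T1', Rel T1 T1' rg' pd',
    perm_eq rg (gd y ++ rg'), perm_eq pd' (ml y ++ pd) &
    ps (ph y) = y /\ forall d, d \in gd y -> d.1 \in adr].
Proof.
move=> [A [U [V [zs [ws [s1 s2 sy]]]]]] st co.
have [x [ns [U' [zs' [us nn s1']]]]] := stripped_step [::] s1 st; rewrite cats0 in nn.
have co' c : c \in gd (y.1, y.2) -> c.1 \in adr -> t c.1 = Some c.2.
  by rewrite -surjective_pairing => h; apply: co; rewrite /gds /= cats0.
have [V' [rg' [pd' [us2 sy' pr pe [e1 e2 ga]]]]] := Sys_fwd sy (stripped_fvU s1) nn us co'.
have [T1' [ws' [st' s2']]] := stripped_ust s2 us2 nn.
rewrite -surjective_pairing in pr pe ga; exists T1', rg', pd'; split=> //.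
  by exists (x :: ns ++ A), U', V', zs', ws'.
by split=> //; rewrite /ps /= e1 e2 -surjective_pairing.
Qed.

Lemma Rel_flush T T' rg pd y : Rel T T' rg pd -> y \in pd ->
  exists T1' pd', [/\ step T' (Int (2 :: y.1) (2 :: y.2)) T1', Rel T T1' rg pd'
    & perm_eq pd (y :: pd')].
Proof.
move=> [A [U [V [zs [ws [s1 s2 sy]]]]]] ypd; have [x xA] := fresh_name A.
have [V' [pd' [us sy' pe]]] := Sys_flush x sy ypd.
have nn : newnames A x [::] by rewrite /newnames /= xA.
have [T1' [ws' [st' s2']]] := stripped_ust s2 us nn.
exists T1', pd'; split=> //; exists (x :: A), U, V', zs, ws'; split=> //.
by apply: strippedW s1 => w wA; rewrite inE wA orbT.
Qed.

Lemma Rel_bwd T T' rg pd y T1' : Rel T T' rg pd -> step T' (Int y.1 y.2) T1' ->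
  [\/ dead_end T1', exists pd' z, [/\ y = (2 :: z.1, 2 :: z.2), perm_eq pd (z :: pd') & Rel T T1' rg pd']
    | exists (a : position * position) T1 rg' pd', [/\ y = ph a, step T (Int a.1 a.2) T1, Rel T1 T1' rg' pd',
      perm_eq rg (gd a ++ rg') & perm_eq pd' (ml a ++ pd)]].
Proof.
move=> [A [U [V [zs [ws [s1 s2 sy]]]]]] st.
have [x [ns [V' [ws' [us nn s2']]]]] := stripped_step [::] s2 st; rewrite cats0 in nn.
case: (Sys_bwd sy (stripped_fvU s1) nn us) => [d|[pd' [pe [e1 e2 sy']]]|].
- by apply: Or31; exists (x :: ns ++ A), V', ws'.
- apply: Or32; exists pd', (behead y.1, behead y.2); rewrite -e1 -e2 -surjective_pairing; split=> //.
  exists (x :: ns ++ A), U, V', zs, ws'; split=> //.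
  by apply: strippedW s1 => w wA; rewrite inE mem_cat wA !orbT.
- move=> [i [k [U' [rg' [pd' [[e1 e2] us1 sy' pr pe]]]]]]; apply: Or33.
  have [T1 [zs' [st' s1']]] := stripped_ust s1 us1 nn.
  exists (i, k), T1, rg', pd'; split=> //; first by rewrite /ph /= -e1 -e2 -surjective_pairing.
  by exists (x :: ns ++ A), U', V', zs', ws'.
Qed.

Definition halted T := forall (a : position * position) T2, ~ step T (Int a.1 a.2) T2.

Lemma halted_stuck A T U zs : stripped A T U zs -> halted T <-> stuck U.
Proof.
move=> s; split=> h.
  by move=> i k x U' ns /(stuck_ust s)[T' /(h (i, k))].
by move=> a T2 /(stripped_step [::] s)[x [ns [U' [zs' [/h]]]]].
Qed.

Lemma Rel_final T T' : Rel T T' [::] [::] -> halted T <-> halted T'.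
Proof.
move=> [A [U [V [zs [ws [s1 s2 sy]]]]]]; rewrite (halted_stuck s1) (halted_stuck s2).
by split; [apply: Sys_final_back sy | apply: Sys_final sy].
Qed.

Lemma Rel_state T T' pd : Rel T T' [::] pd -> state T = state T'.
Proof.
move=> [A [U [V [zs [ws [[_ s1 _ _ _ _] [_ s2 _ _ _ _] sy]]]]]].
by rewrite (sr_state s1) (sr_state s2) (Sys_state sy).
Qed.

Lemma Rel_progress T T' rg pd : Rel T T' rg pd -> halted T' -> dead_end T' \/ rg = [::].
Proof.
move=> [A [U [V [zs [ws [s1 s2 sy]]]]]] /(halted_stuck s2)/(Sys_progress sy)[d|->]; last by right.
by left; exists A, V, ws.
Qed.

Lemma gds_cons y c : gds (y :: c) = gd y ++ gds c. Proof. by []. Qed.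
Lemma mls_cons y c : mls (y :: c) = ml y ++ mls c. Proof. by []. Qed.

(** No test is performed along the way: those enabled by [c] accumulate in [pd'] and are left to
    [path_flush]. *)
Lemma path_fwd T c T1 : valid_to T c T1 -> forall T' rg pd, Rel T T' rg pd -> consistent c ->
  exists T1' rg' pd', [/\ valid_to T' (map ph c) T1', Rel T1 T1' rg' pd',
    perm_eq rg (gds c ++ rg'), perm_eq pd' (mls c ++ pd) &
    {in c, cancel ph ps} /\ forall d, d \in gds c -> d.1 \in adr].
Proof.
elim=> {T c T1} [T|T i k T1 c T2 st v IH] T' rg pd re co.
  by exists T', rg, pd; split=> //; constructor.
have [|T1' [rg1 [pd1 [st' re1 pr1 pe1 [ea ga]]]]] := Rel_fwd (y := (i, k)) re st.
  by move=> d; rewrite /gds /= cats0 => dg; apply: co; rewrite gds_cons mem_cat dg.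
have [|T2' [rg2 [pd2 [v' re2 pr2 pe2 [ec gc]]]]] := IH _ _ _ re1.
  by move=> d dg; apply: co; rewrite gds_cons mem_cat dg orbT.
exists T2', rg2, pd2; split=> //.
- by econstructor; eassumption.
- by rewrite (perm_trans pr1) // gds_cons -catA perm_cat2l.
- by rewrite (perm_trans pe2) // mls_cons (perm_trans (perm_cat (perm_refl _) pe1)) // perm_catCA catA.
- split=> [a|d]; first by rewrite inE => /orP[/eqP->|/ec].
  by rewrite gds_cons mem_cat => /orP[/ga|/gc].
Qed.

Lemma path_flush T T' rg m pd : Rel T T' rg pd -> perm_eq pd m ->
  exists2 T1', valid_to T' (lift [:: 2] m) T1' & Rel T T1' rg [::].
Proof.
elim: m T' pd => [|y m IH] T' pd re pe.
  move/perm_nilP: pe => e; rewrite e in re; exists T' => //; constructor.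
have [|T1' [pd' [st re' pe']]] := Rel_flush (y := y) re; first by rewrite (perm_mem pe) mem_head.
have pe2 : perm_eq pd' m by rewrite -(perm_cons y) -(permPl pe').
by have [T2' v re2] := IH _ _ re' pe2; exists T2' => //; econstructor; eassumption.
Qed.

(** A path of the translation performs tests at arbitrary moments. The permutation is a balance:
    tests done in [q] and tests still pending, against those pending initially and those enabled by
    [c]. *)
Lemma path_bwd T' q T1' : valid_to T' q T1' -> forall T rg pd, Rel T T' rg pd ->
  dead_end T1' \/ exists c T1 rg' pd', [/\ valid_to T c T1, Rel T1 T1' rg' pd',
    perm_eq rg (gds c ++ rg') & perm_eq (q ++ lift [:: 2] pd') (map ph c ++ lift [:: 2] (mls c ++ pd))].
Proof.
elim=> {T' q T1'} [T'|T' i k T1' q T2' st v IH] T rg pd re.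
  by right; exists [::], T, rg, pd; split=> //; constructor.
case: (Rel_bwd (y := (i, k)) re st) => [d|[pd1 [z [[ei ek] pe re1]]]|[a [T1 [rg1 [pd1 [ea st1 re1 pr1 pe1]]]]]].
- by left; apply: dead_end_valid v d.
- case: (IH _ _ _ re1) => [|[c [T1 [rg2 [pd2 [v1 re2 pr2 pe2]]]]]]; [by left|right].
  exists c, T1, rg2, pd2; split=> //; subst i k.
  rewrite cat_cons; apply: (@perm_trans _ ((2 :: z.1, 2 :: z.2) :: map ph c ++ lift [:: 2] (mls c ++ pd1))).
    by rewrite perm_cons.
  rewrite -[_ :: _]cat1s perm_catCA perm_cat2l /lift !map_cat perm_catCA perm_cat2l perm_sym.
  exact: (perm_map (fun y => (2 :: y.1, 2 :: y.2)) pe).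
- case: (IH _ _ _ re1) => [|[c [T2 [rg2 [pd2 [v1 re2 pr2 pe2]]]]]]; [by left|right].
  exists (a :: c), T2, rg2, pd2; split=> //.
  + by case: (a) st1 => i1 k1 /= st1; econstructor; eassumption.
  + by rewrite (perm_trans pr1) // gds_cons -catA perm_cat2l.
  + rewrite ea /= perm_cons (perm_trans pe2) // perm_cat2l mls_cons.
    apply: perm_map; by rewrite (perm_trans (perm_cat (perm_refl _) pe1)) // perm_catCA catA.
Qed.

Lemma gl_addr a T : gl a T = pmap (fun d => omap (pair d) (t d)) (addr a T).
Proof.
elim: T a => //= [n e P IP|P IP Q IQ|P IP Q IQ] a; last by rewrite IP IQ pmap_cat.
  by rewrite IP; case: (t a).
by rewrite IP IQ pmap_cat.
Qed.

(** The guess that [c] itself realises. On a valid path the order of the two tests is immaterial, by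
    [gds_fun]. *)
Definition gf c d := if (d, true) \in gds c then Some true
  else if (d, false) \in gds c then Some false else None.

Lemma loc_inj i k d : loc i = Some d -> loc k = Some d -> i = k.
Proof.
by case: i k => [|[|[|[|i]]] [|[|[|[|j]]] s]] [|[|[|[|k]]] [|[|[|[|l]]] r]] //= [<-] [] *; subst.
Qed.

Lemma valid_shared T c T1 (y z : position * position) i : valid_to T c T1 -> y \in c -> z \in c ->
  i \in [:: y.1; y.2] -> i \in [:: z.1; z.2] -> y = z.
Proof.
move=> v; elim: v y z => {T c T1} // T j l T1 c T2 st v IH y z.
have sep (w : position * position) : w \in c -> i \in [:: w.1; w.2] -> i \in [:: j; l] -> False.
  move=> wc iw ij; have := @valid_nopre _ T (j, l) c T2 w (vt_cons st v) wc.
  by move/nopreP => /(_ i i ij iw); rewrite prefix_refl.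
rewrite !inE => /orP[/eqP->|yc] /orP[/eqP->|zc] //= iy iz; last by apply: IH; rewrite ?inE.
  by case: (sep z zc); rewrite ?inE.
by case: (sep y yc); rewrite ?inE.
Qed.

Definition gval d k := free d && if loc k is Some q then own q else false.

Lemma gd1P i k d b : (d, b) \in gd1 i k -> loc i = Some d /\ b = gval d k.
Proof. by rewrite /gd1; case: (loc i) => // q; rewrite inE => /eqP[-> ->]. Qed.

(** A path uses each position in a single label, so the partner of an address, and with it the
    realised guess, is unique. *)
Lemma gds_fun T c T1 d b b' : valid_to T c T1 -> (d, b) \in gds c -> (d, b') \in gds c -> b = b'.
Proof.
move=> v /flatten_mapP[y yc h] /flatten_mapP[z zc h'].
have [i [k [iy ey li ->]]] : exists i k, [/\ i \in [:: y.1; y.2], y = (i, k) \/ y = (k, i),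
    loc i = Some d & b = gval d k].
  move: h; rewrite mem_cat => /orP[]/gd1P[li ->].
    by exists y.1, y.2; rewrite -surjective_pairing inE eqxx; split=> //; left.
  by exists y.2, y.1; rewrite -surjective_pairing !inE eqxx orbT; split=> //; right.
have [j [l [jz ez lj ->]]] : exists i k, [/\ i \in [:: z.1; z.2], z = (i, k) \/ z = (k, i),
    loc i = Some d & b' = gval d k].
  move: h'; rewrite mem_cat => /orP[]/gd1P[lj ->].
    by exists z.1, z.2; rewrite -surjective_pairing inE eqxx; split=> //; left.
  by exists z.2, z.1; rewrite -surjective_pairing !inE eqxx orbT; split=> //; right.
have ij := loc_inj li lj; rewrite -ij in jz.
have yz := valid_shared v yc zc iy jz; subst j y.
by case: ey ez => -> [] [] * //; subst.
Qed.

Lemma gf_eq T c T1 d b : valid_to T c T1 -> (d, b) \in gds c -> gf c d = Some b.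
Proof.
move=> v h; rewrite /gf; case: ifP => [h'|ht]; first by rewrite (gds_fun v h h').
by case: b h => h; [rewrite h in ht | rewrite h].
Qed.

Lemma gf_mem c d b : gf c d = Some b -> (d, b) \in gds c.
Proof. by rewrite /gf; case: ifP => [? [<-]|_] //; case: ifP => // ? [<-]. Qed.

Lemma gf_perm c c' : perm_eq c c' -> gf c =1 gf c'.
Proof.
move=> pe d; have m b : ((d, b) \in gds c) = ((d, b) \in gds c').
  by apply: perm_mem; apply: perm_flatten; apply: perm_map.
by rewrite /gf !m.
Qed.

(** A canonical representative among the runs of the translation: the translated labels, then all
    tests. *)
Definition encode c := map ph c ++ lift [:: 2] (mls c).

(** The first position of a test begins and ends with 2. A translated position begins with 1 when it
    lies in [P], and otherwise ends with the 1 that [fpos] appends. *)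
Lemma encode_filter c :
  [seq y <- encode c | (head 0 y.1 == 1) || (last 0 y.1 == 1)] = map ph c.
Proof.
rewrite filter_cat (@eq_in_filter _ _ predT) ?filter_predT => [|y].
  rewrite (@eq_in_filter _ _ pred0) ?filter_pred0 ?cats0 // => y /lift_mem[z].
  case/flatten_mapP => a _; rewrite mem_cat /ml1.
  have mlF j : z \in (if loc j is Some p then [:: mlab p] else [::]) -> exists p, z = mlab p.
    by case: (loc j) => // p; rewrite inE => /eqP->; exists p.
  by case/orP => /mlF[p -> ->] /=; rewrite last_cat.
move/mapP => [a _ ->]; rewrite /ph /= /phi.
by case: (a.1) => [|[|[|[|i]]] [|[|[|[|j]]] s]] //=; rewrite /fpos last_cat ?orbT.
Qed.

Lemma encode_perm c c' : {in c, cancel ph ps} -> {in c', cancel ph ps} ->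
  perm_eq (encode c) (encode c') = perm_eq c c'.
Proof.
move=> hc hc'; apply/idP/idP => pe.
  have := perm_filter (fun y : position * position => (head 0 y.1 == 1) || (last 0 y.1 == 1)) pe.
  rewrite !encode_filter => /(perm_map ps); rewrite -!map_comp.
  by rewrite (map_id_in hc) (map_id_in hc').
by apply: perm_cat; [exact: perm_map|apply: perm_map; apply: perm_flatten; exact: perm_map].
Qed.

Definition guessed T p := maximal T p /\ {in adr, gf p =1 t}.

Lemma guessed_fwd T T' rg c : Rel T T' rg [::] -> uniq adr ->
  rg = pmap (fun d => omap (pair d) (t d)) adr -> guessed T c ->
  {in c, cancel ph ps} /\ maximal T' (encode c) /\ value T c = value T' (encode c).
Proof.
move=> re ua erg [mc tc]; have v := maximal_valid mc.
have co : consistent c by case=> d b /(gf_eq v) h ad; rewrite /= -tc.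
have [T1 [rg' [pd' [v1 re1 pr pe [hc ga]]]]] := path_fwd v re co.
rewrite cats0 in pe; have [T2 v2 re2] := path_flush re1 pe.
have v' : valid_to T' (encode c) T2 by apply/valid_to_cat; exists T1.
(* A guess left over would also be realised by [c], which agrees with [t] on all of [adr]; but [rg]
   has no duplicates. *)
have rg0 : rg' = [::].
  case: rg' pr {re1 re2} => // [[d b] rg'] pr.
  have u : uniq (gds c ++ (d, b) :: rg').
    rewrite -(perm_uniq pr) erg; apply: (@pmap_uniq _ _ _ (fun y : position * bool => y.1)) ua.
    by move=> z; case: (t z).
  have dr : (d, b) \in rg by rewrite (perm_mem pr) mem_cat mem_head orbT.
  have [ad td] : d \in adr /\ t d = Some b.
    move: dr; rewrite erg mem_pmap => /mapP[z az]; case ez: (t z) => [b'|] //= [-> ->].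
    by rewrite az ez.
  have dg : (d, b) \in gds c by apply: gf_mem; rewrite tc.
  by move: u; rewrite cat_uniq /= dg /= andbF.
subst rg'; split=> //; split.
  apply/(maximalP v')/(Rel_final re2)/(maximalP v) => //.
by rewrite /value (after_eq v') (Rel_state re2).
Qed.

(** A halted translation has no pending test, and it is either dead, hence of value 0, or without
    unrealised guesses; in the latter case the path extracted from [q] realises exactly [t]. *)
Lemma guessed_bwd T T' rg q : Rel T T' rg [::] ->
  rg = pmap (fun d => omap (pair d) (t d)) adr -> maximal T' q ->
  value T' q = 0%R \/ exists2 c, guessed T c & perm_eq q (encode c).
Proof.
move=> re erg mq; have v := maximal_valid mq; have hq := (maximalP v).1 mq.
case: (path_bwd v re) => [d|[c [T1 [rg' [pd' [v1 re1 pr pe]]]]]].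
  by left; rewrite /value dead_end_state.
have pd0 : pd' = [::].
  case: pd' re1 {pe} => // y pd' /(Rel_flush (y := y))[|T2 [pd2 [st _ _]]]; first exact: mem_head.
  by case: (hq (2 :: y.1, 2 :: y.2) _ st).
rewrite pd0 !cats0 in pe re1; case: (Rel_progress re1 hq) => [d|rg0].
  by left; rewrite /value dead_end_state.
subst rg'; rewrite cats0 in pr; right; exists c => //; split.
  by apply/(maximalP v1)/(Rel_final re1).
move=> d ad; have m b : ((d, b) \in gds c) = (t d == Some b).
  rewrite -(perm_mem pr) erg mem_pmap; apply/mapP/eqP => [[z _]|td].
    by case ez: (t z) => [b'|] //= [-> ->].
  by exists d; rewrite ?td.
by rewrite /gf !m; case: (t d) => [[]|].
Qed.

Lemma guess_outcome T T' rg : Rel T T' rg [::] -> lc T -> lc T' -> uniq adr ->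
  rg = pmap (fun d => omap (pair d) (t d)) adr -> permsum (guessed T) (value T) (outcome T').
Proof.
move=> re lT lT' ua erg; have [L hL] := valid_finite lT.
have [|ps tr] := @perm_transversal_ex _ (guessed T) L; first by move=> p [[/hL]].
have s : permsum (guessed T) (value T) (\sum_(p <- ps) value T p)%R by exists ps.
suff <- : (\sum_(p <- ps) value T p)%R = outcome T' by [].
apply: (permsum_map (h := encode) s (outcome_permsum lT') (value_permfun lT')).
- by move=> p /(guessed_fwd re ua erg)[].
- by move=> p q /(guessed_fwd re ua erg)[hp _] /(guessed_fwd re ua erg)[hq _]; apply: encode_perm.
- by move=> q /(guessed_bwd re erg).
Qed.

Lemma Rel_init P R S : lc P -> lc R -> lc S -> addr [::] (Par R S) = adr ->
  wk [::] (Par R S) -> (forall w, w \in fv P -> w < base) ->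
  Rel (Par (SPar P R) S) (Par P (tr [::] (Par R S))) (gl [::] (Par R S)) [::].
Proof.
move=> lP lR lS ea w0 Pb; set T := Par (SPar P R) S; set T' := Par P _.
have lT : lc T by rewrite /T lc_par lc_spar lP lR.
have [U [zs [s fA]]] := stripped_ex A0 lT.
have [_ sU us fT _ _] := s.
have [V [S1 [z12 [z3 [eU ez sV s3]]]]] := sr_par_inv sU; subst U zs.
have [X [R1 [z1 [z2 [eV ez s1 s2]]]]] := sr_spar_inv sV; subst V z12.
move: (fA); rewrite !fresh_catl -andbA => /and3P[f1 f2 f3].
have [|Y sY g] := G_strip (sr_par s2 s3) w0; first by rewrite fresh_catl f2.
exists (A0 ++ fv T ++ (z1 ++ z2) ++ z3), (Par (SPar X R1) S1), (Par X Y), ((z1 ++ z2) ++ z3), (z1 ++ (z2 ++ z3)).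
have fvT' : {subset fv T' <= A0 ++ fv T}.
  move=> w; rewrite /T' /= mem_cat => /orP[wP|/(tr_fv w0)]; first by rewrite !mem_cat wP !orbT.
  by rewrite /T /= !mem_cat => /orP[/orP[]|] ->; rewrite ?orbT.
split.
- by apply: strippedW s => w wA; rewrite mem_cat wA orbT.
- split.
  + by rewrite /T' lc_par lP; apply: (@lc_tr 0 [::] (Par R S)); apply/andP.
  + exact: sr_par s1 sY.
  + by rewrite catA.
  + apply: (freshW fvT'); rewrite catA fresh_cat fA.
    exact: fT.
  + by move=> w /fvT'; rewrite !mem_cat => /orP[]->; rewrite ?orbT.
  + by move=> w; rewrite !mem_cat => /or3P[]->; rewrite ?orbT.
- exists X, R1, S1, Y; split=> //.
    by rewrite -ea /= (addr_sr _ s2) (addr_sr _ s3).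
  have Xw w : w \in fv X -> w < base \/ w \in z1.
    by move/(sr_fv s1); rewrite mem_cat => /orP[/Pb|]; [left|right].
  split=> [w wA|w /Xw[//|wz] wA|w /Xw[//|wz] /(sr_fv s2)]; first by rewrite mem_cat wA.
    by have := allP f1 _ wz; rewrite wA.
  have wz' : w \in (z1 ++ z2) ++ z3 by rewrite !mem_cat wz.
  rewrite mem_cat => /orP[wR|wz2].
    by have := allP fT _ wz'; rewrite /T /= !mem_cat wR orbT.
  by move: us; rewrite cat_uniq => /and3P[]; rewrite cat_uniq => /and3P[_ /hasPn/(_ _ wz2)]; rewrite /= wz.
Qed.

Lemma addr_prefix a T d : d \in addr a T -> prefix a d.
Proof.
elim: T a => //= [n e P IP|P IP|P IP Q IQ|P IP Q IQ] a; rewrite ?inE ?mem_cat.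
- by case/orP => [/eqP->|/IP/prefix_rcons_trans //]; rewrite prefix_refl.
- by move/IP/prefix_rcons_trans.
- by case/orP => [/IP|/IQ]/prefix_rcons_trans.
- by case/orP => [/IP|/IQ]/prefix_rcons_trans.
Qed.

Lemma addr_uniq a T : uniq (addr a T).
Proof.
have disj (P Q : term K) k : ~~ has (mem (addr (rcons k 1) P)) (addr (rcons k 2) Q).
  apply/hasPn => d /addr_prefix p2; apply/negP => /addr_prefix p1.
  by move: p1 p2; rewrite !prefixE !size_rcons => /eqP-> /eqP/rcons_inj[].
elim: T a => //= [n e P IP|P IP Q IQ|P IP Q IQ] a.
- by rewrite IP andbT; apply/negP => /addr_prefix/size_prefix; rewrite size_rcons ltnn.
- by rewrite cat_uniq IP IQ disj.
- by rewrite cat_uniq IP IQ disj.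
Qed.
End System.
End Guess.

(** * Concrete guesses and names, and the case of composition without interaction *)

Section Instance.
Variable K : comPzSemiRingType.
Implicit Types (P R S T : term K) (i d : position).

Fixpoint free_at T i : bool := match T, i with
| Act n _ _, [::] => if n is F _ then true else false
| Act _ _ P, 1 :: i | Diam P, 1 :: i | Par P _, 1 :: i | SPar P _, 1 :: i => free_at P i
| Par _ P, 2 :: i | SPar _ P, 2 :: i => free_at P i
| Nu P, i => free_at P i
| _, _ => false end.

Lemma wk_free_at (free : pred position) base A0 a T : (forall i, free (a ++ i) = free_at T i) ->
  (forall w, w \in fv T -> w < base) -> wk free base A0 a T.
Proof.
elim: T a => //= [n e P IP|P IP|P IP Q IQ|P IP Q IQ] a fE fb.
- apply/andP; split; last first.
    apply: IP => [i|w wP]; first by rewrite cat_rcons fE.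
    by apply: fb; rewrite mem_cat wP orbT.
  have := fE [::]; rewrite cats0; case: n fb {fE} => [u|j] fb -> //=.
  by apply: fb; rewrite mem_head.
- by apply: IP => [i|//]; rewrite cat_rcons fE.
- apply/andP; split; [apply: IP|apply: IQ] => [i|w wP|i|w wP]; rewrite ?cat_rcons ?fE //;
    by apply: fb; rewrite mem_cat wP ?orbT.
- apply/andP; split; [apply: IP|apply: IQ] => [i|w wP|i|w wP]; rewrite ?cat_rcons ?fE //;
    by apply: fb; rewrite mem_cat wP ?orbT.
Qed.

(** The family [F] depends only on [R], [S] and [base], so that it serves for all [P] with names
    below [base] at once. *)
Lemma spar_decompose R S base : lc R -> lc S -> (forall w, w \in fv (Par R S) -> w < base) ->
  exists I : finType, exists2 F : I -> term K, forall k, lc (F k) &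
    forall P, lc P -> (forall w, w \in fv P -> w < base) ->
      outcome (Par (SPar P R) S) = (\sum_k outcome (Par P (F k)))%R.
Proof.
move=> lR lS Nb; pose N := Par R S; pose adr := addr [::] N; pose n := size adr.
pose own d := head 0 d == 1; pose free := free_at N.
(* Copies and test names are the two summands of one countable type, encoded above [base];
   injectivity and disjointness come from [pickle]. *)
pose hat c u : name := base + pickle (inr (c, u) : position + nat * nat).
pose mk d : name := base + pickle (inl d : position + nat * nat).
pose A0 := iota 0 base ++ [seq hat c u | c <- iota 0 3, u <- iota 0 base] ++ map mk adr.
(* The default [None] declares every address outside [adr] unfired, so test names are only needed
   for [adr]. *)
pose t (tup : n.-tuple (option bool)) d := nth None tup (index d adr).
have tadr tup d : t tup d -> d \in adr.
  by rewrite -index_mem /t; case: ltnP => // h; rewrite nth_default // size_tuple.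
have A0_base u : u < base -> u \in A0 by rewrite mem_cat mem_iota => ->.
have hat_A0 c u : c < 3 -> u < base -> hat c u \in A0.
  move=> c3 ub; rewrite mem_cat; apply/orP; right; rewrite mem_cat; apply/orP; left.
  by apply/allpairsP; exists (c, u); rewrite !mem_iota.
have hat_base c u : base <= hat c u by apply: leq_addr.
have hat_inj c u c' u' : hat c u = hat c' u' -> c = c' /\ u = u'.
  by move=> /addnI/(pcan_inj pickleK)[-> ->].
have mk_A0 tup d : t tup d -> mk d \in A0.
  by move/tadr => dA; rewrite !mem_cat map_f // !orbT.
have mk_base d : base <= mk d by apply: leq_addr.
have mk_inj : injective mk by move=> d d' /addnI/(pcan_inj pickleK)[->].
have mk_hat d c u : mk d <> hat c u by move=> /addnI/(pcan_inj pickleK).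
have own_R i : own (1 :: i) by [].
have own_S i : ~~ own (2 :: i) by [].
have w0 : wk free base A0 [::] N by apply: wk_free_at.
pose T tup := tr (t tup) free own hat mk [::] N.
have lN : lc N by rewrite /N lc_par lR.
exists {: n.-tuple (option bool)}, T => [tup|]; first exact: lc_tr.
move=> P lP Pb; have lX : lc (Par (SPar P R) S) by rewrite lc_par lc_spar lP lR.
have part tup : permsum (guessed (t tup) free own adr (Par (SPar P R) S)) (value (Par (SPar P R) S))
    (outcome (Par P (T tup))).
  have re := Rel_init own hat_A0 (mk_A0 tup) lP lR lS (erefl adr) w0 Pb.
  apply: (guess_outcome A0_base hat_A0 hat_base hat_inj (mk_A0 tup) mk_base mk_inj mk_hat own_R own_S re) => //.
  - by rewrite lc_par lP; apply: lc_tr.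
  - exact: addr_uniq.
  - exact: gl_addr.
have t_inj tup tup' : {in adr, t tup =1 t tup'} -> tup = tup'.
  move=> h; apply: eq_from_tnth => i; rewrite !(tnth_nth None).
  have ia : nth [::] adr i \in adr by rewrite mem_nth.
  by have := h _ ia; rewrite /t index_uniq ?addr_uniq.
apply: outcomeE lX _.
(* Each maximal run realises exactly one guess, the tuple of its own values of [gf], so the guesses
   partition the runs. *)
apply: (eq_permsum (M := fun p => exists2 tup, tup \in index_enum {: n.-tuple (option bool)}
  & guessed (t tup) free own adr (Par (SPar P R) S) p)).
  move=> p; split=> [[tup _ []]|mp] //.
  have sg : size [seq gf free own p d | d <- adr] == n by rewrite size_map.
  exists (Tuple sg); rewrite ?mem_index_enum //; split=> // d dA.
  by rewrite /t (nth_map [::]) ?index_mem // nth_index.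
apply: permsum_bigcup => [|tup _|tup tup' p q _ _ [_ g1] [_ g2] pe].
- exact: index_enum_uniq.
- exact: part.
- by apply: t_inj => d dA; rewrite -g1 // -g2 // (gf_perm _ _ pe).
Qed.

(** [base] bounds the names of both [P] and [Q], so both outcomes decompose over the same family and
    agree term by term. *)
Lemma obs_equiv_sparL P Q R : lc P -> lc Q -> lc R -> obs_equiv P Q ->
  obs_equiv (SPar P R) (SPar Q R).
Proof.
move=> lP lQ lR e S lS; pose base := (\max_(w <- fv P ++ fv Q ++ fv (Par R S)) w).+1.
have lt w : w \in fv P ++ fv Q ++ fv (Par R S) -> w < base.
  by move=> wN; rewrite ltnS (big_rem w wN) leq_maxl.
have [|I [F lF h]] := @spar_decompose R S base lR lS.
  by move=> w wN; apply: lt; rewrite 2!mem_cat wN !orbT.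
rewrite !h //; first by apply: eq_bigr => k _; apply: e.
  by move=> w wQ; apply: lt; rewrite !mem_cat wQ orbT.
by move=> w wP; apply: lt; rewrite !mem_cat wP.
Qed.

Lemma obs_equiv_sparR P Q R : lc P -> lc Q -> lc R -> obs_equiv P Q ->
  obs_equiv (SPar R P) (SPar R Q).
Proof.
move=> lP lQ lR e S lS; rewrite !(par_spar_comm lR) //.
exact: obs_equiv_sparL.
Qed.

End Instance.

Theorem theorem3p2 (K : comPzSemiRingType) :
  [/\ (forall P : term K, obs_equiv P P),
      (forall P Q : term K, obs_equiv P Q -> obs_equiv Q P),
      (forall P Q R : term K, obs_equiv P Q -> obs_equiv Q R -> obs_equiv P R) &
      (forall P Q : term K, lc P -> lc Q -> obs_equiv P Q ->
        [/\ (forall (u : name) (e : bool) (x : name),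
               obs_equiv (act u e x P) (act u e x Q)),
            (forall R, lc R ->
               [/\ obs_equiv (Par P R) (Par Q R), obs_equiv (Par R P) (Par R Q),
                   obs_equiv (SPar P R) (SPar Q R) & obs_equiv (SPar R P) (SPar R Q)]),
            obs_equiv (Diam P) (Diam Q) &
            (forall x : name, obs_equiv (nu x P) (nu x Q))])].
Proof.
split=> [P S _|P Q e S lS|P Q R e1 e2 S lS|P Q lP lQ e] //; [by rewrite e|by rewrite e1 // e2|].
split=> [u b x|R lR||x].
- exact: obs_equiv_act.
- split; [exact: obs_equiv_parL|exact: obs_equiv_parR|exact: obs_equiv_sparL|exact: obs_equiv_sparR].
- exact: obs_equiv_diam.
- exact: obs_equiv_nu.
Qed.
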